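(* Let $n\ge0$ be an integer and let $\Lambda\subset\mathbb{R}^2$ be a lattice with $(n+1)s(\Lambda)<1$. Let $\gamma_n\in L^2(\mathbb{R})$ be the dual window of $\mathcal{G}(H_n,\Lambda)$ whose Bargmann transform is $$ G_n(z)=\mathcal{B}\gamma_n(z)=c\,z^{-1}\,\sigma_{\overline{\Lambda^\circ}}(z)^{n+1}, $$ where $c$ is the normalizing constant for which $\gamma_n$ is a dual window. Set $\kappa=\frac{1-(n+1)s(\Lambda)}{3-(n+1)s(\Lambda)}$. Then there is a constant $C>0$ such that for all $t\in\mathbb{R}$ $$ |\gamma_n(t)|+|\widehat{\gamma_n}(t)|\le C e^{-\pi\kappa t^2}. $$ Furthermore, $$ \|\gamma_n\|_{M^1}\le 4\,c(\overline{\Lambda^\circ})^{n+1}\,\frac{1}{1-(n+1)s(\Lambda)} $$ and $$ \|\gamma_n\|_{L^2(\mathbb{R})}^2\asymp\log\frac{1}{1-(n+1)s(\Lambda)}. $$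
   Context: A lattice is $\Lambda=A\mathbb{Z}^2\subset\mathbb{R}^2$ with $A$ invertible real, and $s(\Lambda)=|\det A|$. $\mathbb{R}^2$ is identified with $\mathbb{C}$ via $(\xi,\eta)\leftrightarrow\xi+i\eta$. Time-frequency shifts: $\pi_z f(t)=e^{2\pi i\xi t}f(t-x)$ for $z=(x,\xi)$. The adjoint lattice is $\Lambda^\circ=\{\mu\in\mathbb{R}^2:\pi_\lambda\pi_\mu=\pi_\mu\pi_\lambda\ \forall\lambda\in\Lambda\}$, and $\overline{\Lambda^\circ}=\{\bar\mu:\mu\in\Lambda^\circ\}\subset\mathbb{C}$. The Hermite functions are $H_k(t)=c_k e^{\pi t^2}\frac{d^k}{dt^k}e^{-2\pi t^2}$ with $c_k$ chosen so that $\|H_k\|_2=1$. A function $\gamma$ is a dual window of $\mathcal{G}(g,\Lambda)=\{\pi_\lambda g:\lambda\in\Lambda\}$ if $f=\sum_{\lambda\in\Lambda}\langle f,\pi_\lambda g\rangle\pi_\lambda\gamma$ for all $f\in L^2(\mathbb{R})$. The Bargmann transform is $\mathcal{B}f(z)=2^{1/4}e^{-\pi z^2/2}\int_{\mathbb{R}}f(t)e^{-\pi t^2}e^{2\pi tz}\,dt$; it is unitary from $L^2(\mathbb{R})$ onto the Fock space of entire functions $F$ with $\int_{\mathbb{C}}|F(z)|^2e^{-\pi|z|^2}dm_z<\infty$ ($dm$ planar Lebesgue measure). The Fourier transform is $\hat f(\xi)=\int f(t)e^{-2\pi i\xi t}dt$. The norm on the Feichtinger algebra is $\|g\|_{M^1}=\int_{\mathbb{R}^2}|\langle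 g,\pi_z\varphi\rangle|\,dz$ with $\varphi(t)=2^{1/4}e^{-\pi t^2}$. For a lattice $L=\{m_1\omega_1+m_2\omega_2:m_1,m_2\in\mathbb{Z}\}\subset\mathbb{C}$ with $\operatorname{Im}(\omega_2/\omega_1)>0$, put $L'=L\setminus\{0\}$ and define the Weierstrass functions $$\sigma(z)=z\prod_{\omega\in L'}\Big(1-\frac z\omega\Big)e^{\frac z\omega+\frac{z^2}{2\omega^2}},\qquad \zeta(z)=\frac1z+\sum_{\omega\in L'}\Big\{\frac1{z-\omega}+\frac1\omega+\frac z{\omega^2}\Big\},$$ the constants $\eta_k=\zeta(z+\omega_k)-\zeta(z)$ ($k=1,2$), $$a(L)=\frac12\,\frac{\eta_2\bar\omega_1-\eta_1\bar\omega_2}{\omega_1\bar\omega_2-\omega_2\bar\omega_1},\qquad \alpha(L)=\frac{\pi}{2s(L)},$$ where $s(L)=\operatorname{Im}(\bar\omega_1\omega_2)$ is the area of a period parallelogram, and the modified sigma function $\sigma_L(z)=\sigma(z)e^{a(L)z^2}$. Let $\Pi_L=\{x\omega_1+y\omega_2:0\le x<1,\ 0\le y<1\}$ and $$c(L)=\sup_{z\in\Pi_L}|\sigma_L(z)|e^{-\alpha(L)|z|^2}.$$ The sign $\asymp$ means that the ratio of the left- and right-hand sides lies between two positive constants. The constant $C$ and the constants implicit in $\asymp$ are allowed to depend on the lattice $\Lambda$ and on $n$. *)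

(* Defs.v *)
From HB Require Import structures.
From mathcomp Require Import all_boot all_order all_algebra finmap.
From mathcomp Require Import all_classical all_reals all_analysis.
From mathcomp.analysis.showcase Require Import summability.
From mathcomp Require Import complex.
Set Implicit Arguments.
Unset Strict Implicit.
Unset Printing Implicit Defensive.
Import Order.TTheory GRing.Theory Num.Theory.
Import numFieldNormedType.Exports.
Local Open Scope classical_set_scope.
Local Open Scope complex_scope.
Local Open Scope ring_scope.

(* Complex numbers are R[i]; normc z : R is the modulus. The topology is that
   of the regular module R[i]^o. *)
Notation normc := Normc.normc.

Section TimeFrequency.
Context {R : realType}.
Implicit Types (f g : R -> R[i]) (z w : R[i]) (p : R * R) (m : int * int).

Definition cexp z : R[i] :=
  (expR (complex.Re z) * cos (complex.Im z))
    +i* (expR (complex.Re z) * sin (complex.Im z)).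

(* Lebesgue integral of a complex-valued function over the real line. *)
Definition cintegral f : R[i] :=
  Rintegral lebesgue_measure setT (fun t => complex.Re (f t))
    +i* Rintegral lebesgue_measure setT (fun t => complex.Im (f t)).

Definition L2norm f : \bar R :=
  Lnorm lebesgue_measure 2%:E (fun t => (normc (f t))%:E).

(* Elements of L^2(R) are represented by functions; statements about them that
   are sensitive to null sets say so explicitly. *)
Definition L2 f : Prop :=
  [/\ measurable_fun setT (fun t => complex.Re (f t)),
      measurable_fun setT (fun t => complex.Im (f t)) &
      (L2norm f < +oo)%E].

Definition inner f g : R[i] := cintegral (fun t => f t * conjc (g t)).

Definition fourier f (xi : R) : R[i] :=
  cintegral (fun t => f t * cexp (0 +i* (- (2 * pi * xi * t)))).

(* p = (x, xi): translation by x followed by modulation by xi. *)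
Definition tfshift p f : R -> R[i] :=
  fun t => cexp (0 +i* (2 * pi * p.2 * t)) * f (t - p.1).

Definition gaussian : R -> R[i] :=
  fun t => (2 `^ 4^-1 * expR (- (pi * t ^+ 2)))%:C.

Definition M1norm f : \bar R :=
  (\int[lebesgue_measure \x lebesgue_measure]_p
     (normc (inner f (tfshift p gaussian)))%:E)%E.

Definition bargmann f z : R[i] :=
  (2 `^ 4^-1)%:C * cexp (- (pi%:C * z ^+ 2 / 2)) *
  cintegral (fun t => f t * (expR (- (pi * t ^+ 2)))%:C
                          * cexp (2 * pi%:C * t%:C * z)).

(* The Hermite function is hermite c k for a constant c such that
   L2norm (hermite c k) = 1. *)
Definition hermite (c : R[i]) (k : nat) : R -> R[i] := fun t =>
  c * (expR (pi * t ^+ 2)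
       * derive1n k (fun u : R => expR (- (2 * pi * u ^+ 2))) t)%:C.

Definition lattice_point (A : 'M[R]_2) m : R * R :=
  (A 0 0 * m.1%:~R + A 0 1 * m.2%:~R, A 1 0 * m.1%:~R + A 1 1 * m.2%:~R).

Definition lattice (A : 'M[R]_2) : set (R * R) := range (lattice_point A).

Definition lattice_area (A : 'M[R]_2) : R := `|\det A|.

(* Commutation as operators on L^2(R). *)
Definition adjoint_lattice (Lambda : set (R * R)) : set (R * R) :=
  [set mu | forall la, Lambda la -> forall f, L2 f ->
     {ae lebesgue_measure, forall t : R,
        tfshift la (tfshift mu f) t = tfshift mu (tfshift la f) t}].

(* The conjugates of the points (x, xi) <-> x + i xi. *)
Definition conj_points (M : set (R * R)) : set R[i] :=
  [set conjc (p.1 +i* p.2) | p in M].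

(* The series over the lattice converges unconditionally in L^2-norm, i.e.
   along the directed set of finite index sets. *)
Definition dual_window g (A : 'M[R]_2) (gamma : R -> R[i]) : Prop :=
  forall f, L2 f ->
    (fun F : {fset int * int} => L2norm (fun t =>
       f t - \sum_(m <- F) inner f (tfshift (lattice_point A m) g)
                           * tfshift (lattice_point A m) gamma t))
      @ totally --> 0%E.

Section Weierstrass.
Variables w1 w2 : R[i].

Definition period m : R[i] := w1 *~ m.1 + w2 *~ m.2.

Definition period_lattice : set R[i] := range period.

(* Products and sums over nonzero periods are unconditional. *)
Definition wsigma z : R[i] :=
  z * lim ((fun F : {fset int * int} =>
    \prod_(m <- F | m != 0)
      ((1 - z / period m)
       * cexp (z / period m + z ^+ 2 / (2 * period m ^+ 2))) : R[i]^o)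
    @ totally).

Definition wzeta z : R[i] :=
  z^-1 + lim ((fun F : {fset int * int} =>
    \sum_(m <- F | m != 0)
      ((z - period m)^-1 + (period m)^-1 + z / period m ^+ 2) : R[i]^o)
    @ totally).

(* The constant value of wzeta (z + w) - wzeta z, for w a period and z away
   from the poles. *)
Definition weta w : R[i] :=
  xget 0 [set e | forall z, ~ period_lattice z -> wzeta (z + w) - wzeta z = e].

Definition period_area : R := complex.Im (conjc w1 * w2).

Definition a_const : R[i] :=
  1 / 2 * ((weta w2 * conjc w1 - weta w1 * conjc w2)
           / (w1 * conjc w2 - w2 * conjc w1)).

Definition alpha_const : R := pi / (2 * period_area).

Definition sigma_mod z : R[i] := wsigma z * cexp (a_const * z ^+ 2).

Definition period_parallelogram : set R[i] :=
  [set z | exists x y : R,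
     [/\ 0 <= x < 1, 0 <= y < 1 & z = x%:C * w1 + y%:C * w2]].

Definition c_const : R :=
  sup [set normc (sigma_mod z) * expR (- (alpha_const * normc z ^+ 2))
      | z in period_parallelogram].

End Weierstrass.

End TimeFrequency.

(* Main.v *)
Require Import Defs.
From HB Require Import structures.
From mathcomp Require Import all_boot all_order all_algebra finmap.
From mathcomp Require Import all_classical all_reals all_analysis.
From mathcomp Require Import measurable_realfun.
From mathcomp Require Import complex ring lra zify.
From mathcomp.analysis.showcase Require Import summability.
Set Implicit Arguments.
Unset Strict Implicit.
Unset Printing Implicit Defensive.
Import Order.TTheory GRing.Theory Num.Theory.
Import numFieldNormedType.Exports.
Local Open Scope classical_set_scope.
Local Open Scope complex_scope.
Local Open Scope ring_scope.

(* Write V f for the short-time Fourier transform of f with the Gaussian window,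
   L for the conjugate of the adjoint lattice, s for the area of the lattice and
   delta = 1 - (n+1) s.  The modified sigma function satisfies
   |sigma_L(z)| <= c(L) exp(alpha(L) |z|^2): by the Legendre relation the weighted
   modulus is L-periodic.  As s(L) = 1/s and |V gamma| is |B gamma| times
   exp(-pi |z|^2 / 2), up to conjugation of z, this yields
   |V gamma(z)| <= |c| c(L)^(n+1) |z|^-1 exp(-pi delta |z|^2 / 2).

   Decay: for fixed x, V gamma(x, .) is the Fourier transform of
   t |-> gamma(t) phi(t - x), so Fourier inversion, used at x = t, turns the
   bound on V gamma into Gaussian decay of gamma; integrating V gamma in x gives
   the decay of the Fourier transform.

   Constant: applying the dual window property to time-frequency shifts of the
   Gaussian and integrating over a fundamental domain gives <gamma, H_n> = s,
   and comparing the Taylor coefficients of B gamma at 0 gives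
   |c| = s sqrt(pi^n / n!) <= (n+1) s.  The M^1 bound follows by integrating
   |z|^-1 exp(-pi delta |z|^2 / 2).  As the implied constants may depend on the
   lattice and on n, the L^2 estimate only needs 0 < ||gamma|| < oo. *)

(** * Complex exponential *)

(** Sigma and zeta are handled only through finite products and sums over square boxes of indices. A
    shift by a period replaces one column of factors by another, so the exponent in the
    quasi-periodicity of sigma and the increment of zeta are limits of the same sequence; neither
    contour integrals nor derivatives of sigma enter. At the other basis vector the column products
    telescope, which gives the Legendre expression modulo [4 pi i]; comparing a Riemann sum with the
    arctangent selects its value.

    The singularity at 0 in the bound on V gamma is only apparent: inside the unit disc the
    Cauchy-Schwarz inequality takes over. The resulting Gaussian exponent [pi delta / 2] is at least
    [pi kappa], because the denominator [3 - (n+1) s] exceeds 2.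

    Coefficients are compared along real [x] tending to 0 from the right. There the Bargmann kernel
    is a translated Gaussian, and its expansion in the translation produces the Hermite functions.
    The inner product with the Hermite function fixes the modulus of the constant because the norm
    of the Taylor coefficient is known from the reproducing kernel [exp (pi x y)]. *)

Section Cplx.
Context {R : realType}.
Implicit Types (z w u v : R[i]) (t a b : R).

Lemma complexP z w : complex.Re z = complex.Re w -> complex.Im z = complex.Im w -> z = w.
Proof. by case: z w => [a b] [c d] /= -> ->. Qed.

Lemma cReM z w : complex.Re (z * w) =
  complex.Re z * complex.Re w - complex.Im z * complex.Im w.
Proof. by case: z w => [a b] [c d]. Qed.

Lemma cImM z w : complex.Im (z * w) =
  complex.Re z * complex.Im w + complex.Im z * complex.Re w.
Proof. by case: z w => [a b] [c d]. Qed.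

Lemma cReD z w : complex.Re (z + w) = complex.Re z + complex.Re w.
Proof. by case: z w => [a b] [c d]. Qed.

Lemma cImD z w : complex.Im (z + w) = complex.Im z + complex.Im w.
Proof. by case: z w => [a b] [c d]. Qed.

Lemma cReN z : complex.Re (- z) = - complex.Re z.
Proof. by case: z. Qed.

Lemma cImN z : complex.Im (- z) = - complex.Im z.
Proof. by case: z. Qed.

Definition ReImE := (cReM, cImM, cReD, cImD, cReN, cImN).

Lemma normc2E z : normc z ^+ 2 = complex.Re z ^+ 2 + complex.Im z ^+ 2.
Proof. by case: z => [a b] /=; rewrite sqr_sqrtr// addr_ge0 ?sqr_ge0. Qed.

Lemma normc_ge0 z : 0 <= normc z.
Proof. by case: z => [a b] /=; exact: sqrtr_ge0. Qed.

Lemma normcC_norm z : `|z| = (normc z)%:C.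
Proof. by case: z. Qed.

Lemma normc_eq0 z : (normc z == 0) = (z == 0).
Proof. by apply/eqP/eqP => [/Normc.eq0_normc//|->]; rewrite Normc.normc0. Qed.

Lemma normc_gt0 z : (0 < normc z) = (z != 0).
Proof. by rewrite lt_def normc_ge0 andbT normc_eq0. Qed.

Lemma normc_real a : normc a%:C = `|a|.
Proof. by rewrite /= expr0n addr0 sqrtr_sqr. Qed.

Lemma normcX z n : normc (z ^+ n) = normc z ^+ n.
Proof.
by elim: n => [|n IH]; rewrite ?expr0 ?Normc.normc1// !exprS Normc.normcM IH.
Qed.

Lemma normc_div z w : normc (z / w) = normc z / normc w.
Proof. by rewrite Normc.normcM Normc.normcV. Qed.

Lemma normcB z w : normc (z - w) = normc (w - z).
Proof. by rewrite -(normcN (z - w)) opprB. Qed.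

Lemma normc_conj z : normc (conjc z) = normc z.
Proof. by case: z => [a b] /=; rewrite sqrrN. Qed.

Lemma le_normcB z w : normc z - normc w <= normc (z - w).
Proof. by rewrite lerBlDr (le_trans _ (le_normcD _ _))// subrK. Qed.

Lemma Re_le_normc z : `|complex.Re z| <= normc z.
Proof.
rewrite -(ler_pXn2r (n := 2)) ?nnegrE ?normc_ge0//.
by rewrite normc2E real_normK ?num_real// lerDl sqr_ge0.
Qed.

Lemma Im_le_normc z : `|complex.Im z| <= normc z.
Proof.
rewrite -(ler_pXn2r (n := 2)) ?nnegrE ?normc_ge0//.
by rewrite normc2E real_normK ?num_real// lerDr sqr_ge0.
Qed.

Lemma normc_le_ReIm z : normc z <= `|complex.Re z| + `|complex.Im z|.
Proof.
rewrite -(ler_pXn2r (n := 2)) ?nnegrE ?normc_ge0 ?addr_ge0//.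
rewrite normc2E sqrrD !real_normK ?num_real// -addrA lerD2l lerDr.
by rewrite mulrn_wge0// mulr_ge0.
Qed.

Lemma normc_sum (I : Type) (r : seq I) (P : pred I) (F : I -> R[i]) :
  normc (\sum_(i <- r | P i) F i) <= \sum_(i <- r | P i) normc (F i).
Proof.
elim/big_ind2: _ => [|x1 x2 y1 y2 h1 h2|//]; first by rewrite Normc.normc0.
by apply: (le_trans (le_normcD _ _)); apply: lerD.
Qed.

Lemma normc_prod (I : Type) (r : seq I) (P : pred I) (F : I -> R[i]) :
  normc (\prod_(i <- r | P i) F i) = \prod_(i <- r | P i) normc (F i).
Proof. by apply: big_morph; [exact: Normc.normcM|exact: Normc.normc1]. Qed.

Lemma mulc_conj z : z * conjc z = (normc z ^+ 2)%:C.
Proof.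
rewrite normc2E; case: z => [a b]; apply: complexP; rewrite /=; ring.
Qed.

Lemma cexpD z w : cexp (z + w) = cexp z * cexp w.
Proof.
apply: complexP; rewrite ReImE /= !(cReD, cImD) expRD ?cosD ?sinD; ring.
Qed.

Lemma cexp0 : cexp 0 = 1 :> R[i].
Proof. by apply: complexP; rewrite /= expR0 ?cos0 ?sin0 mul1r. Qed.

Lemma normc_cexp z : normc (cexp z) = expR (complex.Re z).
Proof.
rewrite /= !exprMn -mulrDr cos2Dsin2 mulr1 sqrtr_sqr ger0_norm// expR_ge0.
Qed.

Lemma cexp_neq0 z : cexp z != 0.
Proof. by rewrite -normc_gt0 normc_cexp expR_gt0. Qed.

Lemma cexpN z : cexp (- z) = (cexp z)^-1.
Proof.
apply: (mulfI (cexp_neq0 z)).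
by rewrite -cexpD subrr cexp0 divff// cexp_neq0.
Qed.

Lemma cexpB z w : cexp (z - w) = cexp z / cexp w.
Proof. by rewrite cexpD cexpN. Qed.

Lemma cexp_sum (I : Type) (r : seq I) (P : pred I) (F : I -> R[i]) :
  cexp (\sum_(i <- r | P i) F i) = \prod_(i <- r | P i) cexp (F i).
Proof. by apply: (big_morph _ cexpD cexp0). Qed.

Lemma cexpMn z n : cexp (z *+ n) = cexp z ^+ n.
Proof.
by elim: n => [|n IH]; rewrite ?mulr0n ?cexp0 ?expr0// mulrS cexpD IH exprS.
Qed.

Lemma cexp_real a : cexp a%:C = (expR a)%:C.
Proof. by apply: complexP; rewrite /= ?cos0 ?sin0 ?mulr1 ?mulr0. Qed.

Lemma cexp_conj z : cexp (conjc z) = conjc (cexp z).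
Proof. by case: z => a b; apply: complexP; rewrite /= ?cosN ?sinN ?mulrN. Qed.

Lemma normc_cexp_i a : normc (cexp (0 +i* a)) = 1.
Proof. by rewrite normc_cexp /= expR0. Qed.

(** The mean value theorem fails for curves in the plane. Applied to the real part of [conjc u * h],
    with [u = h 1 - h 0], whose increment is [normc u ^+ 2], it still yields the inequality. *)
Lemma normc_mean_value (h h' : R -> R[i]) (M : R) :
  (forall t, is_derive t 1 (fun x => complex.Re (h x)) (complex.Re (h' t))) ->
  (forall t, is_derive t 1 (fun x => complex.Im (h x)) (complex.Im (h' t))) ->
  (forall t, 0 <= t <= 1 -> normc (h' t) <= M) ->
  normc (h 1 - h 0) <= M.
Proof.
move=> hRe hIm hM.
have M0 : 0 <= M by apply: (le_trans (normc_ge0 (h' 0))); apply: hM; rewrite lexx ler01.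
set u := h 1 - h 0.
have [->|u0] := eqVneq u 0; first by rewrite Normc.normc0.
pose g t := complex.Re u * complex.Re (h t) + complex.Im u * complex.Im (h t).
pose g' t := complex.Re u * complex.Re (h' t) + complex.Im u * complex.Im (h' t).
have dg t : is_derive t (1 : R) (g : R -> R) (g' t).
  exact: is_deriveD.
have [c hc] : exists2 c, c \in `]0, 1[%R & g 1 - g 0 = g' c * (1 - 0).
  apply: MVT => // t; apply: continuous_subspaceT => x.
  by apply: differentiable_continuous; exact/derivable1_diffP.
rewrite subr0 mulr1 => gE.
have : normc u ^+ 2 <= normc u * M.
  have -> : normc u ^+ 2 = g 1 - g 0.
    by rewrite normc2E /g /u !(cReD, cImD, cReN, cImN); ring.
  rewrite gE; apply: (le_trans (ler_norm _)).
  have -> : g' c = complex.Re (conjc u * h' c).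
    by rewrite cReM /g'; case: (u) => ? ? /=; ring.
  apply: (le_trans (Re_le_normc _)); rewrite Normc.normcM normc_conj.
  apply: ler_wpM2l; first exact: normc_ge0.
  by apply: hM; move: hc; rewrite in_itv /= => /andP[/ltW -> /ltW ->].
by rewrite expr2 ler_pM2l// normc_gt0.
Qed.

Lemma is_derive_cexp_line v t :
  is_derive t 1 (fun x : R => complex.Re (cexp (x%:C * v))) (complex.Re (v * cexp (t%:C * v))) /\
  is_derive t 1 (fun x : R => complex.Im (cexp (x%:C * v))) (complex.Im (v * cexp (t%:C * v))).
Proof.
case: v => a b.
have -> : (fun x : R => complex.Re (cexp (x%:C * (a +i* b)))) = (fun x : R => expR (x * a) * cos (x * b)).
  by apply/funext => x /=; rewrite !mul0r subr0 addr0.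
have -> : (fun x : R => complex.Im (cexp (x%:C * (a +i* b)))) = (fun x : R => expR (x * a) * sin (x * b)).
  by apply/funext => x /=; rewrite !mul0r subr0 addr0.
have da : is_derive t (1 : R) (fun x : R => x * a) a.
  by apply: is_derive_eq; rewrite scaler0 add0r scaler1.
have db : is_derive t (1 : R) (fun x : R => x * b) b.
  by apply: is_derive_eq; rewrite scaler0 add0r scaler1.
have de : is_derive t (1 : R) (fun x : R => expR (x * a)) (a * expR (t * a)).
  have := @is_derive1_comp _ expR (fun x : R => x * a) t _ _ (is_derive_expR (t * a)) da.
  by rewrite mulrC.
have dc : is_derive t (1 : R) (fun x : R => cos (x * b)) (b * - sin (t * b)).
  have := @is_derive1_comp _ cos (fun x : R => x * b) t _ _ (is_derive_cos (t * b)) db.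
  by rewrite mulrC.
have ds : is_derive t (1 : R) (fun x : R => sin (x * b)) (b * cos (t * b)).
  have := @is_derive1_comp _ sin (fun x : R => x * b) t _ _ (is_derive_sin (t * b)) db.
  by rewrite mulrC.
split; apply: is_derive_eq; rewrite !(cReM, cImM) /= !mul0r subr0 addr0 /GRing.scale /=; ring.
Qed.

Lemma normc_scale_le t z : 0 <= t <= 1 -> normc (t%:C * z) <= normc z.
Proof.
move=> /andP[t0 t1]; rewrite Normc.normcM normc_real ger0_norm//.
by rewrite ler_piMl// normc_ge0.
Qed.

Lemma normc_cexp_le z : normc (cexp z) <= expR (normc z).
Proof.
by rewrite normc_cexp ler_expR (le_trans (ler_norm _))// Re_le_normc.
Qed.

Lemma normc_cexp_scale_le t z : 0 <= t <= 1 -> normc (cexp (t%:C * z)) <= expR (normc z).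
Proof.
by move=> t01; rewrite (le_trans (normc_cexp_le _))// ler_expR normc_scale_le.
Qed.

Lemma cexp_taylor0 v : normc (cexp v - 1) <= normc v * expR (normc v).
Proof.
have -> : cexp v - 1 = cexp (1%:C * v) - cexp (0%:C * v).
  by rewrite mul1r mul0r cexp0.
apply: (@normc_mean_value (fun t => cexp (t%:C * v)) (fun t => v * cexp (t%:C * v))).
- by move=> t; have [] := is_derive_cexp_line v t.
- by move=> t; have [] := is_derive_cexp_line v t.
- move=> t t01; rewrite Normc.normcM ler_wpM2l ?normc_ge0//.
  exact: normc_cexp_scale_le.
Qed.

(** Along the segment from 0 to [v], the derivative of a Taylor remainder is [v] times the remainder
    of one order less, so the mean value inequality raises the order by one. The factorials are
    given up. *)
Lemma cexp_taylor1 v : normc (cexp v - 1 - v) <= normc v ^+ 2 * expR (normc v).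
Proof.
pose h t := cexp (t%:C * v) - t%:C * v.
have -> : cexp v - 1 - v = h 1 - h 0.
  by rewrite /h mul1r mul0r cexp0 subr0 addrAC.
apply: (@normc_mean_value h (fun t => v * cexp (t%:C * v) - v)).
- move=> t; have [dr _] := is_derive_cexp_line v t.
  have -> : (fun x => complex.Re (h x)) =
      (fun x => complex.Re (cexp (x%:C * v)) - x * complex.Re v).
    by apply/funext => x; rewrite /h cReD cReN [in X in _ - X]cReM /= mul0r subr0.
  by apply: is_derive_eq; rewrite cReD cReN scaler0 add0r scaler1.
- move=> t; have [_ di] := is_derive_cexp_line v t.
  have -> : (fun x => complex.Im (h x)) =
      (fun x => complex.Im (cexp (x%:C * v)) - x * complex.Im v).
    by apply/funext => x; rewrite /h cImD cImN [in X in _ - X]cImM /= mul0r addr0.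
  by apply: is_derive_eq; rewrite cImD cImN scaler0 add0r scaler1.
- move=> t t01; rewrite -[X in _ - X]mulr1 -mulrBr Normc.normcM expr2 -mulrA.
  rewrite ler_wpM2l ?normc_ge0//; apply: (le_trans (cexp_taylor0 _)).
  by rewrite ler_pM ?normc_ge0 ?expR_ge0 ?ler_expR ?normc_scale_le.
Qed.

Lemma cexp_taylor2 v :
  normc (cexp v - 1 - v - v ^+ 2 / 2) <= normc v ^+ 3 * expR (normc v).
Proof.
pose h t := cexp (t%:C * v) - t%:C * v - (t ^+ 2)%:C * (v ^+ 2 / 2).
have vE : v * v = v ^+ 2 / 2 + v ^+ 2 / 2 by field.
have -> : cexp v - 1 - v - v ^+ 2 / 2 = h 1 - h 0.
  rewrite /h mul1r expr1n mul1r mul0r cexp0 subr0 expr0n /= mul0r subr0; ring.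
apply: (@normc_mean_value h (fun t => v * cexp (t%:C * v) - v - v * (t%:C * v))).
- move=> t; have [dr _] := is_derive_cexp_line v t.
  have -> : (fun x => complex.Re (h x)) =
      (fun x => complex.Re (cexp (x%:C * v)) - x * complex.Re v - x ^+ 2 * complex.Re (v ^+ 2 / 2)).
    apply/funext => x; rewrite /h !cReD !cReN [complex.Re (x%:C * v)]cReM.
    by rewrite [complex.Re ((x ^+ 2)%:C * _)]cReM /= !mul0r !subr0.
  apply: is_derive_eq; rewrite !(cReD, cReN) !scaler0 !add0r !scaler1.
  congr (_ - _ - _); rewrite mulrCA [RHS]cReM /= mul0r subr0 vE cReD /GRing.scale /=; ring.
- move=> t; have [_ di] := is_derive_cexp_line v t.
  have -> : (fun x => complex.Im (h x)) =
      (fun x => complex.Im (cexp (x%:C * v)) - x * complex.Im v - x ^+ 2 * complex.Im (v ^+ 2 / 2)).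
    apply/funext => x; rewrite /h !cImD !cImN [complex.Im (x%:C * v)]cImM.
    by rewrite [complex.Im ((x ^+ 2)%:C * _)]cImM /= !mul0r !addr0.
  apply: is_derive_eq; rewrite !(cImD, cImN) !scaler0 !add0r !scaler1.
  congr (_ - _ - _); rewrite mulrCA [RHS]cImM /= mul0r addr0 vE cImD /GRing.scale /=; ring.
- move=> t t01; have -> : v * cexp (t%:C * v) - v - v * (t%:C * v) =
    v * (cexp (t%:C * v) - 1 - t%:C * v) by ring.
  rewrite Normc.normcM exprS -mulrA.
  rewrite ler_wpM2l ?normc_ge0//; apply: (le_trans (cexp_taylor1 _)).
  apply: ler_pM; rewrite ?exprn_ge0 ?normc_ge0 ?expR_ge0 ?ler_expR ?normc_scale_le//.
  by rewrite lerXn2r ?nnegrE ?normc_ge0// normc_scale_le.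
Qed.

End Cplx.

(** * Unconditional sums and products *)

#[global] Existing Instance totally_filter.

Section Nets.
Context {R : realType}.
Implicit Types (z w u v : R[i]) (t a b : R).

Lemma cvgcP {T : Type} (F : set_system T) {FF : Filter F} (h : T -> R[i]) (l : R[i]) :
  ((h : T -> R[i]^o) @ F --> (l : R[i]^o)) <->
  (forall e : R, 0 < e -> \forall x \near F, normc (l - h x) < e).
Proof.
split=> [/cvgrPdist_lt H e e0|H].
  have e0' : (0 : R[i]) < e%:C by rewrite ltcR.
  by near=> x; rewrite -ltcR -normcC_norm; near: x; exact: H.
apply/cvgrPdist_lt => e e0.
have eE : e = (complex.Re e)%:C by case: e e0 => a b; rewrite ltcE /= => /andP[/eqP -> _].
have e0' : 0 < complex.Re e by move: e0; rewrite ltcE => /andP[].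
near=> x; rewrite normcC_norm eE ltcR; near: x; exact: H.
Unshelve. all: by end_near. Qed.

Lemma cvgc_ReIm {T : Type} (F : set_system T) {FF : Filter F} (h : T -> R[i]) (l : R[i]) :
  ((h : T -> R[i]^o) @ F --> (l : R[i]^o)) <->
  ((fun x => complex.Re (h x)) @ F --> complex.Re l /\
   (fun x => complex.Im (h x)) @ F --> complex.Im l).
Proof.
split=> [/cvgcP H|[/cvgrPdist_lt hr /cvgrPdist_lt hi]].
  split; apply/cvgrPdist_lt => e e0; near=> x.
    by rewrite -cReN -cReD (le_lt_trans (Re_le_normc _))//; near: x; exact: H.
  by rewrite -cImN -cImD (le_lt_trans (Im_le_normc _))//; near: x; exact: H.
apply/cvgcP => e e0; near=> x.
rewrite (le_lt_trans (normc_le_ReIm _))// !(cReD, cImD, cReN, cImN) (splitr e).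
by apply: ltrD; near: x; [apply: hr|apply: hi]; rewrite divr_gt0.
Unshelve. all: by end_near. Qed.

Lemma limc_unique {T : Type} (F : set_system T) {FF : ProperFilter F} (h : T -> R[i]) (l l' : R[i]) :
  ((h : T -> R[i]^o) @ F --> (l : R[i]^o)) ->
  ((h : T -> R[i]^o) @ F --> (l' : R[i]^o)) -> l = l'.
Proof. exact: (@cvg_unique _ (@norm_hausdorff _ R[i]^o)). Qed.

Lemma limcE {T : Type} (F : set_system T) {FF : ProperFilter F} (h : T -> R[i]) (l : R[i]) :
  ((h : T -> R[i]^o) @ F --> (l : R[i]^o)) -> lim ((h : T -> R[i]^o) @ F) = l.
Proof. by move=> H; exact: (@cvg_lim _ (@norm_hausdorff _ R[i]^o)). Qed.

Lemma normc_limit {T : Type} (F : set_system T) {FF : ProperFilter F} (h : T -> R[i]) (l : R[i]) :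
  ((h : T -> R[i]^o) @ F --> (l : R[i]^o)) -> (fun x => normc (h x)) @ F --> normc l.
Proof.
move=> /cvgcP H; apply/cvgrPdist_lt => e e0; near=> x.
apply: (@le_lt_trans _ _ (normc (l - h x))); last by near: x; exact: H.
rewrite ler_norml le_normcB andbT lerNl opprB.
by rewrite normcB le_normcB.
Unshelve. all: by end_near. Qed.

Context {I : choiceType}.
Implicit Types (A B : {fset I}) (F : {fset I} -> R[i]).

Lemma totally_real_cauchy (h : {fset I} -> R) :
  (forall e : R, 0 < e -> exists A0, forall A, (A0 `<=` A)%fset -> `|h A0 - h A| < e) ->
  cvg (h @ totally).
Proof.
move=> H; apply: cauchy_cvg; apply: cauchy_exP => e e0.
have [A0 hA] := H e e0.
exists (h A0); exists A0 => //= A /hA; exact.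
Qed.

Lemma totally_cauchy F :
  (forall e : R, 0 < e -> exists A0, forall A, (A0 `<=` A)%fset -> normc (F A0 - F A) < e) ->
  exists l : R[i], (F : {fset I} -> R[i]^o) @ totally --> (l : R[i]^o).
Proof.
move=> H.
have hr : cvg ((fun A => complex.Re (F A)) @ totally).
  apply: totally_real_cauchy => e /H[A0 hA]; exists A0 => A /hA.
  by apply: le_lt_trans; rewrite -cReN -cReD Re_le_normc.
have hi : cvg ((fun A => complex.Im (F A)) @ totally).
  apply: totally_real_cauchy => e /H[A0 hA]; exists A0 => A /hA.
  by apply: le_lt_trans; rewrite -cImN -cImD Im_le_normc.
by exists (lim ((fun A => complex.Re (F A)) @ totally) +i*
           lim ((fun A => complex.Im (F A)) @ totally)); apply/cvgc_ReIm.
Qed.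

Lemma big_fset_subset (T : Type) (idx : T) (op : Monoid.com_law idx) A B (f : I -> T) :
  (A `<=` B)%fset ->
  \big[op/idx]_(i <- B) f i =
  op (\big[op/idx]_(i <- A) f i) (\big[op/idx]_(i <- (B `\` A)%fset) f i).
Proof.
move=> /fsubsetP AB; rewrite (big_fsetID _ (mem A)) /=; congr (op _ _).
  by apply: eq_fbigl => x; rewrite !inE /= andb_idl// => /AB.
by apply: eq_fbigl => x; rewrite !inE /= andbC.
Qed.

(** Induction with [(1 + a) P - 1 = (1 + a) (P - 1) + a]; the same identity with [expR (normc a)] in
    place of [1 + a] majorizes it. *)
Lemma prod1D_bound (J : Type) (r : seq J) (a : J -> R[i]) :
  normc (\prod_(i <- r) (1 + a i) - 1) <= expR (\sum_(i <- r) normc (a i)) - 1.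
Proof.
elim: r => [|x r IH]; first by rewrite !big_nil subrr expR0 subrr Normc.normc0.
rewrite !big_cons expRD.
set P := \prod_(i <- r) _ in IH *; set E := expR (\sum_(i <- r) _) in IH *.
have -> : (1 + a x) * P - 1 = (1 + a x) * (P - 1) + a x by ring.
apply: (le_trans (le_normcD _ _)); rewrite Normc.normcM.
have h1 : normc (1 + a x) <= expR (normc (a x)).
  by rewrite (le_trans _ (expR_ge1Dx _))// (le_trans (le_normcD _ _))// Normc.normc1.
have h2 := expR_ge1Dx (normc (a x)).
have E1 : 0 <= E - 1 by apply: le_trans IH; exact: normc_ge0.
have : normc (1 + a x) * normc (P - 1) <= expR (normc (a x)) * (E - 1).
  by apply: ler_pM; rewrite ?normc_ge0.
move=> h3; move: h2 h3; set e := expR _; nra.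
Qed.

Lemma prod1D_le (J : Type) (r : seq J) (a : J -> R[i]) :
  normc (\prod_(i <- r) (1 + a i)) <= expR (\sum_(i <- r) normc (a i)).
Proof.
rewrite expR_sum normc_prod ler_prod// => i _; rewrite normc_ge0 /=.
by rewrite (le_trans _ (expR_ge1Dx _))// (le_trans (le_normcD _ _))// Normc.normc1.
Qed.

Section Summable.
Variables (a : I -> R[i]) (S : R).
Hypothesis aS : forall A : {fset I}, \sum_(i <- A) normc (a i) <= S.

Lemma summable_tail (e : R) : 0 < e ->
  exists A0 : {fset I}, forall A : {fset I}, (A0 `<=` A)%fset ->
    \sum_(i <- (A `\` A0)%fset) normc (a i) < e.
Proof.
move=> e0; pose X := [set \sum_(i <- A) normc (a i) | A in @setT {fset I}]%classic.
have hX : has_sup X.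
  split; first by exists (\sum_(i <- (fset0 : {fset I})) normc (a i)); exists fset0.
  by exists S => _ [A _ <-].
(* A finite set whose sum is within [e] of the supremum leaves less than [e] for every set disjoint
   from it. *)
have [_ [A0 _ <-] hA0] := sup_adherent e0 hX.
exists A0 => A A0A.
have : \sum_(i <- A) normc (a i) <= sup X.
  by apply: ub_le_sup; [case: hX|exists A].
rewrite (big_fset_subset _ _ A0A) /=; lra.
Qed.

Lemma summable_sum_cvg :
  exists l : R[i], (fun A : {fset I} => \sum_(i <- A) a i : R[i]^o) @ totally --> (l : R[i]^o).
Proof.
apply: totally_cauchy => e /summable_tail[A0 hA0]; exists A0 => A A0A.
apply: le_lt_trans (hA0 A A0A).
rewrite normcB (big_fset_subset _ _ A0A) /= addrAC subrr add0r.
exact: normc_sum.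
Qed.

Lemma summable_prod_cvg :
  exists l : R[i], (fun A : {fset I} => \prod_(i <- A) (1 + a i) : R[i]^o) @ totally --> (l : R[i]^o).
Proof.
apply: totally_cauchy => e e0.
(* Chosen so that [expR S * (expR e' - 1) = e]: a partial product is at most [expR S], and a tail of
   sum less than [e'] multiplies it by a factor within [expR e' - 1] of 1. *)
pose e' := ln (1 + e * expR (- S)).
have h1 : 1 < 1 + e * expR (- S) by rewrite ltrDl mulr_gt0// expR_gt0.
have e'0 : 0 < e' by rewrite /e' ln_gt0.
have [A0 hA0] := summable_tail e'0; exists A0 => A A0A.
rewrite normcB (big_fset_subset _ _ A0A) /= -[X in _ - X]mulr1 -mulrBr Normc.normcM.
have h2 : normc (\prod_(i <- A0) (1 + a i)) <= expR S.
  by rewrite (le_trans (prod1D_le _ _))// ler_expR.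
apply: (@le_lt_trans _ _ (expR S * (expR (\sum_(i <- (A `\` A0)%fset) normc (a i)) - 1))).
  by apply: ler_pM; rewrite ?normc_ge0// prod1D_bound.
have : expR (\sum_(i <- (A `\` A0)%fset) normc (a i)) < 1 + e * expR (- S).
  rewrite -[ltRHS]lnK ?posrE; first by rewrite ltr_expR hA0.
  by rewrite (lt_trans _ h1).
move=> h3; have ES : expR S * expR (- S) = 1 by rewrite -expRD subrr expR0.
have -> : e = expR S * (e * expR (- S)) by rewrite mulrCA ES mulr1.
by rewrite ltr_pM2l ?expR_gt0// ltrBlDl.
Qed.

Lemma summable_prod_bound (l : R[i]) :
  (fun A : {fset I} => \prod_(i <- A) (1 + a i) : R[i]^o) @ totally --> (l : R[i]^o) ->
  normc l <= expR S /\ normc (l - 1) <= expR S - 1.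
Proof.
move=> hl; split.
  apply: (cvgr_to_le (normc_limit hl)); apply: nearW => A.
  by rewrite (le_trans (prod1D_le _ _))// ler_expR.
have hl1 : (fun A : {fset I} => \prod_(i <- A) (1 + a i) - 1 : R[i]^o) @ totally --> (l - 1 : R[i]^o).
  apply/cvgcP => e e0; move/cvgcP: hl => /(_ e e0); apply: filterS => A.
  by rewrite opprB addrA subrK.
apply: (cvgr_to_le (normc_limit hl1)); apply: nearW => A.
by rewrite (le_trans (prod1D_bound _ _))// lerB// ler_expR.
Qed.

End Summable.

End Nets.

(** * Limits of complex-valued functions *)

Section CvgC.
Context {R : realType} {T : Type} (F : set_system T) {FF : Filter F}.
Implicit Types (f g : T -> R[i]) (a b : R[i]).

Lemma cvgcM f g a b : (f : T -> R[i]^o) @ F --> (a : R[i]^o) ->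
  (g : T -> R[i]^o) @ F --> (b : R[i]^o) ->
  ((fun x => f x * g x) : T -> R[i]^o) @ F --> (a * b : R[i]^o).
Proof.
move=> /cvgc_ReIm[fr fi] /cvgc_ReIm[gr gi]; apply/cvgc_ReIm; split.
  under eq_fun do rewrite cReM.
  by rewrite cReM; apply: cvgB; exact: cvgM.
under eq_fun do rewrite cImM.
by rewrite cImM; apply: cvgD; exact: cvgM.
Qed.

Lemma cvgcD f g a b : (f : T -> R[i]^o) @ F --> (a : R[i]^o) ->
  (g : T -> R[i]^o) @ F --> (b : R[i]^o) ->
  ((fun x => f x + g x) : T -> R[i]^o) @ F --> (a + b : R[i]^o).
Proof.
move=> /cvgc_ReIm[fr fi] /cvgc_ReIm[gr gi]; apply/cvgc_ReIm; split.
  under eq_fun do rewrite cReD.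
  by rewrite cReD; exact: cvgD.
under eq_fun do rewrite cImD.
by rewrite cImD; exact: cvgD.
Qed.

Lemma cvgc_cst a : ((fun _ => a) : T -> R[i]^o) @ F --> (a : R[i]^o).
Proof. exact: cvg_cst. Qed.

Lemma cvgcB f g a b : (f : T -> R[i]^o) @ F --> (a : R[i]^o) ->
  (g : T -> R[i]^o) @ F --> (b : R[i]^o) ->
  ((fun x => f x - g x) : T -> R[i]^o) @ F --> (a - b : R[i]^o).
Proof.
move=> /cvgc_ReIm[fr fi] /cvgc_ReIm[gr gi]; apply/cvgc_ReIm; split.
  under eq_fun do rewrite cReD cReN.
  by rewrite cReD cReN; exact: cvgB.
under eq_fun do rewrite cImD cImN.
by rewrite cImD cImN; exact: cvgB.
Qed.

Lemma cvgc_squeeze f a (h : T -> R) :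
  (\forall x \near F, normc (f x - a) <= h x) -> h @ F --> (0 : R) ->
  (f : T -> R[i]^o) @ F --> (a : R[i]^o).
Proof.
move=> fh /cvgrPdist_lt h0; apply/cvgcP => e e0.
near=> x; rewrite normcB; apply: (@le_lt_trans _ _ (h x)); first by near: x.
rewrite (le_lt_trans (ler_norm _))//.
have : `|0 - h x| < e by near: x; exact: h0.
by rewrite sub0r normrN.
Unshelve. all: by end_near. Qed.

Lemma cvgc_normc0 f a : (f : T -> R[i]^o) @ F --> (a : R[i]^o) ->
  (fun x => normc (f x - a)) @ F --> (0 : R).
Proof.
move=> /cvgcP fa; apply/cvgrPdist_lt => e e0.
near=> x; rewrite sub0r normrN ger0_norm ?normc_ge0// normcB; near: x; exact: fa.
Unshelve. all: by end_near. Qed.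

Lemma cvgc_cexp f a : (f : T -> R[i]^o) @ F --> (a : R[i]^o) ->
  ((fun x => cexp (f x)) : T -> R[i]^o) @ F --> (cexp a : R[i]^o).
Proof.
move=> fa; have d0 := cvgc_normc0 fa.
apply: (@cvgc_squeeze _ _ (fun x => normc (cexp a) * (normc (f x - a) * expR (normc (f x - a))))).
  apply: nearW => x; have -> : cexp (f x) - cexp a = cexp a * (cexp (f x - a) - 1).
    by rewrite mulrBr mulr1 -cexpD [a + _]addrC subrK.
  by rewrite Normc.normcM ler_wpM2l ?normc_ge0// cexp_taylor0.
rewrite -(mulr0 (normc (cexp a))); apply: cvgM; first exact: cvg_cst.
rewrite -(mul0r (expR 0)); apply: cvgM => //.
by apply: (cvg_comp _ _ d0); exact: continuous_expR.
Qed.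

End CvgC.
#[global] Arguments cvgcM {R T F FF f g a b}.
#[global] Arguments cvgcD {R T F FF f g a b}.
#[global] Arguments cvgcB {R T F FF f g a b}.
#[global] Arguments cvgc_cst {R T F FF a}.
#[global] Arguments cvgc_cexp {R T F FF f a}.

Section Large.
Context {R : realType}.

Lemma near_large (x : R) : \forall N \near \oo, x <= N.+1%:R :> R.
Proof.
exists (Num.truncn `|x|) => // N /= hN.
rewrite (le_trans (ler_norm _))// ltW// (lt_le_trans (truncnS_gt _))//.
by rewrite ler_nat.
Qed.

Lemma near_large_mul (k x : R) : 0 < k -> \forall N \near \oo, x <= k * N.+1%:R :> R.
Proof.
move=> k0; near=> N; rewrite -ler_pdivrMl//; near: N; exact: near_large.
Unshelve. all: by end_near. Qed.

Lemma cvg_inv_succ (C : R) : (fun N : nat => C / N.+1%:R) @ \oo --> (0 : R).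
Proof.
rewrite -(mulr0 C); apply: cvgM; first exact: cvg_cst.
exact: cvg_harmonic.
Qed.

End Large.

(** * The Weierstrass sigma function of a lattice *)

Section Boxes.

(** Lists the integers from [-N] to [N] by a range of naturals, so that products along a row of a
    box can be extended by one factor at either end. *)
Definition centered (N i : nat) : int := i%:Z - N%:Z.

Definition box (N : nat) : {fset int * int} :=
  seq_fset tt [seq (centered N i, centered N j) | i <- iota 0 N.*2.+1, j <- iota 0 N.*2.+1].

Lemma mem_box N (m : int * int) : (m \in box N) = (`|m.1| <= N)%N && (`|m.2| <= N)%N.
Proof.
rewrite /box seq_fsetE; apply/allpairsP/idP => [[[i j] []]|].
  rewrite [(_, _).1]/= [(_, _).2]/= !mem_iota => hi hj ->; rewrite /centered /=; lia.
case: m => a b /= /andP[ha hb].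
have hI x : (x \in iota 0 N.*2.+1) = (x <= N.*2)%N by rewrite mem_iota.
exists (absz (a + N%:Z)%R, absz (b + N%:Z)%R); split.
- by rewrite hI /=; lia.
- by rewrite hI /=; lia.
- by rewrite /centered /=; congr (_, _); lia.
Qed.

Lemma big_box (T : Type) (idx : T) (op : Monoid.com_law idx) N (f : int * int -> T) :
  \big[op/idx]_(m <- box N) f m =
  \big[op/idx]_(0 <= i < N.*2.+1) \big[op/idx]_(0 <= j < N.*2.+1)
    f (centered N i, centered N j).
Proof.
rewrite (perm_big _ (seq_fset_perm _ _)) undup_id; first by rewrite big_allpairs_dep /index_iota subn0.
apply: allpairs_uniq; [exact: iota_uniq..|].
by move=> [i j] [i' j'] _ _ [] /=; rewrite /centered => h1 h2; congr (_, _); lia.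
Qed.

Lemma sub_box (F : {fset int * int}) : exists N0, forall N, (N0 <= N)%N -> (F `<=` box N)%fset.
Proof.
exists (\max_(m <- F) (`|m.1| + `|m.2|))%N => N hN; apply/fsubsetP => m mF.
have : (`|m.1| + `|m.2| <= \max_(m <- F) (`|m.1| + `|m.2|))%N by apply: (@leq_bigmax_seq _ (enum_fset F) xpredT (fun m : int * int => (`|m.1| + `|m.2|)%N)).
move=> /leq_trans /(_ hN) {}hN; rewrite mem_box; apply/andP; split.
  exact: leq_trans (leq_addr _ _) hN.
exact: leq_trans (leq_addl _ _) hN.
Qed.

(** Boxes are cofinal among the finite sets, so an unconditional limit may be computed along them.
    They are symmetric, which cancels odd sums, and a shift by a basis vector changes only one
    column. *)
Lemma box_cvg (T : Type) (h : {fset int * int} -> T) (G : set_system T) :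
  h @ totally --> G -> (fun N => h (box N)) @ \oo --> G.
Proof.
move=> H A /H [F _ hF]; have [N0 hN0] := sub_box F.
by exists N0 => // N /hN0; exact: hF.
Qed.

Lemma big_centered (T : Type) (idx : T) (op : Monoid.com_law idx) N (g : int -> T) :
  \big[op/idx]_(0 <= i < N.*2.+1) g (centered N i) =
  op (\big[op/idx]_(0 <= k < N) g (- k.+1%:Z)) (\big[op/idx]_(0 <= k < N.+1) g k%:Z).
Proof.
rewrite -addnn -addnS (big_cat_nat (n := N)) //= ?leq_addr//; congr (op _ _).
  rewrite big_nat_rev /=; apply: eq_big_nat => k /andP[_ kN].
  by congr (g _); rewrite /centered; lia.
rewrite -{1}[N]add0n big_addn addnC addnK.
by apply: eq_big_nat => k _; congr (g _); rewrite /centered; lia.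
Qed.

Lemma big_centered_opp (T : Type) (idx : T) (op : Monoid.com_law idx) N (g : int -> T) :
  \big[op/idx]_(0 <= i < N.*2.+1) g (centered N i) =
  \big[op/idx]_(0 <= i < N.*2.+1) g (- centered N i).
Proof.
rewrite big_nat_rev /=; apply: eq_big_nat => k hk.
by congr (g _); rewrite /centered; lia.
Qed.

Context {R : realType}.

(** The added 1 keeps the size positive at the index 0. *)
Definition lsize (m : int * int) : R := (`|m.1| + `|m.2|).+1%:R.

Lemma lsize_gt0 m : 0 < lsize m. Proof. by rewrite ltr0n. Qed.

Lemma lsize_ge1 m : 1 <= lsize m. Proof. by rewrite ler1n. Qed.

Lemma sum_inv_sqr_le (a M : nat) :
  \sum_(0 <= b < M) ((a + b).+1%:R ^+ 2)^-1 <= 2 / a.+1%:R :> R.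
Proof.
(* The subtracted term makes the induction go through: for [x >= 1], the inverse square of [x] is at
   most [2 / x - 2 / (x + 1)]. *)
suff : \sum_(0 <= b < M) ((a + b).+1%:R ^+ 2)^-1 <= 2 / a.+1%:R - 2 / (a + M).+1%:R :> R.
  by move=> /le_trans; apply; rewrite gerBl divr_ge0.
elim: M => [|M IH]; first by rewrite big_nil addn0 subrr.
rewrite big_nat_recr //= addnS; apply: (le_trans (lerD IH (lexx _))).
set x : R := (a + M).+1%:R; have x1 : 1 <= x by rewrite ler1n.
have x0 : 0 < x by rewrite ltr0n.
have -> : (a + M).+2%:R = x + 1 :> R by rewrite /x -natr1.
suff : (x ^+ 2)^-1 <= 2 / x - 2 / (x + 1). by move=> h; rewrite -addrA lerD2l addrC lerBlDr addrC.
have -> : 2 / x - 2 / (x + 1) = 2 / (x * (x + 1)).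
  by field; rewrite !gt_eqF// addr_gt0.
rewrite ler_pdivlMr ?mulr_gt0 ?addr_gt0// mulrC ler_pdivrMr ?exprn_gt0//.
nra.
Qed.

Lemma sum_inv_cube_le (a M : nat) :
  \sum_(0 <= b < M) ((a + b).+1%:R ^+ 3)^-1 <= 2 / (a.+1%:R ^+ 2) :> R.
Proof.
apply: (@le_trans _ _ (a.+1%:R^-1 * \sum_(0 <= b < M) ((a + b).+1%:R ^+ 2)^-1)).
  rewrite big_distrr /=; apply: ler_sum => b _.
  rewrite exprS invfM ler_wpM2r ?invr_ge0 ?exprn_ge0//.
  by rewrite lef_pV2 ?posrE ?ltr0n// ler_nat ltnS leq_addr.
apply: (@le_trans _ _ (a.+1%:R^-1 * (2 / a.+1%:R))).
  by rewrite ler_wpM2l ?invr_ge0// sum_inv_sqr_le.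
by rewrite mulrCA -invfM -expr2.
Qed.

Lemma sum_centered_abs_le (g : nat -> R) N :
  (forall k, 0 <= g k) ->
  \sum_(0 <= i < N.*2.+1) g `|centered N i|%N <= 2 * \sum_(0 <= k < N.+1) g k.
Proof.
move=> g0; rewrite (big_centered _ N (fun z => g `|z|%N)) /= mulr_natl mulr2n lerD2r.
rewrite [leRHS]big_nat_recl//= lerDr //.
Qed.

(** The inverse cubes are summed one coordinate at a time: a sum of inverse cubes along a row is of
    the order of an inverse square, which is again summable. This single bound controls all products
    and series over the periods. *)
Lemma sum_lsize_le (F : {fset int * int}) :
  \sum_(m <- F) (lsize m ^+ 3)^-1 <= 32.
Proof.
have [N /(_ N (leqnn N)) FB] := sub_box F.
apply: (@le_trans _ _ (\sum_(m <- box N) (lsize m ^+ 3)^-1)).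
  rewrite (big_fset_subset _ _ FB) /= lerDl.
  by apply: sumr_ge0 => m _; rewrite invr_ge0 exprn_ge0// ltW// lsize_gt0.
rewrite big_box /lsize /=.
pose g (a : nat) : R := 2 * (2 / (a.+1%:R ^+ 2)).
apply: (@le_trans _ _ (\sum_(0 <= i < N.*2.+1) g `|centered N i|%N)).
  apply: ler_sum => i _.
  have := @sum_centered_abs_le (fun b => ((`|centered N i| + b).+1%:R ^+ 3)^-1) N.
  move=> /(_ _)/le_trans; apply; first by move=> k; rewrite invr_ge0 exprn_ge0.
  by rewrite /g ler_wpM2l// sum_inv_cube_le.
apply: (le_trans (sum_centered_abs_le _ _)).
  by move=> k; rewrite /g mulr_ge0// divr_ge0// exprn_ge0.
rewrite /g -mulr_sumr -mulr_sumr.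
have := sum_inv_sqr_le 0 N.+1; rewrite divr1 => h.
have -> : \sum_(0 <= i < N.+1) (i.+1%:R ^+ 2 : R)^-1 = \sum_(0 <= b < N.+1) ((0 + b).+1%:R ^+ 2)^-1.
  by apply: eq_bigr => i _; rewrite add0n.
lra.
Qed.

End Boxes.

(** * Primary factors *)

Section Factor.
Context {R : realType}.
Implicit Types (z w u v : R[i]).

Lemma normc_natr (n : nat) : normc (n%:R : R[i]) = n%:R.
Proof. by have := normc_real (n%:R : R); rewrite normr_nat => <-; rewrite rmorph_nat. Qed.

(** The Weierstrass primary factor of genus 2. *)
Definition wfactor u : R[i] := (1 - u) * cexp (u + u ^+ 2 / 2).

Lemma wfactor_bound (K : R) : 0 <= K -> exists2 C : R, 0 <= C &
  forall u, normc u <= K -> normc (wfactor u - 1) <= C * normc u ^+ 3.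
Proof.
move=> K0; pose C := (1 + K) * ((1 + K) ^+ 3 * expR (K * (1 + K))) + (1 + K + K ^+ 2).
exists C.
  by rewrite /C !addr_ge0 ?mulr_ge0 ?exprn_ge0 ?expR_ge0 ?addr_ge0.
move=> u uK; have u0 := normc_ge0 u.
(* With [v = u + u^2 / 2], the exponential is replaced by [1 + v + v^2 / 2] up to a cubic error. In
   [(1 - u) (1 + v + v^2 / 2)] the terms of orders 1 and 2 cancel, leaving a multiple of [u^3]. *)
have -> : wfactor u - 1 = (1 - u) * (cexp (u + u ^+ 2 / 2) - 1 - (u + u ^+ 2 / 2) - (u + u ^+ 2 / 2) ^+ 2 / 2)
   - u ^+ 3 * (2^-1 + u * (3%:R / 8%:R) + u ^+ 2 / 8%:R).
  rewrite /wfactor; set E := cexp _; by field.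
apply: (le_trans (le_normcD _ _)); rewrite normcN /C [leRHS]mulrDl; apply: lerD.
  rewrite Normc.normcM -mulrA ler_pM ?normc_ge0//.
    by rewrite (le_trans (le_normcD _ _))// normcN Normc.normc1 lerD2l.
  apply: (le_trans (cexp_taylor2 _)).
  have hv : normc (u + u ^+ 2 / 2) <= normc u * (1 + K).
    apply: (le_trans (le_normcD _ _)); rewrite normc_div normcX mulrDr mulr1 lerD2l.
    rewrite (normc_natr 2) expr2 -mulrA ler_wpM2l// ler_pdivrMr//; lra.
  rewrite [leRHS]mulrAC ler_pM ?exprn_ge0 ?normc_ge0 ?expR_ge0//.
    by rewrite -exprMn lerXn2r ?nnegrE ?normc_ge0 ?mulr_ge0 ?addr_ge0// [leRHS]mulrC.
  by rewrite ler_expR (le_trans hv)// ler_wpM2r// addr_ge0.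
rewrite Normc.normcM normcX [leLHS]mulrC ler_wpM2r ?exprn_ge0//.
apply: (le_trans (le_normcD _ _)); apply: lerD.
  apply: (le_trans (le_normcD _ _)); apply: lerD.
    by rewrite Normc.normcV (normc_natr 2) invf_le1// ler1n.
  by rewrite Normc.normcM normc_div !normc_natr; lra.
rewrite normc_div normcX normc_natr ler_pdivrMr//.
have : normc u ^+ 2 <= K ^+ 2 by rewrite lerXn2r ?nnegrE.
have := sqr_ge0 K; lra.
Qed.

Lemma exp_lin_bound (x : R[i]) : normc x <= 1 ->
  normc ((1 + x) * cexp (- x) - 1) <= (2 * expR 1 + 1) * normc x ^+ 2.
Proof.
move=> x1.
have -> : (1 + x) * cexp (- x) - 1 = (1 + x) * (cexp (- x) - 1 - (- x)) - x ^+ 2 by ring.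
apply: (le_trans (le_normcD _ _)); rewrite normcN normcX [leRHS]mulrDl mul1r lerD2r.
rewrite Normc.normcM -mulrA ler_pM ?normc_ge0//.
  by rewrite (le_trans (le_normcD _ _))// Normc.normc1; lra.
apply: (le_trans (cexp_taylor1 _)); rewrite normcN mulrC ler_wpM2r ?exprn_ge0 ?normc_ge0//.
by rewrite ler_expR.
Qed.

End Factor.

(** * Convergence of the sigma product *)

Section Lattice.
Context {R : realType}.
Variables w1 w2 : R[i].
Hypothesis area_neq0 : period_area w1 w2 != 0.
Implicit Types (z w u v : R[i]) (m : int * int).

Notation om := (period w1 w2).
Notation L := (period_lattice w1 w2).

(** Cramer's rule: the area times a coordinate of [z] is the imaginary part of a product of [z] and
    a basis vector, one of them conjugated. *)
Lemma coord_bound (x y : R) :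
  `|period_area w1 w2| * (`|x| + `|y|) <=
  (normc w1 + normc w2) * normc (x%:C * w1 + y%:C * w2).
Proof.
set z := x%:C * w1 + y%:C * w2.
have e1 : y * period_area w1 w2 = complex.Im (conjc w1 * z).
  rewrite /z /period_area; case: w1 w2 => [a b] [c d] /=; ring.
have e2 : x * period_area w1 w2 = complex.Im (conjc z * w2).
  rewrite /z /period_area; case: w1 w2 => [a b] [c d] /=; ring.
rewrite mulrDr mulrDl addrC; apply: lerD.
  by rewrite mulrC -normrM e1 (le_trans (Im_le_normc _))// Normc.normcM normc_conj.
by rewrite mulrC -normrM e2 (le_trans (Im_le_normc _))// Normc.normcM normc_conj mulrC.
Qed.

Lemma periodE m : om m = (m.1%:~R : R)%:C * w1 + (m.2%:~R : R)%:C * w2.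
Proof. by rewrite /period -[w1 *~ _]mulrzl -[w2 *~ _]mulrzl !rmorph_int. Qed.

(** The constant in the lower bound of the period of index [m] by [lsize m]; locked so that it stays
    atomic under simplification. *)
Definition kap : R := locked (`|period_area w1 w2| / (2 * (normc w1 + normc w2))).

Lemma period_norms_gt0 : 0 < normc w1 + normc w2.
Proof.
rewrite ltr_wpDr ?normc_ge0// normc_gt0; apply: contra area_neq0 => /eqP ->.
by rewrite /period_area conjc0 mul0r.
Qed.

Lemma kap_gt0 : 0 < kap.
Proof. by rewrite /kap -lock divr_gt0 ?normr_gt0// mulr_gt0// period_norms_gt0. Qed.

Lemma period_ge m : m != 0 -> kap * lsize m <= normc (om m).
Proof.
move=> m0; have P0 := period_norms_gt0.
rewrite /kap -lock mulrAC ler_pdivrMr ?mulr_gt0// [leRHS]mulrC -mulrA.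
apply: le_trans (_ : 2 * (`|period_area w1 w2| * (`|m.1%:~R| + `|m.2%:~R|)) <= _); last first.
  by rewrite ler_wpM2l// periodE coord_bound.
rewrite mulrCA ler_wpM2l// /lsize.
have -> : `|m.1%:~R| + `|m.2%:~R| = (`|m.1| + `|m.2|)%:R :> R.
  by rewrite natrD -!intr_norm !natr_absz.
(* For a nonzero index the 1 in [lsize] is at most [|m.1| + |m.2|]; this is the factor 2 in
   [kap]. *)
rewrite -natrM ler_nat mul2n -addnn -addn1 leq_add2l.
case: m m0 => a b /=; rewrite xpair_eqE negb_and -!absz_gt0 => /orP[] h.
  by rewrite ltn_addr.
by rewrite ltn_addl.
Qed.

Lemma period_neq0 m : m != 0 -> om m != 0.
Proof.
move=> m0; rewrite -normc_gt0; apply: lt_le_trans (period_ge m0).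
exact: (mulr_gt0 kap_gt0 (lsize_gt0 m)).
Qed.

Lemma period0 : om 0 = 0. Proof. by rewrite /period /= !mulr0z addr0. Qed.

Lemma periodD m m' : om (m + m') = om m + om m'.
Proof. by rewrite /period !mulrzDr addrACA. Qed.

Lemma periodN m : om (- m) = - om m.
Proof. by rewrite /period !mulrNz opprD. Qed.

Lemma exists_nonperiod : exists z, ~ L z.
Proof.
exists ((2^-1 : R)%:C * w1) => -[m _ h].
have : `|period_area w1 w2| * (`|m.1%:~R - 2^-1| + `|m.2%:~R : R|) <= 0.
  rewrite (le_trans (coord_bound _ _))// rmorphB /= mulrBl addrAC -periodE h subrr.
  by rewrite Normc.normc0 mulr0.
rewrite pmulr_rle0 ?normr_gt0// => h2.
have /eqP : `|m.1%:~R - 2^-1 : R| == 0.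
  by rewrite eq_le normr_ge0 andbT (le_trans _ h2)// lerDl.
move/eqP; rewrite normr_eq0 subr_eq0 => /eqP h3.
have : ((m.1 * 2)%:~R : R) = 1%:~R by rewrite intrM h3 mulVf.
move/(mulrIz (oner_neq0 R)); lia.
Qed.

(** With the value 0 at the index 0, the product restricted to nonzero indices becomes an
    unrestricted product of factors [1 + wdev z m]. *)
Definition wdev z m : R[i] := if m == 0 then 0 else wfactor (z / om m) - 1.

Lemma wdev_bound (r : R) : 0 <= r -> exists2 C : R, 0 <= C &
  forall z m, normc z <= r -> normc (wdev z m) <= C * normc z ^+ 3 * (lsize m ^+ 3)^-1.
Proof.
move=> r0; have K0 : 0 <= r / kap by rewrite divr_ge0// ltW// kap_gt0.
have [C C0 hC] := wfactor_bound K0.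
exists (C / kap ^+ 3); first by rewrite divr_ge0// exprn_ge0// ltW// kap_gt0.
move=> z m zr; rewrite /wdev; have [->|m0] := eqVneq m 0.
  rewrite Normc.normc0 !mulr_ge0 ?invr_ge0 ?exprn_ge0 ?normc_ge0//.
  by rewrite ltW// kap_gt0.
have hm := period_ge m0; have k0 := kap_gt0; have l0 := lsize_gt0 (R := R) m.
have l1 := lsize_ge1 (R := R) m.
have kl := mulr_gt0 k0 l0; have n0 := normc_ge0 z.
have hq : normc (z / om m) <= normc z / (kap * lsize m).
  by rewrite normc_div ler_wpM2l// lef_pV2 ?posrE// (lt_le_trans kl hm).
apply: (le_trans (hC _ _)).
  apply: (le_trans hq); apply: ler_pM => //; first by rewrite invr_ge0 ltW.
  by rewrite lef_pV2 ?posrE// ler_peMr// ltW.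
rewrite -[leRHS]mulrA -[leRHS]mulrA ler_wpM2l//.
apply: le_trans (_ : (normc z / (kap * lsize m)) ^+ 3 <= _).
  by rewrite lerXn2r ?nnegrE ?normc_ge0 ?divr_ge0// ltW.
by rewrite expr_div_n exprMn invfM mulrCA.
Qed.

Lemma wdev_summable z : exists S, forall A : {fset int * int}, \sum_(m <- A) normc (wdev z m) <= S.
Proof.
have [C C0 hC] := wdev_bound (normc_ge0 z).
exists (C * normc z ^+ 3 * 32) => A.
apply: (@le_trans _ _ (\sum_(m <- A) C * normc z ^+ 3 * (lsize m ^+ 3)^-1)).
  by apply: ler_sum => m _; exact: hC.
by rewrite -mulr_sumr ler_wpM2l ?sum_lsize_le// mulr_ge0// exprn_ge0// normc_ge0.
Qed.

Lemma wsigma_prodE z (F : {fset int * int}) :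
  \prod_(m <- F | m != 0)
      ((1 - z / om m) * cexp (z / om m + z ^+ 2 / (2 * om m ^+ 2)))
  = \prod_(m <- F) (1 + wdev z m).
Proof.
rewrite big_mkcond; apply: eq_bigr => m _; rewrite /wdev.
case: eqVneq => [_|m0] /=; first by rewrite addr0.
rewrite [RHS]addrC subrK /wfactor; congr (_ * cexp (_ + _)).
by have o0 := period_neq0 m0; field.
Qed.

Lemma wsigma_spec z : exists2 l : R[i], wsigma w1 w2 z = z * l &
  (fun A : {fset int * int} => \prod_(m <- A) (1 + wdev z m) : R[i]^o) @ totally --> (l : R[i]^o).
Proof.
have [S hS] := wdev_summable z; have [l hl] := summable_prod_cvg hS.
exists l => //; rewrite /wsigma; congr (_ * _).
under eq_fun do rewrite wsigma_prodE.
exact: limcE.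
Qed.

Lemma wsigma_bound (r : R) : 0 <= r -> exists M : R, forall z, normc z <= r -> normc (wsigma w1 w2 z) <= M.
Proof.
move=> r0; have [C C0 hC] := wdev_bound r0.
exists (r * expR (C * r ^+ 3 * 32)) => z zr.
have [l -> hl] := wsigma_spec z.
rewrite Normc.normcM ler_pM ?normc_ge0//.
have hS (A : {fset int * int}) : \sum_(m <- A) normc (wdev z m) <= C * r ^+ 3 * 32.
  apply: (@le_trans _ _ (\sum_(m <- A) C * r ^+ 3 * (lsize m ^+ 3)^-1)).
    apply: ler_sum => m _; apply: (le_trans (hC _ _ zr)).
    rewrite ler_wpM2r ?invr_ge0 ?exprn_ge0//.
    by rewrite ler_wpM2l// lerXn2r ?nnegrE ?normc_ge0.
  by rewrite -mulr_sumr ler_wpM2l ?sum_lsize_le// mulr_ge0// exprn_ge0.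
by have [] := summable_prod_bound hS hl.
Qed.

(** Sigma has a simple zero at 0 with derivative 1; this quantitative form is what the comparison of
    Taylor coefficients consumes. *)
Lemma wsigma_near0 : exists2 C : R, 0 <= C & forall z, normc z <= 1 -> 
  exists2 l, wsigma w1 w2 z = z * l & normc (l - 1) <= expR (C * normc z) - 1.
Proof.
have [C C0 hC] := wdev_bound (ler01 : (0 : R) <= 1).
exists (C * 32); first by rewrite mulr_ge0.
move=> z z1; have [l -> hl] := wsigma_spec z; exists l => //.
have hS (A : {fset int * int}) : \sum_(m <- A) normc (wdev z m) <= C * 32 * normc z.
  apply: (@le_trans _ _ (\sum_(m <- A) C * normc z * (lsize m ^+ 3)^-1)).
    apply: ler_sum => m _; apply: (le_trans (hC _ _ z1)).
    rewrite ler_wpM2r ?invr_ge0 ?exprn_ge0//.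
    by rewrite ler_wpM2l// exprS ler_piMr ?normc_ge0// exprn_ile1// normc_ge0.
  by rewrite -mulr_sumr mulrAC ler_wpM2r ?normc_ge0// ler_wpM2l ?sum_lsize_le.
by have [] := summable_prod_bound hS hl.
Qed.

End Lattice.

(** An edge carries [2 N + 1] points, so errors of order [N^-2] at each of them vanish in the
    limit. *)
Lemma edge_sum_sqr_bound {R : realType} (N : nat) (C : R) : 0 <= C -> 
  \sum_(0 <= j < N.*2.+1) (C / (N.+1%:R ^+ 2)) <= 2 * C / N.+1%:R.
Proof.
move=> C0; rewrite sumr_const_nat subn0 -[leLHS]mulr_natl mulrA ler_pdivrMr ?exprn_gt0//.
have -> : 2 * C / N.+1%:R * N.+1%:R ^+ 2 = C * (2 * N.+1%:R) :> R.
  by have : N.+1%:R != 0 :> R; [rewrite pnatr_eq0|move: (N.+1%:R) => x x0; field].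
rewrite mulrC ler_wpM2l// -natrM ler_nat; lia.
Qed.

(** * Products over boxes and over their edges *)

Section Edge.
Context {R : realType}.
Variables w1 w2 : R[i].
Hypothesis area_neq0 : period_area w1 w2 != 0.
Implicit Types (z w u v A : R[i]) (m : int * int) (N : nat).

Notation om := (period w1 w2).
Notation kap := (kap w1 w2).

Definition edge N (j : nat) : R[i] := om (N%:Z, centered N j).

Lemma edge_ge N j : (0 < N)%N -> kap * N.+1%:R <= normc (edge N j).
Proof.
move=> N0; have m0 : (N%:Z, centered N j) != 0.
  by rewrite xpair_eqE negb_and; case: N N0.
apply: le_trans (period_ge area_neq0 m0); rewrite ler_wpM2l ?(ltW (kap_gt0 area_neq0))//.
by rewrite ler_nat /= ltnS leq_addr.
Qed.

Lemma edge_gt0 N j : (0 < N)%N -> 0 < normc (edge N j).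
Proof.
move=> /(edge_ge j); apply: lt_le_trans.
exact: (mulr_gt0 (kap_gt0 area_neq0) (ltr0Sn _ _)).
Qed.

Lemma edge_neq0 N j : (0 < N)%N -> edge N j != 0.
Proof. by move=> /(edge_gt0 j); rewrite -normc_gt0. Qed.

Definition edge_sum N : R[i] := \sum_(0 <= j < N.*2.+1) (edge N j)^-1.

Definition edge_prod N A : R[i] := \prod_(0 <= j < N.*2.+1) (1 + A / edge N j).

(** The edge product with the linear exponent removed from each factor. Its factors differ from 1 by
    a term of order [N^-2], so it tends to 1 and [edge_sum] alone carries the asymptotics of
    [edge_prod]. *)
Definition edge_rem N A : R[i] :=
  \prod_(0 <= j < N.*2.+1) ((1 + A / edge N j) * cexp (- (A / edge N j))).

Lemma edge_prodE N A : edge_prod N A = edge_rem N A * cexp (A * edge_sum N).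
Proof.
rewrite /edge_prod /edge_rem /edge_sum mulr_sumr cexp_sum -big_split /=.
by apply: eq_bigr => j _; rewrite -mulrA -cexpD addNr cexp0 mulr1.
Qed.

Lemma edge_rem_cvg A : (fun N => edge_rem N A : R[i]^o) @ \oo --> (1 : R[i]^o).
Proof.
have k0 := kap_gt0 area_neq0.
pose C := (2 * expR 1 + 1) * (normc A ^+ 2 / kap ^+ 2) : R.
have C0 : 0 <= C.
  rewrite mulr_ge0 ?addr_ge0 ?mulr_ge0 ?expR_ge0 ?divr_ge0 ?exprn_ge0 ?normc_ge0//.
  by rewrite invr_ge0 exprn_ge0// ltW.
apply: (@cvgc_squeeze _ _ _ _ _ _ (fun N => expR (2 * C / N.+1%:R) - 1)); last first.
  have -> : (0 : R) = expR 0 - 1 by rewrite expR0 subrr.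
  apply: cvgB; last exact: cvg_cst.
  by apply: (cvg_comp (fun N : nat => 2 * C / N.+1%:R) expR (cvg_inv_succ (2 * C))); exact: continuous_expR.
near=> N; have N0 : (0 < N)%N by near: N; exists 1%N.
rewrite /edge_rem (eq_bigr (fun j => 1 + ((1 + A / edge N j) * cexp (- (A / edge N j)) - 1))); last first.
  by move=> j _; rewrite [RHS]addrC subrK.
apply: (le_trans (prod1D_bound _ _)); rewrite lerD2r ler_expR.
apply: le_trans (edge_sum_sqr_bound N C0); apply: ler_sum => j _.
have kl : 0 < kap * N.+1%:R := mulr_gt0 k0 (ltr0Sn _ N).
have hj := edge_ge j N0; have q : normc (A / edge N j) <= normc A / (kap * N.+1%:R).
  by rewrite normc_div ler_wpM2l ?normc_ge0// lef_pV2 ?posrE//; exact: edge_gt0.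
apply: (le_trans (exp_lin_bound _)).
  apply: (le_trans q); rewrite ler_pdivrMr// mul1r.
  by near: N; exact: near_large_mul.
rewrite /C -mulrA ler_wpM2l ?addr_ge0 ?mulr_ge0 ?expR_ge0//.
apply: le_trans (_ : (normc A / (kap * N.+1%:R)) ^+ 2 <= _).
  by rewrite lerXn2r ?nnegrE ?normc_ge0 ?divr_ge0 ?normc_ge0// ltW.
by rewrite expr_div_n exprMn invfM mulrA.
Unshelve. all: by end_near. Qed.

(** A partial sum of the Eisenstein series of weight 2, which does not converge absolutely. Only its
    combination with [edge_sum] in [etaN] is shown to converge. *)
Definition sq_sum N : R[i] := \sum_(m <- box N) if m == 0 then 0 else (om m ^+ 2)^-1.

Definition sigN N z := z * \prod_(m <- box N) (1 + wdev w1 w2 z m).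

Lemma sigN_cvg z : (fun N => sigN N z : R[i]^o) @ \oo --> (wsigma w1 w2 z : R[i]^o).
Proof.
have [l -> hl] := wsigma_spec area_neq0 z.
by apply: cvgcM; [exact: cvgc_cst|exact: (box_cvg hl)].
Qed.

Lemma box_odd_sum N (f : int * int -> R[i]) : (forall m, f (- m) = - f m) ->
  \sum_(m <- box N) f m = 0.
Proof.
move=> fN; set x := LHS.
have : x = - x.
  rewrite {1}/x big_box (big_centered_opp _ N (fun i => \sum_(0 <= j < N.*2.+1) f (i, centered N j))) /=.
  rewrite /x big_box -sumrN; apply: eq_bigr => i _.
  rewrite (big_centered_opp _ N (fun j => f (- centered N i, j))) /= -sumrN.
  by apply: eq_bigr => j _; rewrite -fN.
by move/eqP; rewrite -addr_eq0 -mulr2n mulrn_eq0 /= => /eqP.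
Qed.

Lemma mem0_box N : 0 \in box N. Proof. by rewrite mem_box. Qed.

(** By symmetry of the box the linear exponents cancel and the quadratic ones add up to [sq_sum].
    What remains is a polynomial with its zeros at the periods of the box, and [K] collects the
    constants [- 1 / om m]. *)
Lemma sigN_factor N : exists K : R[i], forall z,
  sigN N z = K * (\prod_(m <- box N) (z - om m)) * cexp (z ^+ 2 / 2 * sq_sum N).
Proof.
exists (\prod_(m <- box N) if m == 0 then 1 else (- om m)^-1) => z.
have E1 : \sum_(m <- box N) (if m == 0 then 0 else (om m)^-1) = 0.
  apply: box_odd_sum => m; rewrite oppr_eq0; case: ifP => _; first by rewrite oppr0.
  by rewrite periodN invrN.
have -> : cexp (z ^+ 2 / 2 * sq_sum N) =
   cexp (z * \sum_(m <- box N) (if m == 0 then 0 else (om m)^-1)) * cexp (z ^+ 2 / 2 * sq_sum N).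
  by rewrite E1 mulr0 cexp0 mul1r.
rewrite [\prod_(m <- box N) (z - om m)](big_fsetD1 0 (mem0_box N)) /= period0 subr0.
rewrite /sigN -!mulrA [RHS]mulrCA; congr (z * _).
have -> : \prod_(i <- (box N `\ 0)%fset) (z - om i) = \prod_(m <- box N) if m == 0 then 1 else z - om m.
  rewrite [RHS](big_fsetD1 0 (mem0_box N)) /= mul1r.
  by apply: eq_fbigr => m; rewrite !inE => /andP[/negbTE -> _].
rewrite /sq_sum !mulr_sumr !cexp_sum -!big_split /=; apply: eq_bigr => m _.
rewrite /wdev; case: eqVneq => m0; first by rewrite !mulr0 cexp0 !mulr1 addr0.
have o0 := period_neq0 area_neq0 m0.
rewrite addrC subrK /wfactor -cexpD !mulrA; congr (_ * cexp _); first by field.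
by field.
Qed.

Lemma int_pairP (p q : int * int) : p.1 = q.1 -> p.2 = q.2 -> p = q.
Proof. by case: p q => [a b] [c d] /= -> ->. Qed.

Lemma period_w1 : om (1, 0) = w1.
Proof. by rewrite /period /= mulr1z mulr0z addr0. Qed.

(** Shifting by [w1] moves the box by one column: column [- N - 1] enters and column [N] leaves.
    Both columns are edge products, up to the product [P] of the edge points. *)
Lemma box_prod_shift N z : (0 < N)%N ->
  (\prod_(m <- box N) (z + w1 - om m)) * edge_prod N (- z) =
  - (\prod_(m <- box N) (z - om m)) * edge_prod N (z + w1).
Proof.
move=> N0.
pose P := \prod_(0 <= j < N.*2.+1) edge N j.
have P0 : P != 0 by rewrite /P prodf_seq_neq0; apply/allP => j _ /=; rewrite edge_neq0.
apply: (mulIf P0); rewrite -!mulrA.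
have e1 : edge_prod N (- z) * P = - \prod_(0 <= j < N.*2.+1) (z - edge N j).
  rewrite /edge_prod /P -big_split /=.
  (* The number of edge points is odd. The sign obtained here is the one in
     [sigma (z + w1) = - sigma z * exp (...)]. *)
  have -> : - \prod_(0 <= j < N.*2.+1) (z - edge N j) = \prod_(0 <= j < N.*2.+1) (- (z - edge N j)).
    rewrite -[X in - X]mul1r -mulNr.
    under [RHS]eq_bigr do rewrite -mulN1r.
    by rewrite big_split /= prodr_const_nat subn0 -signr_odd /= odd_double expr1.
  apply: eq_bigr => j _; have := edge_neq0 j N0 => h; by field.
have e2 : edge_prod N (z + w1) * P = \prod_(0 <= j < N.*2.+1) (z + w1 + edge N j).
  rewrite /edge_prod /P -big_split /=.
  by apply: eq_bigr => j _; have := edge_neq0 j N0 => h; field.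
rewrite e1 e2 mulrN mulNr; congr (- _).
rewrite !big_box /= exchange_big /= [in RHS]exchange_big /=.
have -> : \prod_(0 <= j < N.*2.+1) (z + w1 + edge N j) =
  \prod_(0 <= j < N.*2.+1) (z - om (- N.+1%:Z, centered N j)).
  rewrite (big_centered_opp _ N (fun j => z - om (- N.+1%:Z, j))) /=.
  apply: eq_bigr => j _; rewrite /edge -addrA; congr (_ + _).
  by rewrite -[X in X + _]period_w1 -periodN -periodD; congr om; apply: int_pairP => /=; lia.
rewrite -!big_split /=; apply: eq_bigr => j _.
(* The factors of row [j] from column [- N - 1] to column [N]; both sides are the product of all of
   them. *)
pose f k := z - om (k%:Z - N.+1%:Z, centered N j).
have -> : z - edge N j = f N.*2.+1.
  by rewrite /f /edge; congr (_ - om (_, _)); lia.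
have -> : z - om (- N.+1%:Z, centered N j) = f 0%N by rewrite /f sub0r.
have -> : \prod_(0 <= i < N.*2.+1) (z + w1 - om (centered N i, centered N j)) = \prod_(0 <= i < N.*2.+1) f i.
  apply: eq_bigr => i _; rewrite /f -addrA; congr (_ + _).
  by rewrite -[X in X - _]period_w1 -!periodN -periodD; congr om; apply: int_pairP; rewrite /centered /=; lia.
have -> : \prod_(0 <= i < N.*2.+1) (z - om (centered N i, centered N j)) = \prod_(0 <= i < N.*2.+1) f i.+1.
  apply: eq_bigr => i _; rewrite /f; congr (_ - om (_, _)); rewrite /centered; lia.
by rewrite -big_nat_recr//= big_nat_recl//= mulrC.
Qed.

End Edge.

(** * The Legendre relation *)

Section Shift.
Context {R : realType}.
Variables w1 w2 : R[i].
Hypothesis area_neq0 : period_area w1 w2 != 0.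
Implicit Types (z w u v A B : R[i]) (m : int * int) (N : nat).

Notation om := (period w1 w2).
Notation L := (period_lattice w1 w2).
Notation kap := (kap w1 w2).
Notation edge := (edge w1 w2).
Notation edge_sum := (edge_sum w1 w2).
Notation edge_prod := (edge_prod w1 w2).
Notation edge_rem := (edge_rem w1 w2).
Notation sq_sum := (sq_sum w1 w2).
Notation sigN := (sigN w1 w2).

(** The quasi-period of [w1] at finite level. It is at once the exponent gained by the box products
    of sigma under the shift and, in the limit, the increment of zeta, so the two are identified
    without taking a logarithmic derivative. *)
Definition etaN N : R[i] := 2 * edge_sum N + w1 * sq_sum N.

Lemma sigN_shift N z : (0 < N)%N ->
  sigN N (z + w1) * edge_rem N (- z) =
  - (sigN N z * edge_rem N (z + w1) * cexp ((z + w1 / 2) * etaN N)).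
Proof.
move=> N0; have [K hK] := sigN_factor area_neq0 N.
have hP := box_prod_shift area_neq0 z N0.
rewrite !edge_prodE in hP.
have h1 : edge_rem N (- z) = edge_rem N (- z) * cexp (- z * edge_sum N) * cexp (z * edge_sum N).
  by rewrite -mulrA -cexpD mulNr addNr cexp0 mulr1.
rewrite !hK h1; set P1 := \prod_(m <- box N) (z + w1 - _) in hP *.
set P := \prod_(m <- box N) (z - _) in hP *.
have h2 : cexp ((z + w1) ^+ 2 / 2 * sq_sum N) * cexp ((z + w1) * edge_sum N) * cexp (z * edge_sum N) =
   cexp (z ^+ 2 / 2 * sq_sum N) * cexp ((z + w1 / 2) * etaN N).
  by rewrite -!cexpD /etaN; congr cexp; field.
set c1 := cexp ((z + w1) ^+ 2 / 2 * _) in h2 *.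
set c2 := cexp (z * _) in h2 *.
set c3 := cexp (- z * _) in hP *.
set c4 := cexp (z ^+ 2 / 2 * _) in h2 *.
set c5 := cexp ((z + w1 / 2) * _) in h2 *.
set c6 := cexp ((z + w1) * _) in h2 hP *.
transitivity (K * c1 * c2 * (P1 * (edge_rem N (- z) * c3))); first by ring.
rewrite hP; transitivity (- (K * P * edge_rem N (z + w1) * (c1 * c6 * c2))); first by ring.
by rewrite h2; ring.
Qed.

Lemma wsigma_shift (eta : R[i]) z : ((etaN : nat -> R[i]^o) @ \oo --> (eta : R[i]^o)) ->
  wsigma w1 w2 (z + w1) = - (wsigma w1 w2 z * cexp ((z + w1 / 2) * eta)).
Proof.
move=> he.
have l1 : (fun N => sigN N (z + w1) * edge_rem N (- z) : R[i]^o) @ \oo --> (wsigma w1 w2 (z + w1) * 1 : R[i]^o).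
  by apply: cvgcM; [exact: sigN_cvg|exact: edge_rem_cvg].
have l2 : (fun N => 0 - (sigN N z * edge_rem N (z + w1) * cexp ((z + w1 / 2) * etaN N)) : R[i]^o) @ \oo -->
   (0 - (wsigma w1 w2 z * 1 * cexp ((z + w1 / 2) * eta)) : R[i]^o).
  apply: cvgcB; first exact: cvgc_cst.
  apply: cvgcM; first by apply: cvgcM; [exact: sigN_cvg|exact: edge_rem_cvg].
  exact: (cvgc_cexp (cvgcM (cvgc_cst (a := z + w1 / 2)) he)).
rewrite -[LHS]mulr1 -[X in - (X * _)]mulr1 -[RHS]sub0r; apply: (limc_unique _ l2).
move/cvgcP : l1 => l1; apply/cvgcP => e e0; near=> N.
rewrite sub0r -sigN_shift; last by near: N; exists 1%N.
by near: N; exact: l1.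
Unshelve. all: by end_near. Qed.

Definition zdev z m : R[i] := if m == 0 then 0 else (z - om m)^-1 + (om m)^-1 + z / om m ^+ 2.

Lemma zdev_summable z : ~ L z -> exists S : R, forall A : {fset int * int},
  \sum_(m <- A) normc (zdev z m) <= S.
Proof.
move=> Lz; have k0 := kap_gt0 area_neq0.
(* Outside [box N0] every period has norm at least [2 * normc z], which makes the term comparable to
   an inverse cube ([b]); the finitely many other terms are kept as they are ([c]). *)
have [N0 _ hN0] := near_large_mul (2 * normc z) k0.
exists (2 * normc z ^+ 2 / kap ^+ 3 * 32 + \sum_(m <- box N0) normc (zdev z m)) => F.
pose b m : R := 2 * normc z ^+ 2 / kap ^+ 3 * (lsize m ^+ 3)^-1.
pose c m : R := if m \in box N0 then normc (zdev z m) else 0.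
have b0 m : 0 <= b m.
  apply: mulr_ge0; last by rewrite invr_ge0 exprn_ge0// ltW// lsize_gt0.
  apply: divr_ge0; first by rewrite mulr_ge0// exprn_ge0// normc_ge0.
  by rewrite exprn_ge0// ltW.
apply: (@le_trans _ _ (\sum_(m <- F) (b m + c m))).
  apply: ler_sum => m _; rewrite /c; case: ifPn => mB; first by rewrite lerDr.
  rewrite addr0 /zdev; case: eqVneq => m0; first by rewrite Normc.normc0.
  have o0 := period_neq0 area_neq0 m0; have og := period_ge area_neq0 m0.
  have zo : z - om m != 0 by rewrite subr_eq0; apply/eqP => zE; apply: Lz; exists m.
  have -> : (z - om m)^-1 + (om m)^-1 + z / om m ^+ 2 = z ^+ 2 / (om m ^+ 2 * (z - om m)).
    by field; rewrite o0 zo.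
  have l0 := lsize_gt0 (R := R) m; have kl := mulr_gt0 k0 l0.
  have o2 : 2 * normc z <= normc (om m).
    apply: le_trans og; apply: le_trans (hN0 N0 (leqnn _)) _; rewrite ler_wpM2l ?(ltW k0)//.
    rewrite ler_nat; move: mB; rewrite mem_box; lia.
  have o3 : normc (om m) / 2 <= normc (z - om m).
    by rewrite normcB; apply: le_trans (le_normcB _ _); lra.
  have o4 : 0 < normc (om m) by rewrite normc_gt0.
  rewrite normc_div normcX Normc.normcM normcX /b.
  apply: (@le_trans _ _ (normc z ^+ 2 / (normc (om m) ^+ 2 * (normc (om m) / 2)))).
    rewrite ler_wpM2l ?exprn_ge0 ?normc_ge0// lef_pV2 ?posrE ?mulr_gt0 ?exprn_gt0 ?normc_gt0//.
    by rewrite ler_wpM2l// exprn_ge0// ltW.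
  have -> : normc z ^+ 2 / (normc (om m) ^+ 2 * (normc (om m) / 2)) = 2 * normc z ^+ 2 / normc (om m) ^+ 3.
    by field; rewrite gt_eqF.
  rewrite -[leRHS]mulrA ler_wpM2l ?mulr_ge0 ?exprn_ge0 ?normc_ge0//.
  rewrite -invfM -exprMn lef_pV2 ?posrE ?exprn_gt0//.
  by rewrite lerXn2r ?nnegrE// ltW.
rewrite big_split /=; apply: lerD.
  by rewrite -mulr_sumr ler_wpM2l ?sum_lsize_le// divr_ge0 ?mulr_ge0 ?exprn_ge0 ?normc_ge0// ltW.
apply: (@le_trans _ _ (\sum_(m <- (F `|` box N0)%fset) c m)).
  rewrite (big_fset_subset _ _ (fsubsetUl F (box N0))) /= lerDl sumr_ge0// => m _.
  by rewrite /c; case: ifP => // _; exact: normc_ge0.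
rewrite (big_fset_subset _ _ (fsubsetUr F (box N0))) /=.
rewrite [X in _ + X]big1_fset ?addr0.
  by rewrite le_eqVlt; apply/orP; left; apply/eqP; apply: eq_big_seq => m /= mB; rewrite /c mB.
by move=> m; rewrite !inE => /andP[/negbTE mB _] _; rewrite /c mB.
Qed.

Definition zetaN N z : R[i] := z^-1 + \sum_(m <- box N) zdev z m.

Lemma zetaN_cvg z : ~ L z -> (fun N => zetaN N z : R[i]^o) @ \oo --> (wzeta w1 w2 z : R[i]^o).
Proof.
move=> Lz; have [S hS] := zdev_summable Lz; have [l hl] := summable_sum_cvg hS.
have -> : wzeta w1 w2 z = z^-1 + l.
  rewrite /wzeta; congr (_ + _).
  have -> : (fun F : {fset int * int} => \sum_(m <- F | m != 0)
      ((z - om m)^-1 + (om m)^-1 + z / om m ^+ 2) : R[i]^o) = (fun F => \sum_(m <- F) zdev z m).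
    by apply/funext => F; rewrite big_mkcond; apply: eq_bigr => m _; rewrite /zdev; case: eqP.
  exact: limcE.
by apply: cvgcD; [exact: cvgc_cst|exact: (box_cvg hl)].
Qed.

Lemma zetaNE N z : zetaN N z = \sum_(m <- box N) (z - om m)^-1 + z * sq_sum N.
Proof.
have E1 : \sum_(m <- box N) (if m == 0 then 0 else (om m)^-1) = 0.
  apply: box_odd_sum => m; rewrite oppr_eq0; case: ifP => _; first by rewrite oppr0.
  by rewrite periodN invrN.
rewrite /zetaN /sq_sum mulr_sumr.
have -> : \sum_(m <- box N) (z - om m)^-1 = z^-1 + \sum_(m <- box N) (if m == 0 then 0 else (z - om m)^-1).
  rewrite (big_fsetD1 0 (mem0_box N)) /= period0 subr0; congr (_ + _).
  rewrite [RHS](big_fsetD1 0 (mem0_box N)) /= add0r.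
  by apply: eq_fbigr => m; rewrite !inE => /andP[/negbTE -> _].
rewrite -addrA -big_split /=; congr (_ + _).
rewrite -[RHS]addr0 -[X in _ = _ + X]E1 -big_split /=; apply: eq_bigr => m _.
by rewrite /zdev; case: eqP => _; ring.
Qed.

(** The additive counterpart of [box_prod_shift]: all columns but the entering and the leaving one
    cancel. *)
Lemma zetaN_shift N z :
  zetaN N (z + w1) - zetaN N z =
  \sum_(0 <= j < N.*2.+1) ((edge N j + (z + w1))^-1 + (edge N j - z)^-1) + w1 * sq_sum N.
Proof.
rewrite !zetaNE.
suff H : \sum_(m <- box N) (z + w1 - om m)^-1 = \sum_(m <- box N) (z - om m)^-1 +
   \sum_(0 <= j < N.*2.+1) ((edge N j + (z + w1))^-1 + (edge N j - z)^-1) by rewrite H; ring.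
rewrite !big_box exchange_big /= [in RHS]exchange_big /= big_split /=.
have -> : \sum_(0 <= j < N.*2.+1) (edge N j + (z + w1))^-1 =
  \sum_(0 <= j < N.*2.+1) (z - om (- N.+1%:Z, centered N j))^-1.
  rewrite (big_centered_opp _ N (fun j => (z - om (- N.+1%:Z, j))^-1)) /=.
  apply: eq_bigr => j _; rewrite /edge addrC -addrA; congr (_ + _)^-1.
  by rewrite -[X in X + _](period_w1 w1 w2) -periodN -periodD; congr om; apply: int_pairP => /=; lia.
rewrite -!big_split /=; apply: eq_bigr => j _.
pose f k := (z - om (k%:Z - N.+1%:Z, centered N j))^-1.
have -> : (edge N j - z)^-1 = - f N.*2.+1.
  by rewrite /f /edge -invrN opprB; congr (om (_, _) - z)^-1; lia.
have -> : (z - om (- N.+1%:Z, centered N j))^-1 = f 0%N by rewrite /f sub0r.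
have -> : \sum_(0 <= i < N.*2.+1) (z + w1 - om (centered N i, centered N j))^-1 = \sum_(0 <= i < N.*2.+1) f i.
  apply: eq_bigr => i _; rewrite /f -addrA; congr (_ + _)^-1.
  by rewrite -[X in X - _](period_w1 w1 w2) -!periodN -periodD; congr om; apply: int_pairP; rewrite /centered /=; lia.
have -> : \sum_(0 <= i < N.*2.+1) (z - om (centered N i, centered N j))^-1 = \sum_(0 <= i < N.*2.+1) f i.+1.
  apply: eq_bigr => i _; rewrite /f; congr (_ - om (_, _))^-1; rewrite /centered; lia.
by rewrite addrA [X in X - _]addrC -big_nat_recl//= [X in _ = X - _]big_nat_recr//= addrK.
Qed.

Lemma edge_inv_cvg B :
  (fun N => \sum_(0 <= j < N.*2.+1) ((edge N j + B)^-1 - (edge N j)^-1) : R[i]^o) @ \oo --> (0 : R[i]^o).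
Proof.
have k0 := kap_gt0 area_neq0.
pose C : R := 2 * normc B / kap ^+ 2.
have C0 : 0 <= C by rewrite divr_ge0 ?mulr_ge0 ?normc_ge0 ?exprn_ge0// ltW.
apply: (@cvgc_squeeze _ _ _ _ _ _ (fun N => 2 * C / N.+1%:R)); last exact: cvg_inv_succ.
near=> N; have N0 : (0 < N)%N by near: N; exists 1%N.
rewrite subr0; apply: (le_trans (normc_sum _ _ _)).
apply: le_trans (edge_sum_sqr_bound N C0); apply: ler_sum => j _.
have e0 := edge_gt0 area_neq0 j N0; have eg := edge_ge area_neq0 j N0.
have kl : 0 < kap * N.+1%:R := mulr_gt0 k0 (ltr0Sn _ N).
have e2 : 2 * normc B <= normc (edge N j).
  by apply: le_trans eg; near: N; exact: near_large_mul.
have e3 : normc (edge N j) / 2 <= normc (edge N j + B).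
  by rewrite -[B]opprK; apply: le_trans (le_normcB _ _); rewrite normcN; lra.
have e4 : 0 < normc (edge N j + B) by apply: lt_le_trans e3; rewrite divr_gt0.
have -> : (edge N j + B)^-1 - (edge N j)^-1 = - B / (edge N j * (edge N j + B)).
  by field; rewrite -!normc_gt0 e0 e4.
rewrite normc_div normcN Normc.normcM.
apply: (@le_trans _ _ (normc B / (normc (edge N j) * (normc (edge N j) / 2)))).
  rewrite ler_wpM2l ?normc_ge0// lef_pV2 ?posrE ?mulr_gt0//.
  by rewrite ler_wpM2l// ltW.
have -> : normc B / (normc (edge N j) * (normc (edge N j) / 2)) = 2 * normc B / normc (edge N j) ^+ 2.
  by field; rewrite gt_eqF.
rewrite /C -[leRHS]mulrA ler_wpM2l ?mulr_ge0 ?normc_ge0// -invfM -exprMn.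
rewrite lef_pV2 ?posrE ?exprn_gt0//.
by rewrite lerXn2r ?nnegrE// ltW.
Unshelve. all: by end_near. Qed.

Lemma period_lattice_shift z m : ~ L z -> ~ L (z + om m).
Proof.
move=> Lz [m' _ h]; apply: Lz; exists (m' - m) => //.
by rewrite periodD periodN h addrK.
Qed.

(** By [edge_inv_cvg], displacing the edge points by fixed amounts does not affect the limit, so
    both boundary sums of the zeta increment may be replaced by [edge_sum]. The limit of [etaN] is
    therefore the same for every [z]. *)
Lemma etaN_cvg z : ~ L z ->
  (etaN : nat -> R[i]^o) @ \oo --> (wzeta w1 w2 (z + w1) - wzeta w1 w2 z : R[i]^o).
Proof.
move=> Lz; have Lz1 : ~ L (z + w1).
  by have := period_lattice_shift (m := (1, 0)) Lz; rewrite period_w1.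
pose proof (cvgcB (cvgcB (zetaN_cvg Lz1) (zetaN_cvg Lz))
  (cvgcD (edge_inv_cvg (z + w1)) (edge_inv_cvg (- z)))) as h2.
rewrite addr0 subr0 in h2; apply: cvg_trans h2.
apply: near_eq_cvg; apply: nearW => N.
rewrite zetaN_shift -big_split /= /etaN -[LHS]addrA [w1 * _ - _]addrC addrA; congr (_ + _).
rewrite -sumrB /edge_sum mulr_sumr; apply: eq_bigr => j _; ring.
Qed.

End Shift.

(** * Riemann sums compared with the arctangent *)

Section AtanSum.
Context {R : realType}.

(** The increment of the arctangent is [h / (1 + c^2)] for some [c] between [a] and [a + h], and
    moving from [a] to [c] enlarges [1 + a^2] by a factor of at most [1 + h + h^2]. *)
Lemma inv_le_atan (a h : R) : 0 < h ->
  h / (1 + a ^+ 2) <= (1 + h + h ^+ 2) * (atan (a + h) - atan a).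
Proof.
move=> h0.
have [c hc ->] : exists2 c, c \in `]a, (a + h)[%R & atan (a + h) - atan a = (1 + c ^+ 2)^-1 * (a + h - a).
  have ah : a < a + h by rewrite ltrDl.
  have dr x : x \in `]a, (a + h)[%R -> is_derive x 1 (@atan R) (1 + x ^+ 2)^-1.
    by move=> _; exact: is_derive1_atan.
  apply: (MVT ah dr).
  by apply: continuous_subspaceT => x; exact: continuous_atan.
rewrite [a + h]addrC addrK.
have [ac ch] : a < c /\ c < a + h by move: hc; rewrite in_itv /= => /andP[].
have a0 : 0 < 1 + a ^+ 2 by rewrite ltr_pwDl// sqr_ge0.
have c0 : 0 < 1 + c ^+ 2 by rewrite ltr_pwDl// sqr_ge0.
rewrite ler_pdivrMr// mulrA mulrAC ler_peMl ?(ltW h0)//.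
rewrite mulrAC ler_pdivlMr// mul1r.
have h1 : c ^+ 2 <= a ^+ 2 + 2 * `|a| * h + h ^+ 2.
  have [cp|cn] := leP 0 c.
    have : c ^+ 2 <= (a + h) ^+ 2 by rewrite lerXn2r ?nnegrE; lra.
    have := ler_norm a; nra.
  have : c ^+ 2 <= a ^+ 2 by rewrite -sqrrN -(sqrrN a) lerXn2r ?nnegrE; lra.
  have := normr_ge0 a; nra.
have h2 : 2 * `|a| <= 1 + a ^+ 2.
  have := sqr_ge0 (`|a| - 1); have := real_normK (num_real a); nra.
have h3 : 0 <= a ^+ 2 := sqr_ge0 a.
nra.
Qed.

Lemma sum_inv_le_pi (M : nat) (y0 h : R) : 0 < h ->
  \sum_(0 <= j < M) h / (1 + (y0 + j%:R * h) ^+ 2) <= (1 + h + h ^+ 2) * pi.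
Proof.
move=> h0.
apply: (@le_trans _ _ (\sum_(0 <= j < M) (1 + h + h ^+ 2) * (atan (y0 + j.+1%:R * h) - atan (y0 + j%:R * h)))).
  apply: ler_sum => j _; have -> : y0 + j.+1%:R * h = (y0 + j%:R * h) + h by rewrite -natr1; ring.
  exact: inv_le_atan.
rewrite -mulr_sumr telescope_sumr// ler_wpM2l//.
  by rewrite !addr_ge0 ?exprn_ge0// ltW.
have := atan_gtNpi2 (y0 + 0%:R * h); have := atan_ltpi2 (y0 + M%:R * h); lra.
Qed.

(** The imaginary part of [1 / (N t + j)] is, up to sign, the density [1 / (1 + y^2)] sampled with
    mesh [h]. The arctangent increments telescope to at most [pi]. *)
Lemma sum_Im_inv_le (t : R[i]) (N : nat) (h : R) : complex.Im t != 0 -> (0 < N)%N ->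
  h = (N%:R * `|complex.Im t|)^-1 ->
  \sum_(0 <= j < N.*2.+1) `|complex.Im ((N%:R * t + (centered N j)%:~R)^-1)| <= (1 + h + h ^+ 2) * pi.
Proof.
move=> t0 N0 hE.
have r0 : 0 < `|complex.Im t| by rewrite normr_gt0.
have N0' : 0 < N%:R :> R by rewrite ltr0n.
have h0 : 0 < h by rewrite hE invr_gt0 mulr_gt0.
apply: le_trans (sum_inv_le_pi N.*2.+1 ((N%:R * complex.Re t - N%:R) * h) h0).
apply: ler_sum => j _.
set x := N%:R * complex.Re t + (centered N j)%:~R : R.
have -> : N%:R * t + (centered N j)%:~R = x +i* (N%:R * complex.Im t).
  rewrite -[(centered N j)%:~R](rmorph_int (real_complex R)) -[N%:R](rmorph_nat (real_complex R)).
  rewrite /x; case: (t) => a b; apply: complexP; rewrite /=; ring.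
have -> : (N%:R * complex.Re t - N%:R) * h + j%:R * h = x * h.
  by rewrite /x /centered rmorphB /= -!pmulrn; ring.
have D0 : 0 < x ^+ 2 + (N%:R * complex.Im t) ^+ 2.
  by rewrite ltr_wpDl ?sqr_ge0// exprn_even_gt0//= mulf_neq0// gt_eqF.
rewrite /= normrN normrM [X in _ * X]ger0_norm ?invr_ge0 ?(ltW D0)//.
rewrite normrM normr_nat.
have -> : N%:R * `|complex.Im t| = h^-1 by rewrite hE invrK.
have -> : (N%:R * complex.Im t) ^+ 2 = h^-1 ^+ 2.
  by rewrite hE invrK !exprMn real_normK ?num_real.
rewrite le_eqVlt; apply/orP; left; apply/eqP.
have D1 : 0 < 1 + (x * h) ^+ 2 by rewrite ltr_pwDl// sqr_ge0.
have D2 : 0 < x ^+ 2 * h ^+ 2 + 1 by rewrite -exprMn addrC.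
by field; rewrite !gt_eqF//=; rewrite addrC exprMn in D1.
Qed.

End AtanSum.

(** * Exchange of the two periods *)

Section Swap.
Context {R : realType}.
Implicit Types (w z : R[i]) (m : int * int).

Definition swapz m := (m.2, m.1).

Lemma period_swap w1 w2 m : period w1 w2 m = period w2 w1 (swapz m).
Proof. by rewrite /period /= addrC. Qed.

Lemma swapz_eq0 m : (swapz m == 0) = (m == 0).
Proof. by case: m => a b; rewrite !xpair_eqE andbC. Qed.

Lemma box_swap (T : Type) (idx : T) (op : Monoid.com_law idx) N (f : int * int -> T) :
  \big[op/idx]_(m <- box N) f m = \big[op/idx]_(m <- box N) f (swapz m).
Proof. by rewrite !big_box exchange_big. Qed.

(** The exchange reverses orientation. The shift formulas are stated for [w1] and a nonzero area of
    either sign, so that those for [w2] follow by exchanging the periods. *)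
Lemma area_swap w1 w2 : period_area w2 w1 = - period_area w1 w2.
Proof. by rewrite /period_area; case: w1 w2 => [a b] [c d] /=; ring. Qed.

Lemma sq_sum_swap w1 w2 N : sq_sum w2 w1 N = sq_sum w1 w2 N.
Proof.
rewrite /sq_sum box_swap; apply: eq_bigr => m _.
by rewrite swapz_eq0 [period w1 w2 m]period_swap.
Qed.

Lemma sigN_swap w1 w2 N z : sigN w2 w1 N z = sigN w1 w2 N z.
Proof.
rewrite /sigN box_swap; congr (_ * _); apply: eq_bigr => m _.
by rewrite /wdev swapz_eq0 [period w1 w2 m]period_swap.
Qed.

Lemma zetaN_swap w1 w2 N z : zetaN w2 w1 N z = zetaN w1 w2 N z.
Proof.
rewrite /zetaN box_swap; congr (_ + _); apply: eq_bigr => m _.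
by rewrite /zdev swapz_eq0 [period w1 w2 m]period_swap.
Qed.

Lemma lattice_swap w1 w2 z : period_lattice w2 w1 z <-> period_lattice w1 w2 z.
Proof. by split=> -[m _ <-]; exists (swapz m) => //; rewrite [RHS]period_swap. Qed.

Lemma wsigma_swap w1 w2 z : period_area w1 w2 != 0 -> wsigma w2 w1 z = wsigma w1 w2 z.
Proof.
move=> a0; have b0 : period_area w2 w1 != 0 by rewrite area_swap oppr_eq0.
have h1 := sigN_cvg a0 (z := z); have h2 := sigN_cvg b0 (z := z).
apply: (limc_unique h2); under eq_fun do rewrite sigN_swap.
exact: h1.
Qed.

Lemma wzeta_swap w1 w2 z : period_area w1 w2 != 0 -> ~ period_lattice w1 w2 z ->
  wzeta w2 w1 z = wzeta w1 w2 z.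
Proof.
move=> a0 Lz; have b0 : period_area w2 w1 != 0 by rewrite area_swap oppr_eq0.
have Lz' : ~ period_lattice w2 w1 z by move/lattice_swap.
have h1 := zetaN_cvg a0 Lz; have h2 := zetaN_cvg b0 Lz'.
apply: (limc_unique h2); under eq_fun do rewrite zetaN_swap.
exact: h1.
Qed.

End Swap.

(** * Proof of the Legendre relation *)

Section Legendre.
Context {R : realType}.
Variables w1 w2 : R[i].
Hypothesis area_gt0 : 0 < period_area w1 w2.

Let a0 : period_area w1 w2 != 0. Proof. by rewrite gt_eqF. Qed.
Let b0 : period_area w2 w1 != 0. Proof. by rewrite area_swap oppr_eq0. Qed.

(** [weta] is defined by choice; the existence of a point off the lattice makes the chosen value
    unique. *)
Lemma weta_eq (w e : R[i]) : (forall z, ~ period_lattice w1 w2 z ->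
   wzeta w1 w2 (z + w) - wzeta w1 w2 z = e) -> weta w1 w2 w = e.
Proof.
move=> H; have [z Lz] := exists_nonperiod a0; rewrite /weta.
case: xgetP => [e' _ he'|/(_ e) he]; last by case: he.
by rewrite -(he' z Lz) H.
Qed.

Lemma eta1_cvg : (etaN w1 w2 : nat -> R[i]^o) @ \oo --> (weta w1 w2 w1 : R[i]^o).
Proof.
have [z Lz] := exists_nonperiod a0; have h := etaN_cvg a0 Lz.
suff -> : weta w1 w2 w1 = wzeta w1 w2 (z + w1) - wzeta w1 w2 z by [].
apply: weta_eq => z' Lz'; exact: limc_unique (etaN_cvg a0 Lz') h.
Qed.

Lemma eta2_cvg : (etaN w2 w1 : nat -> R[i]^o) @ \oo --> (weta w1 w2 w2 : R[i]^o).
Proof.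
have [z Lz] := exists_nonperiod a0.
have Lz' : ~ period_lattice w2 w1 z by move/lattice_swap.
have h := etaN_cvg b0 Lz'.
suff -> : weta w1 w2 w2 = wzeta w2 w1 (z + w2) - wzeta w2 w1 z by [].
apply: weta_eq => y Ly; have Ly' : ~ period_lattice w2 w1 y by move/lattice_swap.
have Ly2 : ~ period_lattice w1 w2 (y + w2).
  have := period_lattice_shift (m := (0, 1)) Ly.
  by rewrite /period /= mulr0z mulr1z add0r.
rewrite -!(wzeta_swap a0)//.
exact: limc_unique (etaN_cvg b0 Ly') h.
Qed.

(** Adding [u2] to an edge point gives the next one, so the product telescopes and only a ratio of
    two corner values is left. *)
Lemma edge_prod_w2 (u1 u2 : R[i]) (N : nat) : period_area u1 u2 != 0 -> (0 < N)%N ->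
  edge_prod u1 u2 N u2 * (N%:R * (u1 - u2)) = N.+1%:R * (u1 + u2) - u1.
Proof.
move=> u0 N0; pose P := \prod_(0 <= j < N.*2.+1) edge u1 u2 N j.
have P0 : P != 0 by rewrite /P prodf_seq_neq0; apply/allP => j _ /=; rewrite edge_neq0.
apply: (mulfI P0).
pose f k := u1 * N%:R + u2 * (k%:R - N%:R).
have fE j : edge u1 u2 N j = f j.
  by rewrite /edge /period /= /f -[u1 *~ _]mulrzr -[u2 *~ _]mulrzr /centered intrB -!pmulrn.
have e1 : P * edge_prod u1 u2 N u2 = \prod_(0 <= j < N.*2.+1) f j.+1.
  rewrite /P /edge_prod -big_split /=; apply: eq_bigr => j _.
  rewrite mulrDr mulr1 mulrCA divff ?edge_neq0// mulr1 fE /f -natr1; ring.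
rewrite [LHS]mulrA e1.
have -> : N%:R * (u1 - u2) = f 0%N by rewrite /f; ring.
rewrite mulrC -big_nat_recl//= big_nat_recr//=.
congr (_ * _); first by apply: eq_bigr => j _; rewrite fE.
rewrite /f -addnn -natr1 natrD -natr1; ring.
Qed.

(** Half of the Legendre expression at finite level; the contributions of [sq_sum] to the two
    quasi-periods cancel. *)
Definition legendreN (N : nat) : R[i] := w2 * edge_sum w1 w2 N - w1 * edge_sum w2 w1 N.

Lemma legendreN_cvg : (legendreN : nat -> R[i]^o) @ \oo -->
  ((weta w1 w2 w1 * w2 - weta w1 w2 w2 * w1) / 2 : R[i]^o).
Proof.
pose proof (cvgcM (cvgcB (cvgcM eta1_cvg (cvgc_cst (a := w2)))
  (cvgcM eta2_cvg (cvgc_cst (a := w1)))) (cvgc_cst (a := 2^-1))) as h.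
apply: cvg_trans h; apply: near_eq_cvg; apply: nearW => N.
by rewrite /etaN /legendreN sq_sum_swap; field.
Qed.

(** The quotient of the telescoped products of the two edges. Their starting corners [N (w1 - w2)]
    and [N (w2 - w1)] are opposite, whence the minus sign. *)
Lemma legendreN_cexp N : (0 < N)%N ->
  cexp (legendreN N) * edge_rem w1 w2 N w2 * (N.+1%:R * (w2 + w1) - w2) =
  - (edge_rem w2 w1 N w1 * (N.+1%:R * (w1 + w2) - w1)).
Proof.
move=> N0.
have h1 := edge_prod_w2 a0 N0; have h2 := edge_prod_w2 b0 N0.
rewrite -h1 -h2 !edge_prodE /legendreN cexpB.
have c0 := cexp_neq0 (w1 * edge_sum w2 w1 N).
by field.
Qed.

Lemma legendre_exp : cexp ((weta w1 w2 w1 * w2 - weta w1 w2 w2 * w1) / 2) = -1.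
Proof.
set l := (X in cexp X).
have s0 : w1 + w2 != 0.
  apply: contraNneq a0 => /eqP; rewrite addrC addr_eq0 => /eqP ->.
  by rewrite /period_area; case: (w1) => a b /=; apply/eqP; ring.
apply: (mulIf s0).
have hd (u : R[i]) : (fun N => (w1 + w2) - u * (N.+1%:R^-1) : R[i]^o) @ \oo --> ((w1 + w2) - u * 0 : R[i]^o).
  apply: cvgcB; first exact: cvgc_cst.
  apply: cvgcM; first exact: cvgc_cst.
  apply: (@cvgc_squeeze _ _ _ _ _ _ (fun N => 1 / N.+1%:R)); last exact: cvg_inv_succ.
  by apply: nearW => N; rewrite subr0 Normc.normcV normc_natr mul1r.
pose proof (cvgcM (cvgcM (cvgc_cexp legendreN_cvg) (edge_rem_cvg a0 w2)) (hd w2)) as l1.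
pose proof (cvgcB (cvgc_cst (a := 0)) (cvgcM (edge_rem_cvg b0 w1) (hd w1))) as l2.
rewrite !mulr0 !subr0 mulr1 in l1; rewrite !mulr0 !subr0 mul1r sub0r in l2.
rewrite mulN1r; apply: (limc_unique l1); apply: cvg_trans l2.
apply: near_eq_cvg; near=> N.
have N0 : (0 < N)%N by near: N; exists 1%N.
have n0 : N.+1%:R != 0 :> R[i] by rewrite pnatr_eq0.
apply: (mulIf n0); have := legendreN_cexp N0 => h.
have e (u : R[i]) : N.+1%:R * (w1 + w2) - u = (w1 + w2 - u * N.+1%:R^-1) * N.+1%:R.
  by rewrite mulrBl -mulrA mulVf// mulr1 mulrC.
rewrite [w2 + w1]addrC !e in h; rewrite sub0r mulNr.
move: h; rewrite !mulrA => h.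
by rewrite h.
Unshelve. all: by end_near. Qed.

Lemma cos_eqN1 (x : R) : 0 <= x <= 2 * pi -> cos x = -1 -> x = pi.
Proof.
move=> /andP[x0 x2] hc.
have h : cos (x / 2) = cos (pi / 2).
  rewrite cos_pihalf; have h : cos x = cos (x / 2) ^+ 2 * 2 - 1.
    by rewrite {1}(splitr x) -mulr2n cos_mulr2n mulr_natr.
  have : cos (x / 2) ^+ 2 = 0 by lra.
  by move=> /eqP; rewrite sqrf_eq0 => /eqP.
have : x / 2 = pi / 2.
  by apply: cos_inj => //; rewrite in_itv /=; have := pi_gt0 R; lra.
lra.
Qed.

(** All terms of the sum have imaginary parts of the same sign, so the sum lies on one side of 0,
    and the arctangent comparison bounds it on the other. *)
Lemma Im_edge_sum_bounds (u1 u2 : R[i]) (N : nat) (h : R) :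
  u1 != 0 -> u2 != 0 -> complex.Im (u1 / u2) != 0 -> (0 < N)%N -> h = (N%:R * `|complex.Im (u1 / u2)|)^-1 ->
  (forall j, 0 <= - Num.sg (complex.Im (u1 / u2)) * complex.Im (u2 / edge u1 u2 N j)) /\
  0 <= - Num.sg (complex.Im (u1 / u2)) * complex.Im (u2 * edge_sum u1 u2 N) <= (1 + h + h ^+ 2) * pi.
Proof.
move=> u10 u20 t0 N0 hE.
have eE j : u2 / edge u1 u2 N j = (N%:R * (u1 / u2) + (centered N j)%:~R)^-1.
  have -> : edge u1 u2 N j = u2 * (N%:R * (u1 / u2) + (centered N j)%:~R).
    rewrite /edge /period /= -[u1 *~ _]mulrzr -[u2 *~ _]mulrzr -pmulrn.
    by move: ((centered N j)%:~R) => x; field.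
  by rewrite invfM mulVKf.
have h1 j : 0 <= - Num.sg (complex.Im (u1 / u2)) * complex.Im (u2 / edge u1 u2 N j).
  rewrite eE; set t := u1 / u2.
  rewrite -[(centered N j)%:~R](rmorph_int (real_complex R)) -[N%:R](rmorph_nat (real_complex R)).
  case: t => a b /=; rewrite !mul0r !addr0 subr0 mulrN mulNr opprK mulrA.
  rewrite divr_ge0 ?addr_ge0 ?sqr_ge0//.
  by rewrite mulrCA mulr_ge0// -normrEsg.
split=> //; have -> : complex.Im (u2 * edge_sum u1 u2 N) = \sum_(0 <= j < N.*2.+1) complex.Im (u2 / edge u1 u2 N j).
  rewrite /edge_sum mulr_sumr; apply: (big_morph (@complex.Im R)) => //.
  exact: cImD.
rewrite mulr_sumr; apply/andP; split; first by rewrite sumr_ge0// => j _; exact: h1.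
apply: le_trans (sum_Im_inv_le t0 N0 hE); apply: ler_sum => j _.
rewrite -eE (le_trans (ler_norm _))// normrM normrN normr_sg t0 mul1r//.
Qed.

(** [legendre_exp] determines half of the expression only modulo [2 pi i]. The bounds on the edge
    sums confine its imaginary part to [[0, 2 pi]], where the cosine equals -1 only at [pi]. *)
Lemma legendre : weta w1 w2 w1 * w2 - weta w1 w2 w2 * w1 = 2 * pi%:C * 'i%C.
Proof.
set e := LHS.
have he := legendre_exp; rewrite -/e in he.
have l0 : forall x : R[i], x = 0 -> complex.Im x = 0 by move=> x ->.
have D0 := area_gt0.
have n1 : w1 != 0.
  by apply: contraTneq D0 => ->; rewrite /period_area conjc0 mul0r ltxx.
have n2 : w2 != 0.
  by apply: contraTneq D0 => ->; rewrite /period_area mulr0 ltxx.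
have q1 : complex.Im (w1 / w2) < 0.
  have -> : complex.Im (w1 / w2) = - (period_area w1 w2 / (normc w2) ^+ 2).
    rewrite /period_area normc2E; case: w1 w2 => [a b] [c d] /=; ring.
  by rewrite oppr_lt0 divr_gt0// exprn_gt0// normc_gt0.
have q2 : 0 < complex.Im (w2 / w1).
  have -> : complex.Im (w2 / w1) = period_area w1 w2 / (normc w1) ^+ 2.
    rewrite /period_area normc2E; case: w1 w2 => [a b] [c d] /=; ring.
  by rewrite divr_gt0// exprn_gt0// normc_gt0.
have [_ himg] : (fun N => complex.Re (legendreN N)) @ \oo --> complex.Re (e / 2) /\
  (fun N => complex.Im (legendreN N)) @ \oo --> complex.Im (e / 2).
  by apply/cvgc_ReIm; exact: legendreN_cvg.
pose h1 N : R := (N%:R * `|complex.Im (w1 / w2)|)^-1.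
pose h2 N : R := (N%:R * `|complex.Im (w2 / w1)|)^-1.
(* By the orientation of the basis both edge sums contribute with a nonnegative sign, and each
   contributes at most [pi] in the limit. *)
have bnd N : (0 < N)%N -> 0 <= complex.Im (legendreN N) <= (1 + h1 N + h1 N ^+ 2) * pi + (1 + h2 N + h2 N ^+ 2) * pi.
  move=> N0.
  have [_ b1] := Im_edge_sum_bounds n1 n2 (ltr0_neq0 q1) N0 (erefl (h1 N)).
  have [_ b2] := Im_edge_sum_bounds n2 n1 (lt0r_neq0 q2) N0 (erefl (h2 N)).
  move: b1 b2; rewrite ltr0_sg// gtr0_sg// opprK mul1r mulN1r /legendreN cImD cImN.
  move=> /andP[x1 x2] /andP[x3 x4]; apply/andP; split; first exact: addr_ge0.
  exact: lerD.
have hlim (r : R) : (fun N : nat => (N%:R * r)^-1) @ \oo --> (0 : R).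
  have -> : (fun N : nat => (N%:R * r)^-1) = (fun N : nat => N%:R^-1 * r^-1).
    by apply/funext => N; rewrite invfM.
  rewrite -(mul0r r^-1); apply: cvgM; last exact: cvg_cst.
  rewrite -(cvg_shiftS (fun N : nat => N%:R^-1 : R)); exact: cvg_harmonic.
have hlim2 (r : R) : (fun N : nat => (1 + (N%:R * r)^-1 + (N%:R * r)^-1 ^+ 2) * pi : R) @ \oo --> (1 + 0 + 0 * 0 : R) * pi.
  apply: cvgM; last exact: cvg_cst.
  apply: cvgD; first by apply: cvgD; [exact: cvg_cst|exact: hlim].
  by apply: cvgM; exact: hlim.
have i0 : 0 <= complex.Im (e / 2).
  by apply: (cvgr_to_ge himg); exists 1%N => // N /= /bnd /andP[].
have i1 : complex.Im (e / 2) <= 2 * pi.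
  rewrite -subr_ge0; pose proof (cvgB (cvgD (hlim2 `|complex.Im (w1 / w2)|) (hlim2 `|complex.Im (w2 / w1)|)) himg) as hl.
  have -> : 2 * pi = (1 + 0 + 0 * 0 : R) * pi + (1 + 0 + 0 * 0 : R) * pi by ring.
  by apply: (cvgr_to_ge hl); exists 1%N => // N /= /bnd /andP[_]; rewrite subr_ge0.
have re0 : expR (complex.Re (e / 2)) = 1 by rewrite -normc_cexp he normcN Normc.normc1.
have cos1 : cos (complex.Im (e / 2)) = -1.
  by have := f_equal (@complex.Re R) he; rewrite /= re0 mul1r.
have im : complex.Im (e / 2) = pi by apply: cos_eqN1 => //; rewrite i0.
have re : complex.Re (e / 2) = 0 by apply: expR_inj; rewrite re0 expR0.
have -> : e = 2 * (e / 2) by rewrite mulrC divfK.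
rewrite -mulrA; congr (_ * _); apply: complexP; rewrite ?re ?im /=; ring.
Qed.

End Legendre.

(** * Growth of the modified sigma function *)

Lemma natC {R : realType} (n : nat) : (n%:R : R[i]) = (n%:R : R)%:C.
Proof. by rewrite rmorph_nat. Qed.

Section Growth.
Context {R : realType}.
Variables w1 w2 : R[i].
Hypothesis area_gt0 : 0 < period_area w1 w2.
Implicit Types (z w : R[i]).

Let a0 : period_area w1 w2 != 0. Proof. by rewrite gt_eqF. Qed.
Let b0 : period_area w2 w1 != 0. Proof. by rewrite area_swap oppr_eq0. Qed.

Notation al := (alpha_const w1 w2).

Lemma denomE : w1 * conjc w2 - w2 * conjc w1 = - (2 * (period_area w1 w2)%:C * 'i%C).
Proof. by rewrite /period_area; case: w1 w2 => [a b] [c d]; apply: complexP; rewrite /=; ring. Qed.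

Lemma denom_neq0 : w1 * conjc w2 - w2 * conjc w1 != 0.
Proof.
rewrite denomE oppr_eq0 !mulf_neq0 ?pnatr_eq0//.
  by rewrite -normc_eq0 normc_real normr_eq0.
by apply/eqP => /(f_equal (@complex.Im R)) /= /eqP; rewrite oner_eq0.
Qed.

Lemma alphaE : 2 * al%:C * (w1 * conjc w2 - w2 * conjc w1) = - (2 * pi%:C * 'i%C).
Proof.
rewrite denomE /alpha_const.
have -> : pi%:C = 2 * (pi / (2 * period_area w1 w2))%:C * (period_area w1 w2)%:C :> R[i].
  rewrite (natC 2) -!rmorphM /=; congr (_%:C); by field.
ring.
Qed.

(** The reason for the choice of [a_const]: by the Legendre relation the Gaussian correction turns
    the quasi-period of [w1] into a multiple of [conjc w1]. *)
Lemma weta1_a : weta w1 w2 w1 + 2 * a_const w1 w2 * w1 = 2 * al%:C * conjc w1.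
Proof.
apply: (mulIf denom_neq0); rewrite [RHS]mulrAC alphaE -(legendre area_gt0) /a_const.
have := denom_neq0; set d := _ - _ => d0.
rewrite mulrDl; have -> : 2 * (1 / 2 * ((weta w1 w2 w2 * conjc w1 - weta w1 w2 w1 * conjc w2) / d)) * w1 * d =
  (weta w1 w2 w2 * conjc w1 - weta w1 w2 w1 * conjc w2) * w1 by field.
by rewrite /d; ring.
Qed.

Lemma weta2_a : weta w1 w2 w2 + 2 * a_const w1 w2 * w2 = 2 * al%:C * conjc w2.
Proof.
apply: (mulIf denom_neq0); rewrite [RHS]mulrAC alphaE -(legendre area_gt0) /a_const.
have := denom_neq0; set d := _ - _ => d0.
rewrite mulrDl; have -> : 2 * (1 / 2 * ((weta w1 w2 w2 * conjc w1 - weta w1 w2 w1 * conjc w2) / d)) * w2 * d =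
  (weta w1 w2 w2 * conjc w1 - weta w1 w2 w1 * conjc w2) * w2 by field.
by rewrite /d; ring.
Qed.

Definition sigma_weight z : R := normc (sigma_mod w1 w2 z) * expR (- (al * normc z ^+ 2)).

(** The real part of the exponent [2 alpha (z + w / 2) conjc w] is [alpha] times the increment of
    the squared modulus from [z] to [z + w], which the weight cancels. *)
Lemma sigma_weight_shift (w eta : R[i]) z :
  wsigma w1 w2 (z + w) = - (wsigma w1 w2 z * cexp ((z + w / 2) * eta)) ->
  eta + 2 * a_const w1 w2 * w = 2 * al%:C * conjc w ->
  sigma_weight (z + w) = sigma_weight z.
Proof.
move=> hs he; rewrite /sigma_weight.
have -> : sigma_mod w1 w2 (z + w) = - (sigma_mod w1 w2 z * cexp ((z + w / 2) * (2 * al%:C * conjc w))).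
  rewrite /sigma_mod hs -he mulNr; congr (- _).
  by rewrite -[LHS]mulrA -[RHS]mulrA -!cexpD; congr (_ * cexp _); field.
rewrite normcN Normc.normcM normc_cexp -mulrA -expRD; congr (_ * expR _).
rewrite !normc2E; case: z {hs} => a b; case: w {he} => c d.
have -> : (c +i* d) / 2 = (c / 2) +i* (d / 2).
  have two0 : (2 : R[i]) != 0 by rewrite pnatr_eq0.
  apply: (mulIf two0); rewrite divfK//.
  by rewrite (natC 2); apply: complexP; rewrite /=; field.
by rewrite (natC 2) /=; field.
Qed.

Lemma sigma_weight_w1 z : sigma_weight (z + w1) = sigma_weight z.
Proof. by apply: (sigma_weight_shift _ weta1_a); apply: wsigma_shift a0 _ _ (eta1_cvg area_gt0). Qed.

Lemma sigma_weight_w2 z : sigma_weight (z + w2) = sigma_weight z.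
Proof.
apply: (sigma_weight_shift _ weta2_a).
rewrite -!(wsigma_swap _ a0); apply: wsigma_shift b0 _ _ (eta2_cvg area_gt0).
Qed.

Lemma periodic_int (f : R[i] -> R) w : (forall z, f (z + w) = f z) ->
  forall (k : int) z, f (z + w *~ k) = f z.
Proof.
move=> fw; have fn (k : nat) z : f (z + w *+ k) = f z.
  by elim: k z => [|k IH] z; rewrite ?mulr0n ?addr0// mulrS addrA IH.
case=> k z; first exact: fn.
by rewrite NegzE mulrNz -[in RHS](subrK (w *~ k.+1) z) fn.
Qed.

Lemma lattice_reduction z : exists z', exists m,
  period_parallelogram w1 w2 z' /\ z = z' + period w1 w2 m.
Proof.
pose D := period_area w1 w2.
pose x := complex.Im (conjc z * w2) / D; pose y := complex.Im (conjc w1 * z) / D.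
have zE : z = x%:C * w1 + y%:C * w2.
  have D0 : D%:C != 0 :> R[i] by rewrite -normc_eq0 normc_real normr_eq0.
  apply: (mulfI D0); rewrite mulrDr !mulrA -!rmorphM /= /x /y ![D * _]mulrC !divfK//.
  rewrite /D /period_area; case: (z) (w1) (w2) => [a b] [c d] [e f].
  by apply: complexP; rewrite /=; ring.
exists ((x - (Num.floor x)%:~R)%:C * w1 + (y - (Num.floor y)%:~R)%:C * w2), (Num.floor x, Num.floor y).
have fr (t : R) : 0 <= t - (Num.floor t)%:~R < 1.
  by rewrite subr_ge0 floor_le ltrBlDl -[1]/(1%:~R) -intrD lt_succ_floor.
split; first by exists (x - (Num.floor x)%:~R), (y - (Num.floor y)%:~R); split.
by rewrite periodE /= [LHS]zE !rmorphB /=; ring.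
Qed.

(** [sup] is informative only on a nonempty bounded set; boundedness comes from the bound of sigma
    on a disc containing the parallelogram. *)
Lemma c_const_has_sup : has_sup [set normc (sigma_mod w1 w2 z) * expR (- (al * normc z ^+ 2))
      | z in period_parallelogram w1 w2].
Proof.
split.
  by exists (sigma_weight 0), 0 => //; exists 0, 0; rewrite lexx ltr01 !mul0r addr0.
have [M hM] := wsigma_bound a0 (addr_ge0 (normc_ge0 w1) (normc_ge0 w2)).
pose r := normc w1 + normc w2.
exists (M * expR (normc (a_const w1 w2) * r ^+ 2)) => _ [z [x [y [/andP[x0 x1] /andP[y0 y1] zE]]] <-].
have zr : normc z <= r.
  rewrite zE (le_trans (le_normcD _ _))// /r lerD// Normc.normcM normc_real ger0_norm//.
    by rewrite ler_piMl ?normc_ge0// ltW.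
  by rewrite ler_piMl ?normc_ge0// ltW.
have al0 : 0 <= al by rewrite divr_ge0 ?pi_ge0 ?mulr_ge0// ltW.
rewrite /sigma_mod Normc.normcM -[leRHS]mulr1 ler_pM ?mulr_ge0 ?normc_ge0 ?expR_ge0//; last first.
  by rewrite -expR0 ler_expR oppr_le0 mulr_ge0// exprn_ge0 ?normc_ge0.
rewrite ler_pM ?normc_ge0//; first exact: hM.
rewrite (le_trans (normc_cexp_le _))// ler_expR Normc.normcM normcX ler_wpM2l ?normc_ge0//.
by rewrite lerXn2r ?nnegrE ?normc_ge0// /r addr_ge0 ?normc_ge0.
Qed.

Lemma sigma_weight_le z : sigma_weight z <= c_const w1 w2.
Proof.
have [z' [m [hz' ->]]] := lattice_reduction z.
rewrite /period addrA (periodic_int sigma_weight_w2) (periodic_int sigma_weight_w1).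
by apply: ub_le_sup; [case: c_const_has_sup|exists z'].
Qed.

Lemma c_const_ge0 : 0 <= c_const w1 w2.
Proof.
by apply: le_trans (sigma_weight_le 0); rewrite mulr_ge0 ?normc_ge0 ?expR_ge0.
Qed.

Lemma sigma_mod_le z : normc (sigma_mod w1 w2 z) <= c_const w1 w2 * expR (al * normc z ^+ 2).
Proof.
by rewrite -ler_pdivrMr ?expR_gt0// -expRN; exact: sigma_weight_le.
Qed.

(** Along the positive reals suffices: it identifies the leading Taylor coefficient and shows that
    [c_const] is positive. *)
Lemma sigma_mod_near0 (e : R) : 0 < e -> exists2 d : R, 0 < d & forall x : R, 0 < x < d ->
  exists2 l, sigma_mod w1 w2 x%:C = x%:C * l & normc (l - 1) < e.
Proof.
move=> e0; have [C C0 hC] := wsigma_near0 a0.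
pose A := normc (a_const w1 w2).
(* The first summand is a Lipschitz constant for [l - 1]. The second is one for the Gaussian factor
   minus 1, multiplied by the bound [expR C] of [l]. *)
pose K := (C * expR C + A * expR A * expR C).
have A0 : 0 <= A := normc_ge0 _.
have K0 : 0 <= K by rewrite !addr_ge0 ?mulr_ge0 ?expR_ge0.
exists (Num.min 1 (e / (K + 1))); first by rewrite lt_min ltr01 divr_gt0// ltr_wpDl.
move=> x /andP[x0]; rewrite lt_min => /andP[x1 xe].
have nx : normc x%:C = x by rewrite normc_real gtr0_norm.
have [|l hl l1] := hC x%:C; first by rewrite nx ltW.
exists (l * cexp (a_const w1 w2 * x%:C ^+ 2)); first by rewrite /sigma_mod hl mulrA.
rewrite nx in l1.
have exp1 (y : R) : 0 <= y -> y <= 1 -> forall c, 0 <= c -> expR (c * y) - 1 <= c * expR c * y.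
  move=> y0 y1 c c0; have := cexp_taylor0 (c * y)%:C.
  have -> : cexp (c * y)%:C - 1 = (expR (c * y) - 1)%:C by rewrite cexp_real rmorphB.
  rewrite !normc_real ger0_norm.
    rewrite ger0_norm ?mulr_ge0// => /le_trans; apply; rewrite mulrAC ler_wpM2r// ler_wpM2l// ler_expR.
    by rewrite ler_piMr.
  by rewrite subr_ge0 -expR0 ler_expR mulr_ge0.
set E := cexp _.
have -> : l * E - 1 = l * (E - 1) + (l - 1) by ring.
have El : normc (E - 1) <= A * expR A * x.
  rewrite (le_trans (cexp_taylor0 _))// Normc.normcM normcX nx -/A.
  have x2 : x ^+ 2 <= x by rewrite expr2 ler_piMr// ltW.
  have x21 : x ^+ 2 <= 1 by rewrite (le_trans x2)// ltW.
  rewrite mulrAC ler_pM ?mulr_ge0 ?exprn_ge0 ?expR_ge0 ?(ltW x0)//.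
  by rewrite ler_wpM2l// ler_expR ler_piMr.
have l2 : normc l <= expR C.
  have -> : l = 1 + (l - 1) by ring.
  rewrite (le_trans (le_normcD _ _))// Normc.normc1.
  have : expR (C * x) <= expR C by rewrite ler_expR ler_piMr// ltW.
  lra.
apply: (@le_lt_trans _ _ (K * x)).
  rewrite (le_trans (le_normcD _ _))// Normc.normcM addrC /K mulrDl lerD//.
    by rewrite (le_trans l1)// exp1// ltW.
  by rewrite mulrC [leRHS]mulrAC ler_pM ?normc_ge0.
apply: (@le_lt_trans _ _ ((K + 1) * x)); first by rewrite ler_wpM2r ?(ltW x0)// lerDl.
by rewrite mulrC -ltr_pdivlMr// ltr_wpDl.
Qed.

End Growth.

(** * Complex-valued integrals *)

Section ComplexMeasurable.
Context {R : realType} {d : measure_display} {T : measurableType d}.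
Implicit Types (f g : T -> R[i]).

Definition cmeas f := measurable_fun setT (fun x => complex.Re (f x)) /\
  measurable_fun setT (fun x => complex.Im (f x)).

Lemma cmeasD f g : cmeas f -> cmeas g -> cmeas (fun x => f x + g x).
Proof.
move=> [fr fi] [gr gi]; split.
  under eq_fun do rewrite cReD; exact: measurable_funD.
under eq_fun do rewrite cImD; exact: measurable_funD.
Qed.

Lemma cmeasM f g : cmeas f -> cmeas g -> cmeas (fun x => f x * g x).
Proof.
move=> [fr fi] [gr gi]; split.
  under eq_fun do rewrite cReM; apply: measurable_funB; exact: measurable_funM.
under eq_fun do rewrite cImM; apply: measurable_funD; exact: measurable_funM.
Qed.

Lemma cmeas_cst (c : R[i]) : cmeas (fun=> c).
Proof. by split; exact: measurable_cst. Qed.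

Lemma cmeas_real (h : T -> R) : measurable_fun setT h -> cmeas (fun x => (h x)%:C).
Proof. by move=> mh; split => //=; exact: measurable_cst. Qed.

Lemma cmeas_conj f : cmeas f -> cmeas (fun x => conjc (f x)).
Proof.
move=> [fr fi]; split.
  by rewrite (_ : (fun x => _) = (fun x => complex.Re (f x)))//; apply/funext => x; case: (f x).
rewrite (_ : (fun x => _) = (fun x => - complex.Im (f x))).
  by apply: measurable_funN.
by apply/funext => x; case: (f x).
Qed.

Lemma cmeas_cexp f : cmeas f -> cmeas (fun x => cexp (f x)).
Proof.
move=> [fr fi]; split; apply: measurable_funM; apply: measurableT_comp => //.
- by apply: continuous_measurable_fun; exact: continuous_cos.
- by apply: continuous_measurable_fun; exact: continuous_sin.
Qed.

Lemma cmeas_normc f : cmeas f -> measurable_fun setT (fun x => normc (f x)).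
Proof.
move=> [fr fi].
rewrite (_ : (fun x => _) = (fun x => Num.sqrt (complex.Re (f x) ^+ 2 + complex.Im (f x) ^+ 2))); last first.
  by apply/funext => x; case: (f x).
apply: measurableT_comp; first by apply: continuous_measurable_fun; exact: sqrt_continuous.
by apply: measurable_funD; exact: measurable_funX.
Qed.

Lemma cmeas_sum (I : Type) (r : seq I) (F : I -> T -> R[i]) :
  (forall i, cmeas (F i)) -> cmeas (fun x => \sum_(i <- r) F i x).
Proof.
move=> mF; elim: r => [|i r IH].
  by under eq_fun do rewrite big_nil; exact: cmeas_cst.
by under eq_fun do rewrite big_cons; exact: cmeasD.
Qed.

Lemma cmeas_comp {d' : measure_display} {T' : measurableType d'} (f : T -> R[i]) (h : T' -> T) :
  cmeas f -> measurable_fun setT h ->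
  measurable_fun setT (fun x => complex.Re (f (h x))) /\ measurable_fun setT (fun x => complex.Im (f (h x))).
Proof. by move=> [fr fi] mh; split; [apply: (measurableT_comp fr mh)|apply: (measurableT_comp fi mh)]. Qed.

End ComplexMeasurable.

Section ComplexIntegral.
Context {R : realType} {d : measure_display} {T : measurableType d}.
Variable m : {measure set T -> \bar R}.
Implicit Types (f g : T -> R[i]).

(** The integral for an arbitrary measure; for Lebesgue measure it is convertible to [cintegral]. *)
Definition cint f : R[i] :=
  (\int[m]_x complex.Re (f x))%R +i* (\int[m]_x complex.Im (f x))%R.

Definition cintegrable f := m.-integrable setT (EFin \o (fun x => complex.Re (f x))) /\
  m.-integrable setT (EFin \o (fun x => complex.Im (f x))).

Lemma cintegrable_cmeas f : cintegrable f -> cmeas f.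
Proof.
by move=> [fr fi]; split; apply/measurable_EFinP; [apply: measurable_int fr|apply: measurable_int fi].
Qed.

Lemma dominated_integrable_real (h k : T -> R) : measurable_fun setT h ->
  (forall x, `|h x| <= k x) -> m.-integrable setT (EFin \o k) -> m.-integrable setT (EFin \o h).
Proof.
move=> mh hk ik; apply: (le_integrable measurableT _ _ ik).
  exact/measurable_EFinP.
by move=> x _ /=; rewrite lee_fin (le_trans (hk x))// ler_norm.
Qed.

Lemma cintegrable_dominated f (k : T -> R) : cmeas f -> (forall x, normc (f x) <= k x) ->
  m.-integrable setT (EFin \o k) -> cintegrable f.
Proof.
move=> [fr fi] fk ik; split; apply: (dominated_integrable_real _ _ ik) => // x.
  by rewrite (le_trans (Re_le_normc _)).
by rewrite (le_trans (Im_le_normc _)).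
Qed.

Lemma cintegrable_normc f : cintegrable f -> m.-integrable setT (EFin \o (fun x => normc (f x))).
Proof.
move=> fI; have mf := cintegrable_cmeas fI; case: (fI) => fr fi.
have i2 : m.-integrable setT (EFin \o (fun x => `|complex.Re (f x)| + `|complex.Im (f x)|)).
  have := integrableD measurableT (integrable_norm fr) (integrable_norm fi).
  exact.
apply: (dominated_integrable_real _ _ i2); first exact: cmeas_normc.
by move=> x; rewrite ger0_norm ?normc_ge0// normc_le_ReIm.
Qed.

Lemma cintegrableP f : cmeas f -> (\int[m]_x (normc (f x))%:E < +oo)%E -> cintegrable f.
Proof.
move=> mf fi; apply: (cintegrable_dominated mf (fun x => lexx _)).
apply/integrableP; split; first by apply/measurable_EFinP; exact: cmeas_normc.
by under eq_integral do rewrite /= ger0_norm ?normc_ge0//.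
Qed.

Lemma cintegrableD f g : cintegrable f -> cintegrable g -> cintegrable (fun x => f x + g x).
Proof.
move=> fI gI; apply: (@cintegrable_dominated _ (fun x => normc (f x) + normc (g x))).
- by apply: cmeasD; exact: cintegrable_cmeas.
- by move=> x; exact: le_normcD.
- exact: (integrableD measurableT (cintegrable_normc fI) (cintegrable_normc gI)).
Qed.

Lemma cintegrableM_bounded f g (M : R) : cmeas g -> (forall x, normc (g x) <= M) ->
  cintegrable f -> cintegrable (fun x => f x * g x).
Proof.
move=> mg gM fI; apply: (@cintegrable_dominated _ (fun x => M * normc (f x))).
- by apply: cmeasM => //; exact: cintegrable_cmeas.
- by move=> x; rewrite Normc.normcM mulrC ler_wpM2r ?normc_ge0.
- exact: (integrableZl measurableT M (cintegrable_normc fI)).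
Qed.

Lemma cintegrableZ f (c : R[i]) : cintegrable f -> cintegrable (fun x => c * f x).
Proof.
move=> fI; rewrite (_ : (fun x => _) = (fun x => f x * c)); last by apply/funext => x; rewrite mulrC.
exact: (cintegrableM_bounded (cmeas_cst c) (fun=> lexx _) fI).
Qed.

Lemma cintegrable0 : cintegrable (fun=> 0).
Proof. by split; exact: integrable0. Qed.

Lemma cintegrable_sum (I : Type) (r : seq I) (F : I -> T -> R[i]) :
  (forall i, cintegrable (F i)) -> cintegrable (fun x => \sum_(i <- r) F i x).
Proof.
move=> mF; elim: r => [|i r IH].
  by under eq_fun do rewrite big_nil; exact: cintegrable0.
by under eq_fun do rewrite big_cons; exact: cintegrableD.
Qed.

Lemma cintegrable_real (h : T -> R) : m.-integrable setT (EFin \o h) -> cintegrable (fun x => (h x)%:C).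
Proof. by move=> hI; split => //; exact: integrable0. Qed.

Lemma cintD f g : cintegrable f -> cintegrable g ->
  cint (fun x => f x + g x) = cint f + cint g.
Proof.
move=> [fr fi] [gr gi]; apply: complexP => /=.
  by rewrite -RintegralD//; apply: eq_Rintegral => x _; rewrite cReD.
by rewrite -RintegralD//; apply: eq_Rintegral => x _; rewrite cImD.
Qed.

Lemma cintZ f (c : R[i]) : cintegrable f -> cint (fun x => c * f x) = c * cint f.
Proof.
move=> [fr fi]; apply: complexP; rewrite ?(cReM, cImM) /=.
  rewrite -!RintegralZl// -RintegralB//.
  - by apply: eq_Rintegral => x _; rewrite cReM.
  - exact: (integrableZl measurableT (complex.Re c) fr).
  - exact: (integrableZl measurableT (complex.Im c) fi).
rewrite -!RintegralZl// -RintegralD//.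
- by apply: eq_Rintegral => x _; rewrite cImM.
- exact: (integrableZl measurableT (complex.Re c) fi).
- exact: (integrableZl measurableT (complex.Im c) fr).
Qed.

Lemma Rintegral0 : (\int[m]_(x in setT) (0 : R))%R = 0.
Proof. by rewrite /Rintegral integral0. Qed.

Lemma cint0 : cint (fun=> 0) = 0.
Proof. by apply: complexP; rewrite /= Rintegral0. Qed.

Lemma cint_sum (I : Type) (r : seq I) (F : I -> T -> R[i]) :
  (forall i, cintegrable (F i)) -> cint (fun x => \sum_(i <- r) F i x) = \sum_(i <- r) cint (F i).
Proof.
move=> FI; elim: r => [|i r IH].
  by under eq_fun do rewrite big_nil; rewrite big_nil cint0.
under eq_fun do rewrite big_cons.
by rewrite big_cons cintD ?IH//; exact: cintegrable_sum.
Qed.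

Lemma cint_conj f : cintegrable f -> cint (fun x => conjc (f x)) = conjc (cint f).
Proof.
move=> [fr fi]; apply: complexP => /=.
  by apply: eq_Rintegral => x _; case: (f x).
rewrite -mulN1r -RintegralZl//.
by apply: eq_Rintegral => x _; case: (f x) => a b; rewrite /= mulN1r.
Qed.

Lemma cint_real (h : T -> R) : cint (fun x => (h x)%:C) = (\int[m]_x h x)%R%:C.
Proof. by apply: complexP => //=; rewrite Rintegral0. Qed.

Lemma eq_cint f g : f =1 g -> cint f = cint g.
Proof. by move=> /funext ->. Qed.

(** Multiplying by a unimodular [u] makes the integral real and nonnegative, so that it equals the
    integral of a real part. *)
Lemma normc_cint_le f (k : T -> R) : cintegrable f -> (forall x, normc (f x) <= k x) ->
  m.-integrable setT (EFin \o k) -> normc (cint f) <= (\int[m]_x k x)%R.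
Proof.
move=> fI fk ik; set I := cint f.
have [->|I0] := eqVneq I 0.
  rewrite Normc.normc0; apply: Rintegral_ge0 => x _.
  exact: le_trans (normc_ge0 _) (fk x).
pose u := conjc I / (normc I)%:C.
have nI : 0 < normc I by rewrite normc_gt0.
have nu : normc u = 1.
  by rewrite normc_div normc_conj normc_real ger0_norm ?normc_ge0// divff// gt_eqF.
have uI : (normc I)%:C = cint (fun x => u * f x).
  rewrite cintZ// -/I /u mulrAC [_ * I]mulrC mulc_conj expr2 rmorphM /= mulfK//.
  by rewrite -normc_eq0 normc_real normr_eq0 gt_eqF.
have uF := cintegrableZ u fI.
have -> : normc I = (\int[m]_x complex.Re (u * f x))%R by have := f_equal (@complex.Re R) uI.
apply: le_Rintegral => //; first by case: uF.
move=> x _; rewrite (le_trans (ler_norm _))// (le_trans (Re_le_normc _))//.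
by rewrite Normc.normcM nu mul1r.
Qed.

Lemma cint_ae_eq f g : cmeas f -> cmeas g -> {ae m, forall x, f x = g x} -> cint f = cint g.
Proof.
move=> [fr fi] [gr gi] fg; apply: complexP; rewrite /= /Rintegral; congr fine;
  apply: ae_eq_integral => //; try exact/measurable_EFinP.
- by apply: filterS fg => x /= -> _.
- by apply: filterS fg => x /= -> _.
Qed.

Lemma cintegrable_ae_eq f g : cmeas g -> {ae m, forall x, f x = g x} -> cintegrable f -> cintegrable g.
Proof.
move=> mg fg fI; apply: cintegrableP => //.
have := cintegrable_normc fI => /integrableP[mn].
under eq_integral do rewrite /= ger0_norm ?normc_ge0//.
rewrite (@ae_eq_integral _ _ _ m setT (EFin \o (fun x => normc (f x))) (EFin \o (fun x => normc (g x))))//.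
  by apply/measurable_EFinP; exact: cmeas_normc.
by apply: filterS fg => x /= -> _.
Qed.

Lemma cint_dominated_cvg (f_ : nat -> T -> R[i]) f (k : T -> R) :
  (forall n, cmeas (f_ n)) -> cmeas f ->
  {ae m, forall x, (fun n => f_ n x : R[i]^o) @ \oo --> (f x : R[i]^o)} ->
  m.-integrable setT (EFin \o k) ->
  (forall n x, normc (f_ n x) <= k x) ->
  (fun n => cint (f_ n) : R[i]^o) @ \oo --> (cint f : R[i]^o).
Proof.
move=> mf_ mf ff ik fk.
have key (P : R[i] -> R) : (forall z, `|P z| <= normc z) ->
    (forall n, measurable_fun setT (fun x => P (f_ n x))) -> measurable_fun setT (fun x => P (f x)) ->
    {ae m, forall x, (fun n => P (f_ n x)) @ \oo --> P (f x)} ->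
    (fun n => (\int[m]_x P (f_ n x))%R) @ \oo --> (\int[m]_x P (f x))%R.
  move=> hP mPn mP cP.
  have h1 n : measurable_fun setT (fun x => (P (f_ n x))%:E) by exact/measurable_EFinP.
  have h2 : measurable_fun setT (fun x => (P (f x))%:E) by exact/measurable_EFinP.
  have h3 : {ae m, forall x, setT x -> (fun n => (P (f_ n x))%:E) @ \oo --> (P (f x))%:E}.
    by apply: filterS cP => x hx _; apply/fine_cvgP; split => //; exact: nearW.
  have h4 : {ae m, forall x n, setT x -> (`|(P (f_ n x))%:E| <= (EFin \o k) x)%E}.
    by apply: aeW => x n _; rewrite /= lee_fin (le_trans (hP _)).
  have [iPf _ hc] := dominated_convergence measurableT h1 h2 h3 ik h4.
  apply: fine_cvg; rewrite /= -/(Rintegral _ _ _) fineK; first exact: hc.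
  exact: integrable_fin_num.
apply/cvgc_ReIm; split.
  apply: (key (@complex.Re R)); [exact: Re_le_normc|by move=> n; case: (mf_ n)|by case: mf|].
  by apply: filterS ff => x /cvgc_ReIm[].
apply: (key (@complex.Im R)); [exact: Im_le_normc|by move=> n; case: (mf_ n)|by case: mf|].
by apply: filterS ff => x /cvgc_ReIm[].
Qed.

End ComplexIntegral.

(** * Fubini's theorem under a product majorant *)

Section Fubini.
Context {R : realType} {d1 d2 : measure_display} {T1 : measurableType d1} {T2 : measurableType d2}.
Variables (m1 : {sigma_finite_measure set T1 -> \bar R}) (m2 : {sigma_finite_measure set T2 -> \bar R}).
Variables (a : T1 -> R) (b : T2 -> R).
Hypotheses (a0 : forall x, 0 <= a x) (b0 : forall y, 0 <= b y).
Hypotheses (ia : m1.-integrable setT (EFin \o a)) (ib : m2.-integrable setT (EFin \o b)).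

Lemma integrable_prod : (m1 \x m2)%E.-integrable setT (EFin \o (fun p : T1 * T2 => a p.1 * b p.2)).
Proof.
have ma : measurable_fun setT a by apply/measurable_EFinP; exact: measurable_int ia.
have mb : measurable_fun setT b by apply/measurable_EFinP; exact: measurable_int ib.
have mab : measurable_fun setT (EFin \o (fun p : T1 * T2 => a p.1 * b p.2)).
  apply/measurable_EFinP; apply: measurable_funM.
    exact: (measurableT_comp ma measurable_fst).
  exact: (measurableT_comp mb measurable_snd).
apply/integrable12ltyP => //=.
rewrite (eq_integral (fun x => (a x)%:E * (\int[m2]_y (b y)%:E))%E); last first.
  move=> x _; rewrite -ge0_integralZl//.
  - by apply: eq_integral => y _; rewrite ger0_norm ?mulr_ge0// EFinM.
  - exact/measurable_EFinP.
  - by move=> y _; rewrite lee_fin.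
  - by rewrite lee_fin.
have fb := integrable_fin_num measurableT ib; have fa := integrable_fin_num measurableT ia.
rewrite /= in fa fb; rewrite -(fineK fb) ge0_integralZr//.
- by rewrite -(fineK fa) -EFinM ltry.
- exact/measurable_EFinP.
- by move=> x _; rewrite lee_fin.
- by rewrite lee_fin fine_ge0// integral_ge0// => y _; rewrite lee_fin.
Qed.

(** The product majorant makes every slice integrable, not merely almost every one, so the iterated
    integrals are those of functions defined everywhere. *)
Lemma real_fubini (f : T1 * T2 -> R) : measurable_fun setT f ->
  (forall x y, `|f (x, y)| <= a x * b y) ->
  [/\ (m1 \x m2)%E.-integrable setT (EFin \o f),
      m1.-integrable setT (EFin \o (fun x => \int[m2]_y f (x, y))%R),
      m2.-integrable setT (EFin \o (fun y => \int[m1]_x f (x, y))%R),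
      (\int[m1]_x (\int[m2]_y f (x, y)) = \int[(m1 \x m2)%E]_p f p)%R &
      (\int[m2]_y (\int[m1]_x f (x, y)) = \int[(m1 \x m2)%E]_p f p)%R].
Proof.
move=> mf fab.
have fI : (m1 \x m2)%E.-integrable setT (EFin \o f).
  by apply: (dominated_integrable_real mf _ integrable_prod) => -[x y]; exact: fab.
have s2 x : m2.-integrable setT (EFin \o (fun y => f (x, y))).
  apply: (@dominated_integrable_real _ _ _ _ _ (fun y => a x * b y)).
  - exact: (measurableT_comp mf (measurable_pair1 x)).
  - by move=> y; exact: fab.
  - exact: (integrableZl measurableT (a x) ib).
have s1 y : m1.-integrable setT (EFin \o (fun x => f (x, y))).
  apply: (@dominated_integrable_real _ _ _ _ _ (fun x => b y * a x)).
  - exact: (measurableT_comp mf (measurable_pair2 y)).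
  - by move=> x; rewrite mulrC; exact: fab.
  - exact: (integrableZl measurableT (b y) ia).
have F1 : EFin \o (fun x => \int[m2]_y f (x, y))%R = fubini_F m2 (EFin \o f).
  apply/funext => x /=; rewrite /Rintegral fineK//.
  exact: (integrable_fin_num measurableT (s2 x)).
have F2 : EFin \o (fun y => \int[m1]_x f (x, y))%R = fubini_G m1 (EFin \o f).
  apply/funext => y /=; rewrite /Rintegral fineK//.
  exact: (integrable_fin_num measurableT (s1 y)).
split => //.
- by rewrite F1; exact: integrable_fubini_F.
- apply: (@dominated_integrable_real _ _ _ _ _ (fun y => (\int[m1]_x a x)%R * b y)).
  + by apply/measurable_EFinP; rewrite F2; exact: (measurable_fubini_G fI).
  + move=> y; apply: (le_trans (le_normr_Rintegral measurableT (s1 y))).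
    rewrite -RintegralZr//; apply: le_Rintegral => //.
    * exact: (integrable_norm (s1 y)).
    * by under eq_fun do rewrite mulrC; exact: (integrableZl measurableT (b y) ia).
  + exact: (integrableZl measurableT _ ib).
- rewrite [LHS]/Rintegral [RHS]/Rintegral; congr fine.
  rewrite -[RHS](integral12_prod_meas1 fI) -F1; exact: eq_integral.
- rewrite [LHS]/Rintegral [RHS]/Rintegral; congr fine.
  rewrite -[RHS](integral21_prod_meas1 fI) -F2; exact: eq_integral.
Qed.

Lemma complex_fubini (f : T1 * T2 -> R[i]) : cmeas f ->
  (forall x y, normc (f (x, y)) <= a x * b y) ->
  [/\ cintegrable (m1 \x m2)%E f,
      cintegrable m1 (fun x => cint m2 (fun y => f (x, y))),
      cintegrable m2 (fun y => cint m1 (fun x => f (x, y))),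
      cint m1 (fun x => cint m2 (fun y => f (x, y))) = cint (m1 \x m2)%E f &
      cint m2 (fun y => cint m1 (fun x => f (x, y))) = cint (m1 \x m2)%E f].
Proof.
move=> [mr mi] fab.
have [r1 r2 r3 r4 r5] := real_fubini mr (fun x y => le_trans (Re_le_normc _) (fab x y)).
have [i1 i2 i3 i4 i5] := real_fubini mi (fun x y => le_trans (Im_le_normc _) (fab x y)).
split => //.
- by apply: complexP; rewrite /= ?r4 ?i4.
- by apply: complexP; rewrite /= ?r5 ?i5.
Qed.

End Fubini.

(** * Affine substitutions and Gaussian integrals *)

Section Affine.
Context {R : realType}.
Notation mu := (@lebesgue_measure R).
Local Open Scope ereal_scope.

Lemma measurable_affine (a b : R) : measurable_fun setT (fun x : measurableTypeR R => (a * x + b)%R : measurableTypeR R).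
Proof.
by apply: measurable_funD => //; exact: measurable_funM.
Qed.

(** The rescaled pushforward agrees with Lebesgue measure on half-open intervals, hence on all
    measurable sets. For negative [a] the preimage is half-open at the other end, which does not
    change its length. *)
Lemma lebesgue_affine (a b : R) (X : set (measurableTypeR R)) : a != 0%R -> measurable X ->
  mu X = (`|a|)%:E * mu ((fun x => a * x + b)%R @^-1` X).
Proof.
move=> a0 mX.
have an : (0 <= `|a|)%R by [].
pose phi (x : measurableTypeR R) : measurableTypeR R := (a * x + b)%R.
pose nu0 := mscale (NngNum an) (pushforward mu phi) : {measure set (measurableTypeR R) -> \bar R}.
pose nu := nu0 (measurable_affine a b).
suff H : forall A, measurable A -> mu A = nu A by rewrite (H X mX).
apply: lebesgue_measure_unique => Y [[u v] _ <-] /=.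
rewrite /nu /nu0 /= /mscale /= /pushforward /phi /=.
have [ap|an'|a00] := ltgtP a 0%R; last by rewrite a00 eqxx in a0.
- have -> : (fun x => a * x + b)%R @^-1` `]u, v]%classic = `[((v - b) / a)%R, ((u - b) / a)%R[%classic.
    apply/seteqP; split => x /=; rewrite !in_itv /= ler_ndivrMr// ltr_ndivlMr//;
    rewrite lerBrDr ltrBlDr [(x * a)%R]mulrC => /andP[h1 h2]; apply/andP; split => //.
  rewrite !lebesgue_measure_itv /= !lte_fin ltr_nM2r ?invr_lt0// ltrD2r.
  case: ifP => _; last by rewrite mule0.
  by rewrite -!EFinD -EFinM; congr EFin; rewrite ltr0_norm//; field; rewrite lt_eqF.
- have -> : (fun x => a * x + b)%R @^-1` `]u, v]%classic = `]((u - b) / a)%R, ((v - b) / a)%R]%classic.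
    apply/seteqP; split => x /=; rewrite !in_itv /= ltr_pdivrMr// ler_pdivlMr//;
    rewrite ltrBlDr lerBrDr [(x * a)%R]mulrC => /andP[h1 h2]; apply/andP; split => //.
  rewrite !lebesgue_measure_itv /= !lte_fin ltr_pM2r ?invr_gt0// ltrD2r.
  case: ifP => _; last by rewrite mule0.
  by rewrite -!EFinD -EFinM; congr EFin; rewrite gtr0_norm//; field; rewrite gt_eqF.
Qed.

Lemma ge0_integral_affine (a b : R) (f : R -> \bar R) : a != 0%R ->
  measurable_fun setT f -> (forall x, 0 <= f x) ->
  \int[mu]_x f x = (`|a|)%:E * \int[mu]_x f (a * x + b)%R.
Proof.
move=> a0 mf f0.
have an : (0 <= `|a|)%R by [].
pose phi (x : measurableTypeR R) : measurableTypeR R := (a * x + b)%R.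
pose nu0 := mscale (NngNum an) (pushforward mu phi) : {measure set (measurableTypeR R) -> \bar R}.
pose nu := nu0 (measurable_affine a b).
rewrite (eq_measure_integral nu); last by move=> A mA _; exact: lebesgue_affine.
rewrite /nu /nu0 ge0_integral_mscale//; congr (_ * _).
rewrite ge0_integral_pushforward//; exact: measurable_affine.
Qed.

Lemma integrable_affine (a b : R) (f : R -> R) : a != 0%R ->
  mu.-integrable setT (EFin \o f) -> mu.-integrable setT (EFin \o (fun x => f (a * x + b)%R)).
Proof.
move=> a0 /integrableP[mf fi]; apply/integrableP; split.
  exact: (measurableT_comp mf (measurable_affine a b)).
have an : (0 < `|a|)%R by rewrite normr_gt0.
have := fi; rewrite (@ge0_integral_affine a b (fun x => `|(EFin \o f) x|))//.
- move=> h; rewrite ltNge leye_eq; apply/eqP => e; move: h.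
  by rewrite [X in _ * X]e gt0_muley ?lte_fin// ltxx.
- exact: measurableT_comp.
Qed.

Lemma Rintegral_affine (a b : R) (f : R -> R) : a != 0%R -> mu.-integrable setT (EFin \o f) ->
  (\int[mu]_x f x = `|a| * \int[mu]_x f (a * x + b))%R.
Proof.
move=> a0 fI; rewrite /Rintegral integralE [in RHS]integralE.
have mE : measurable_fun setT (fun x => (f x)%:E) := measurable_int _ fI.
have h1 : \int[mu]_x (fun y => (f y)%:E)^\+ x = (`|a|)%:E * \int[mu]_x (fun y => (f (a * y + b)%R)%:E)^\+ x.
  rewrite (@ge0_integral_affine a b (fun x => (fun y => (f y)%:E)^\+ x))//; first last.
    exact: measurable_funepos.
  by congr (_ * _); apply: eq_integral => x _; rewrite !funeposE.
have h2 : \int[mu]_x (fun y => (f y)%:E)^\- x = (`|a|)%:E * \int[mu]_x (fun y => (f (a * y + b)%R)%:E)^\- x.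
  rewrite (@ge0_integral_affine a b (fun x => (fun y => (f y)%:E)^\- x))//; first last.
    exact: measurable_funeneg.
  by congr (_ * _); apply: eq_integral => x _; rewrite !funenegE.
have gI := integrable_affine b a0 fI.
have p1 : \int[mu]_x (fun y => (f (a * y + b)%R)%:E)^\+ x \is a fin_num.
  by apply: integrable_fin_num => //; exact: integrable_funepos gI.
have p2 : \int[mu]_x (fun y => (f (a * y + b)%R)%:E)^\- x \is a fin_num.
  by apply: integrable_fin_num => //; exact: integrable_funeneg gI.
rewrite h1 h2 -(fineK p1) -(fineK p2).
rewrite -!EFinM -!EFinB /=.
by rewrite mulrBr.
Qed.

Lemma integral_gauss (a b : R) : (0 < a)%R ->
  \int[mu]_x (expR (- (a * (x - b) ^+ 2)))%:E = (Num.sqrt (pi / a))%:E.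
Proof.
move=> a0.
have s0 : Num.sqrt a != 0%R by rewrite gt_eqF// sqrtr_gt0.
have sp : (0 < Num.sqrt a)%R by rewrite sqrtr_gt0.
have h := @ge0_integral_affine (Num.sqrt a) (- (Num.sqrt a * b))%R (fun x => (gauss_fun x)%:E) s0.
rewrite integralT_gauss in h.
transitivity (\int[mu]_x (gauss_fun (Num.sqrt a * x + - (Num.sqrt a * b))%R)%:E).
  apply: eq_integral => x _; rewrite /gauss_fun; congr (expR (- _))%:E.
  by rewrite -mulrBr exprMn sqr_sqrtr// ltW.
have mg : measurable_fun setT (fun x : R => (gauss_fun x)%:E).
  by apply/measurable_EFinP; exact: measurable_gauss_fun.
have g0 (x : R) : 0 <= (gauss_fun x)%:E by rewrite lee_fin gauss_fun_ge0.
rewrite sqrtrM ?pi_ge0// sqrtrV ?(ltW a0)// EFinM (h mg g0).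
by rewrite muleAC -EFinM gtr0_norm// mulfV// mul1e.
Qed.

Lemma integrable_gauss (a b : R) : (0 < a)%R ->
  mu.-integrable setT (EFin \o (fun x : R => expR (- (a * (x - b) ^+ 2)))).
Proof.
move=> a0; apply/integrableP; split.
  apply/measurable_EFinP; apply: measurableT_comp => //.
  apply: measurable_funN; apply: measurable_funM => //.
  by apply: measurable_funX; exact: measurable_funB.
under eq_integral do rewrite /= ger0_norm ?expR_ge0//.
by rewrite integral_gauss// ltry.
Qed.

End Affine.

(** * Fourier inversion *)

Section Parametric.
Context {R : realType} {d1 d2 : measure_display} {T1 : measurableType d1} {T2 : measurableType d2}.
Variable (m2 : {sigma_finite_measure set T2 -> \bar R}).

(** Tonelli's theorem is applied to the positive and the negative part separately. *)
Lemma measurable_Rintegral_param (f : T1 * T2 -> R) : measurable_fun setT f ->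
  measurable_fun setT (fun x => \int[m2]_y f (x, y))%R.
Proof.
move=> mf; rewrite /Rintegral; apply: measurableT_comp; first exact: fine_measurable.
have mE : measurable_fun setT (fun p => (f p)%:E) by exact/measurable_EFinP.
rewrite (_ : (fun x => _) = (fun x => (\int[m2]_y ((fun p => (f p)%:E)^\+ (x, y)) - \int[m2]_y ((fun p => (f p)%:E)^\- (x, y))))%E); last first.
  by apply/funext => x; rewrite integralE; congr (_ - _)%E; apply: eq_integral => y _; rewrite ?funeposE ?funenegE.
apply: emeasurable_funB.
  have h := measurable_fun_fubini_tonelli_F (m2 := m2) _ (measurable_funepos mE) (fun p => funepos_ge0 _ p).
  exact: h.
have h := measurable_fun_fubini_tonelli_F (m2 := m2) _ (measurable_funeneg mE) (fun p => funeneg_ge0 _ p).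
exact: h.
Qed.

Lemma cmeas_cint_param (f : T1 * T2 -> R[i]) : cmeas f ->
  cmeas (fun x => cint m2 (fun y => f (x, y))).
Proof.
move=> [fr fi]; split.
  exact: (measurable_Rintegral_param (f := fun p => complex.Re (f p)) fr).
exact: (measurable_Rintegral_param (f := fun p => complex.Im (f p)) fi).
Qed.

End Parametric.

(** * The Fourier transform of the two-sided exponential *)

Section Poisson.
Context {R : realType}.
Notation mu := (@lebesgue_measure R).
Implicit Types (e w x t : R).

Lemma continuous_measurableT (f : R -> R) : continuous f -> measurable_fun setT f.
Proof. exact: continuous_measurable_fun. Qed.

Definition dominatedL := @dominated_integrable_real R _ (measurableTypeR R) mu.
Arguments dominatedL {h k}.

Lemma cts_comp (f g : R -> R) : continuous f -> continuous g -> continuous (fun x => g (f x)).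
Proof. by move=> cf cg x; exact: (continuous_comp (cf x) (cg (f x))). Qed.

Lemma cts_mul (f g : R -> R) : continuous f -> continuous g -> continuous (fun x => f x * g x).
Proof. by move=> cf cg x; exact: (cvgM (cf x) (cg x)). Qed.

Lemma cts_add (f g : R -> R) : continuous f -> continuous g -> continuous (fun x => f x + g x).
Proof. by move=> cf cg x; exact: (cvgD (cf x) (cg x)). Qed.

Lemma cts_opp (f : R -> R) : continuous f -> continuous (fun x => - f x).
Proof. by move=> cf x; exact: (cvgN (cf x)). Qed.

Lemma cts_inv (f : R -> R) : continuous f -> (forall x, f x != 0) -> continuous (fun x => (f x)^-1).
Proof. by move=> cf f0 x; exact: (cvgV (f0 x) (cf x)). Qed.

Lemma cts_cst (c : R) : continuous (fun _ : R => c).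
Proof. by move=> x; exact: cvg_cst. Qed.

Lemma cts_id : continuous (fun x : R => x).
Proof. by move=> x; exact: cvg_id. Qed.

Lemma cts_scale (c : R) : continuous (fun x : R => c * x).
Proof. exact: (cts_mul (cts_cst (c := c)) cts_id). Qed.

Lemma continuous_exp_abs e : continuous (fun x : R => expR (- (e * `|x|))).
Proof.
apply: (cts_comp (f := fun x => - (e * `|x|)) _ (@continuous_expR R)).
apply: cts_opp; apply: cts_mul; first exact: cts_cst.
exact: norm_continuous.
Qed.

Lemma continuous_cos1 w : continuous (fun x : R => 1 + cos (w * x)).
Proof.
apply: cts_add; first exact: cts_cst.
exact: (cts_comp (cts_scale (c := w)) (@continuous_cos R)).
Qed.

(** The 1 added to the cosine makes the integrand nonnegative, as the fundamental theorem of
    calculus on a half-line requires. The cosine alone is recovered by subtracting the case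
    [w = 0]. *)
Lemma integral_exp_cos1 e w : 0 < e ->
  (\int[mu]_x (expR (- (e * `|x|)) * (1 + cos (w * x)))%:E)%E =
  (2 * (e^-1 + e / (e ^+ 2 + w ^+ 2)))%:E.
Proof.
move=> e0.
have D0 : 0 < e ^+ 2 + w ^+ 2 by rewrite ltr_wpDr ?sqr_ge0// exprn_gt0.
have cabs : continuous (fun x : R => expR (- (e * `|x|)) * (1 + cos (w * x))).
  exact: (cts_mul (continuous_exp_abs (e := e)) (continuous_cos1 (w := w))).
have f0 (x : R) : 0 <= expR (- (e * `|x|)) * (1 + cos (w * x)).
  by rewrite mulr_ge0 ?expR_ge0// -lerBlDl sub0r cos_geN1.
have fe : (fun x : R => expR (- (e * `|x|)) * (1 + cos (w * x))) =1
    (fun x : R => expR (- (e * `|x|)) * (1 + cos (w * x))) \o -%R.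
  by move=> x; rewrite /= normrN mulrN cosN.
rewrite (ge0_symfun_integralT f0 cabs fe).
(* A primitive that tends to 0 at infinity, so the half-line integral is [- F 0]. *)
pose F x := - (expR (- (e * x)) * (e^-1 + (e * cos (w * x) - w * sin (w * x)) / (e ^+ 2 + w ^+ 2))).
have dF x : is_derive x (1 : R) F (expR (- (e * x)) * (1 + cos (w * x))).
  have dl (c : R) : is_derive x (1 : R) (fun x : R => c * x) c.
    by apply: is_derive_eq; rewrite /GRing.scale /=; ring.
  have de : is_derive x (1 : R) (fun x : R => expR (- (e * x))) (expR (- (e * x)) * - e).
    apply: (@is_derive1_comp _ expR (fun x : R => - (e * x)) x).
  have dc : is_derive x (1 : R) (fun x : R => cos (w * x)) (- sin (w * x) * w).
    exact: (@is_derive1_comp _ cos (fun x : R => w * x) x _ _ (is_derive_cos (w * x)) (dl w)).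
  have ds : is_derive x (1 : R) (fun x : R => sin (w * x)) (cos (w * x) * w).
    exact: (@is_derive1_comp _ sin (fun x : R => w * x) x _ _ (is_derive_sin (w * x)) (dl w)).
  rewrite /F; apply: is_derive_eq; rewrite /GRing.scale /=.
  by field; rewrite !gt_eqF.
rewrite -set_itvcy.
transitivity (2%:E * \int[mu]_(x in `[0%R, +oo[) (expR (- (e * x)) * (1 + cos (w * x)))%:E)%E.
  congr (_ * _)%E; apply: eq_integral => x.
  by rewrite inE /= in_itv /= andbT => x0; rewrite ger0_norm.
have g0 (x : R) : 0 <= x -> 0 <= expR (- (e * x)) * (1 + cos (w * x)).
  by move=> _; rewrite mulr_ge0 ?expR_ge0// -lerBlDl sub0r cos_geN1.
have cg : {within `[0, +oo[, continuous (fun x : R => expR (- (e * x)) * (1 + cos (w * x)))}.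
  apply: continuous_subspaceT; apply: (cts_mul _ (continuous_cos1 (w := w))).
  exact: (cts_comp (cts_opp (cts_scale (c := e))) (@continuous_expR R)).
have Fl : F x @[x --> +oo] --> (0 : R).
  have hE : expR (- (e * x)) @[x --> +oo] --> (0 : R).
    have h1 : e * x @[x --> +oo] --> +oo.
      by under eq_fun do rewrite mulrC; apply: gt0_cvgMly => //; exact: cvg_id.
    exact: (cvg_comp _ _ h1 (@cvgr_expR R)).
  pose K := e^-1 + (e + `|w|) / (e ^+ 2 + w ^+ 2).
  have FK x : `|F x| <= K * expR (- (e * x)).
    rewrite /F normrN normrM ger0_norm ?expR_ge0// mulrC ler_wpM2r ?expR_ge0//.
    rewrite (le_trans (ler_normD _ _))// /K lerD//.
      by rewrite ger0_norm// invr_ge0 ltW.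
    rewrite normrM [X in _ * X <= _]ger0_norm ?invr_ge0 ?(ltW D0)// ler_wpM2r ?invr_ge0 ?(ltW D0)//.
    rewrite (le_trans (ler_normB _ _))// !normrM (ger0_norm (ltW e0)) lerD//.
      by rewrite ler_piMr// ?(ltW e0)// ler_norml cos_geN1 cos_le1.
    by rewrite ler_piMr// ler_norml sin_geN1 sin_le1.
  apply: (@squeeze_cvgr _ _ _ _ (fun x => - (K * expR (- (e * x)))) (fun x => K * expR (- (e * x)))).
  + by apply: nearW => x; rewrite -ler_norml FK.
  + rewrite -[X in _ --> X]oppr0; apply: cvgN; rewrite -(mulr0 K); apply: cvgM => //; exact: cvg_cst.
  + rewrite -(mulr0 K); apply: cvgM => //; exact: cvg_cst.
have dF1 (x : R) : 0 < x -> derivable F x 1 by move=> _; have [] := dF x.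
have F0 : F x @[x --> 0^'+] --> F 0.
  apply: cvg_at_right_filter; apply: differentiable_continuous; apply/derivable1_diffP.
  by have [] := dF 0.
have dF2 : {in `]0, +oo[, F^`()%classic =1 (fun x : R => expR (- (e * x)) * (1 + cos (w * x)))}.
  by move=> x _; rewrite derive1E; have [] := dF x.
rewrite (ge0_continuous_FTC2y g0 cg Fl dF1 F0 dF2) -EFinB -EFinM; congr EFin.
by rewrite /F !mulr0 oppr0 expR0 cos0 sin0; field; rewrite !gt_eqF.
Qed.

Lemma integrable_exp_abs e : 0 < e -> mu.-integrable setT (EFin \o (fun x => expR (- (e * `|x|)))).
Proof.
move=> e0.
have m1 : measurable_fun setT (fun x : R => expR (- (e * `|x|))).
  by apply: continuous_measurable_fun; exact: continuous_exp_abs.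
have ik : mu.-integrable setT (EFin \o (fun x : R => expR (- (e * `|x|)) * (1 + cos (0 * x)))).
  apply/integrableP; split.
    apply/measurable_EFinP; apply: measurable_funM => //.
    by under eq_fun do rewrite mul0r cos0; exact: measurable_cst.
  have k0 (x : R) : 0 <= expR (- (e * `|x|)) * (1 + cos (0 * x)).
    by rewrite mul0r cos0 mulr_ge0 ?expR_ge0.
  under eq_integral do rewrite /= ger0_norm ?k0//.
  by rewrite integral_exp_cos1// ltry.
apply: (dominatedL m1 _ ik) => x.
by rewrite mul0r cos0 ger0_norm ?expR_ge0// ler_peMr ?expR_ge0// lerDl.
Qed.

Lemma measurable_cosw w : measurable_fun setT (fun x : R => cos (w * x)).
Proof.
apply: measurableT_comp; first by apply: continuous_measurable_fun; exact: continuous_cos.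
exact: measurable_funM.
Qed.

Lemma measurable_sinw w : measurable_fun setT (fun x : R => sin (w * x)).
Proof.
apply: measurableT_comp; first by apply: continuous_measurable_fun; exact: continuous_sin.
exact: measurable_funM.
Qed.

Lemma Rintegral_exp_cos e w : 0 < e ->
  (\int[mu]_x (expR (- (e * `|x|)) * cos (w * x)))%R = 2 * e / (e ^+ 2 + w ^+ 2).
Proof.
move=> e0.
have D0 : 0 < e ^+ 2 + w ^+ 2 by rewrite ltr_wpDr ?sqr_ge0// exprn_gt0.
have h0 : (\int[mu]_x expR (- (e * `|x|)))%R = 2 * e^-1.
  have : (\int[mu]_x (2 * expR (- (e * `|x|))))%R = 2 * (e^-1 + e / (e ^+ 2 + 0 ^+ 2)).
    rewrite /Rintegral; transitivity (fine (2 * (e^-1 + e / (e ^+ 2 + 0 ^+ 2)))%:E) => //.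
    rewrite -(integral_exp_cos1 0 e0); congr fine; apply: eq_integral => x _.
    by rewrite mul0r cos0 mulrC.
  rewrite RintegralZl//; last exact: integrable_exp_abs.
  move=> /(mulfI _) ->; rewrite ?pnatr_eq0//.
  by rewrite expr0n addr0; field; rewrite gt_eqF.
have ic : mu.-integrable setT (EFin \o (fun x => expR (- (e * `|x|)) * cos (w * x))).
  apply: (dominatedL _ _ (integrable_exp_abs e0)).
    apply: measurable_funM; last exact: measurable_cosw.
    by apply: continuous_measurable_fun; exact: continuous_exp_abs.
  move=> x; rewrite normrM ger0_norm ?expR_ge0// ler_piMr ?expR_ge0//.
  by rewrite ler_norml cos_geN1 cos_le1.
have h1 : (\int[mu]_x (expR (- (e * `|x|)) + expR (- (e * `|x|)) * cos (w * x)))%R = 2 * (e^-1 + e / (e ^+ 2 + w ^+ 2)).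
  rewrite /Rintegral; transitivity (fine (2 * (e^-1 + e / (e ^+ 2 + w ^+ 2)))%:E) => //.
  rewrite -(integral_exp_cos1 w e0); congr fine; apply: eq_integral => x _.
  by rewrite mulrDr mulr1.
move: h1; rewrite RintegralD//; last exact: integrable_exp_abs.
rewrite h0 mulrDr => /addrI ->; by rewrite mulrA.
Qed.

Lemma Rintegral_odd (f : R -> R) : mu.-integrable setT (EFin \o f) -> (forall x, f (- x) = - f x) ->
  (\int[mu]_x f x)%R = 0.
Proof.
move=> fI fo; have n1 : (-1 : R) != 0 by rewrite oppr_eq0.
have := Rintegral_affine 0 n1 fI; rewrite normrN normr1 mul1r.
have -> : (\int[mu]_x f (-1 * x + 0))%R = (\int[mu]_x (-1 * f x))%R.
  by apply: eq_Rintegral => x _; rewrite addr0 mulN1r fo mulN1r.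
rewrite RintegralZl// => h; lra.
Qed.

(** The sine part is odd and integrates to 0; the cosine part is the Poisson kernel. *)
Lemma cint_exp_abs e w : 0 < e ->
  cint mu (fun x => (expR (- (e * `|x|)))%:C * cexp (0 +i* (w * x))) = (2 * e / (e ^+ 2 + w ^+ 2))%:C.
Proof.
move=> e0; apply: complexP.
  rewrite -Rintegral_exp_cos//=; apply: eq_Rintegral => x _.
  by rewrite expR0 mul1r mul0r subr0.
rewrite /=; apply: Rintegral_odd => [|x].
  apply: (dominatedL _ _ (integrable_exp_abs e0)).
    under eq_fun do rewrite expR0 !mul1r mul0r addr0.
    apply: measurable_funM; last exact: measurable_sinw.
    by apply: continuous_measurable_fun; exact: continuous_exp_abs.
  move=> x; rewrite expR0 !mul1r mul0r addr0 normrM ger0_norm ?expR_ge0// ler_piMr ?expR_ge0//.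
  by rewrite ler_norml sin_geN1 sin_le1.
by rewrite expR0 !mul1r !mul0r !addr0 normrN mulrN sinN mulrN.
Qed.

End Poisson.

(* The sigma-algebra of the realType R and that carried by lebesgue_measure are
   convertible but not syntactically equal, which defeats unification: these
   instances fix the latter. *)
Section LebesgueInstances.
Context {R : realType}.
Notation mu := (@lebesgue_measure R).

Definition cintegrable_dominatedL f k := @cintegrable_dominated R _ (measurableTypeR R) mu f k.
Definition normc_cint_leL f k := @normc_cint_le R _ (measurableTypeR R) mu f k.
Definition cintegrableM_boundedL f g M := @cintegrableM_bounded R _ (measurableTypeR R) mu f g M.
Definition cint_dominated_cvgL f_ f k := @cint_dominated_cvg R _ (measurableTypeR R) mu f_ f k.
Definition cintegrable_realL h := @cintegrable_real R _ (measurableTypeR R) mu h.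
Definition cint_ae_eqL f g := @cint_ae_eq R _ (measurableTypeR R) mu f g.
Definition cintegrable_ae_eqL f g := @cintegrable_ae_eq R _ (measurableTypeR R) mu f g.
Definition cintZL f c := @cintZ R _ (measurableTypeR R) mu f c.
Definition cintDL f g := @cintD R _ (measurableTypeR R) mu f g.
Definition complex_fubiniL a b := @complex_fubini R _ _ (measurableTypeR R) (measurableTypeR R) mu mu a b.

End LebesgueInstances.
#[global] Arguments cintegrable_dominatedL {R f k}.
#[global] Arguments normc_cint_leL {R f k}.
#[global] Arguments cintegrableM_boundedL {R f g M}.
#[global] Arguments cint_dominated_cvgL {R f_ f k}.
#[global] Arguments cintegrable_realL {R h}.
#[global] Arguments cint_ae_eqL {R f g}.
#[global] Arguments cintegrable_ae_eqL {R f g}.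
#[global] Arguments cintZL {R f} c.
#[global] Arguments cintDL {R f g}.
#[global] Arguments complex_fubiniL {R a b} _ _ _ _ {f}.

(** * Abel summation and inversion almost everywhere *)

Section Inversion.
Context {R : realType}.
Notation mu := (@lebesgue_measure R).
Implicit Types (a b e s t x : R).

Lemma cmeas_phase {d : measure_display} {T : measurableType d} (h : T -> R) :
  measurable_fun setT h -> cmeas (fun p => cexp (0 +i* h p)).
Proof. by move=> mh; apply: cmeas_cexp; split => //=; exact: measurable_cst. Qed.

Lemma integrable_itv_bounded (D : set (measurableTypeR R)) (f : R -> R) (M : R) :
  measurable D -> (mu D < +oo)%E -> measurable_fun setT f -> (forall x, `|f x| <= M) ->
  mu.-integrable setT (EFin \o (fun x => \1_D x * f x)).
Proof.
move=> mD Df mf fM.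
have hi : mu.-integrable setT (EFin \o (\1_D : R -> R)).
  apply/integrableP; split; first by apply/measurable_EFinP; exact: measurable_indic.
  under eq_integral do rewrite /= ger0_norm//.
  by rewrite integral_indic//= setIT.
have h : mu.-integrable setT (EFin \o (fun x => M * \1_D x)) by exact: (integrableZl measurableT M hi).
apply: (dominatedL _ _ h).
  by apply: measurable_funM => //; exact: measurable_indic.
move=> x; rewrite normrM mulrC [X in _ * X <= _]ger0_norm// ler_wpM2r//.
Qed.

Variables (u : R -> R[i]) (k : R -> R).
Hypotheses (uI : cintegrable mu u) (uk : forall xi, normc (fourier u xi) <= k xi)
  (kI : mu.-integrable setT (EFin \o k)).

Let mu_ : cmeas u := cintegrable_cmeas uI.

Lemma cmeas_fourier : cmeas (fourier u).
Proof.
apply: (cmeas_cint_param mu (f := fun p : R * R => u p.2 * cexp (0 +i* (- (2 * pi * p.1 * p.2))))).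
apply: cmeasM; first exact: (cmeas_comp mu_ measurable_snd).
apply: cmeas_phase; apply: measurable_funN; apply: measurable_funM => //.
exact: measurable_funM.
Qed.

Definition inverse_fourier t := cint mu (fun xi => fourier u xi * cexp (0 +i* (2 * pi * xi * t))).

Let mline (c : R) : measurable_fun setT (fun x : R => 2 * pi * x * c).
Proof. by apply: measurable_funM => //; exact: measurable_funM. Qed.

Lemma cmeas_integrand t : cmeas (fun xi => fourier u xi * cexp (0 +i* (2 * pi * xi * t))).
Proof. by apply: cmeasM; [exact: cmeas_fourier|apply: cmeas_phase; exact: mline]. Qed.

Lemma normc_integrand t xi : normc (fourier u xi * cexp (0 +i* (2 * pi * xi * t))) <= k xi.
Proof. by rewrite Normc.normcM normc_cexp_i mulr1. Qed.

Lemma cintegrable_integrand t : cintegrable mu (fun xi => fourier u xi * cexp (0 +i* (2 * pi * xi * t))).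
Proof. exact: (cintegrable_dominatedL (cmeas_integrand t) (normc_integrand t) kI). Qed.

Lemma normc_inverse_fourier t : normc (inverse_fourier t) <= (\int[mu]_x k x)%R.
Proof. exact: (normc_cint_leL (cintegrable_integrand t) (normc_integrand t) kI). Qed.

Lemma cmeas_inverse_fourier : cmeas inverse_fourier.
Proof.
apply: (cmeas_cint_param mu (f := fun p : R * R => fourier u p.2 * cexp (0 +i* (2 * pi * p.2 * p.1)))).
apply: cmeasM; first exact: (cmeas_comp cmeas_fourier measurable_snd).
by apply: cmeas_phase; apply: measurable_funM => //; exact: measurable_funM.
Qed.

Lemma cvg_inverse_fourier (x : nat -> R) (x0 : R) : x @ \oo --> x0 ->
  (fun n => inverse_fourier (x n) : R[i]^o) @ \oo --> (inverse_fourier x0 : R[i]^o).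
Proof.
move=> xx0; apply: (cint_dominated_cvgL (fun n => cmeas_integrand (x n)) (cmeas_integrand x0) _ kI).
  apply: aeW => xi; apply: cvgcM; first exact: cvgc_cst.
  apply: cvgc_cexp; apply/cvgc_ReIm; split => /=; first exact: cvg_cst.
  by apply: cvgM => //; exact: cvg_cst.
by move=> n xi; exact: normc_integrand.
Qed.

(** Abel means of the inversion integral. The damping makes the double integral absolutely
    convergent, so Fubini turns it into a convolution of [u] with the Poisson kernel. *)
Definition damped e t := cint mu (fun xi =>
  fourier u xi * cexp (0 +i* (2 * pi * xi * t)) * (expR (- (e * `|xi|)))%:C).

Let mexp e : cmeas (fun x : R => (expR (- (e * `|x|)))%:C).
Proof.
by apply: cmeas_real; apply: continuous_measurable_fun; exact: continuous_exp_abs.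
Qed.

(** The Poisson kernel in the normalization of total mass 1. *)
Definition poisson e x := 2 * e / (e ^+ 2 + (2 * pi * x) ^+ 2).

Lemma dampedE e t : 0 < e -> damped e t = cint mu (fun s => u s * (poisson e (t - s))%:C).
Proof.
move=> e0.
pose f (p : R * R) := u p.1 * cexp (0 +i* (- (2 * pi * p.2 * p.1))) *
   (cexp (0 +i* (2 * pi * p.2 * t)) * (expR (- (e * `|p.2|)))%:C).
have mf : cmeas f.
  apply: cmeasM.
    apply: cmeasM; first exact: (cmeas_comp mu_ measurable_fst).
    apply: cmeas_phase; apply: measurable_funN; apply: measurable_funM => //.
    exact: measurable_funM.
  apply: cmeasM; last exact: (cmeas_comp (mexp e) measurable_snd).
  by apply: cmeas_phase; apply: measurable_funM => //; exact: measurable_funM.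
have fb s xi : normc (f (s, xi)) <= normc (u s) * expR (- (e * `|xi|)).
  by rewrite !Normc.normcM !normc_cexp_i mulr1 mul1r normc_real ger0_norm// expR_ge0.
have [_ _ _ h1 h2] := complex_fubiniL (fun s => normc_ge0 (u s))
  (fun xi => expR_ge0 _) (cintegrable_normc uI) (integrable_exp_abs e0) mf fb.
transitivity (cint mu (fun xi => cint mu (fun s => f (s, xi)))).
  apply: eq_cint => xi; rewrite /f /=.
  under eq_fun do rewrite mulrC.
  rewrite cintZL; first by rewrite [RHS]mulrC -[LHS]mulrA.
  apply: (cintegrableM_boundedL (M := 1)) uI; last by move=> s; rewrite normc_cexp_i.
  apply: cmeas_phase; apply: measurable_funN.
  exact: measurable_funM.
rewrite h2 -h1; apply: eq_cint => s; rewrite /f /=.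
rewrite /poisson -(cint_exp_abs _ e0) -cintZL; last first.
  apply: (cintegrableM_boundedL (M := 1)); last first.
  - exact: cintegrable_realL (integrable_exp_abs e0).
  - by move=> x; rewrite normc_cexp_i.
  - by apply: cmeas_phase; exact: measurable_funM.
apply: eq_cint => xi; rewrite -mulrA; congr (_ * _).
rewrite mulrA -cexpD mulrC; congr (_ * cexp _).
by apply: complexP; rewrite /=; ring.
Qed.

Lemma continuous_poisson e : 0 < e -> continuous (poisson e).
Proof.
move=> e0.
have D0 x : e ^+ 2 + (2 * pi * x) ^+ 2 != 0.
  by rewrite gt_eqF// ltr_wpDr ?sqr_ge0// exprn_gt0.
have cl : continuous (fun x : R => 2 * pi * x) := cts_scale (c := 2 * pi).
have c2 : continuous (fun x : R => (2 * pi * x) ^+ 2) := cts_comp cl (@exprn_continuous R 2).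
have c3 : continuous (fun x : R => e ^+ 2 + (2 * pi * x) ^+ 2) := cts_add (cts_cst (c := e ^+ 2)) c2.
exact: (cts_mul (cts_cst (c := 2 * e)) (cts_inv c3 D0)).
Qed.

Section Interval.
Variables (a b : R).
Hypothesis ab : a < b.

Definition itv_ind : R -> R := \1_`[a, b].

(** The integral of the Poisson kernel centred at [s] over [[a, b]]. It lies between 0 and 1 and
    tends to the indicator function off the endpoints, so after integration over an interval
    dominated convergence replaces an approximate-identity argument. *)
Definition poisson_mass e s := (atan (2 * pi * (b - s) / e) - atan (2 * pi * (a - s) / e)) / pi.

Lemma measurable_itv_ind : measurable_fun setT itv_ind.
Proof. exact: measurable_indic. Qed.

Lemma itv_ind01 x : 0 <= itv_ind x <= 1.
Proof. by rewrite /itv_ind indicE; case: (x \in _); rewrite /= ?lexx ler01. Qed.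

Lemma integrable_itv_ind : mu.-integrable setT (EFin \o itv_ind).
Proof.
apply/integrableP; split; first by apply/measurable_EFinP; exact: measurable_itv_ind.
under eq_integral do rewrite /= ger0_norm ?(andP (itv_ind01 _)).1//.
by rewrite integral_indic//= setIT lebesgue_measure_itv /= lte_fin ab -EFinD ltry.
Qed.

Lemma Rintegral_itv_ind (f : R -> R) :
  (\int[mu]_x (itv_ind x * f x) = \int[mu]_(x in `[a, b]) f x)%R.
Proof.
rewrite [RHS]Rintegral_mkcond; apply: eq_Rintegral => x _.
by rewrite /itv_ind patchE indicE; case: (x \in _); rewrite ?mul1r ?mul0r.
Qed.

Lemma poisson_massE e s : 0 < e ->
  (\int[mu]_t (itv_ind t * poisson e (t - s)))%R = poisson_mass e s.
Proof.
move=> e0; rewrite Rintegral_itv_ind /Rintegral.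
pose F x := atan (2 * pi * (x - s) / e) / pi.
have p0 := pi_gt0 R.
have D0 x : 0 < e ^+ 2 + (2 * pi * x) ^+ 2 by rewrite ltr_wpDr ?sqr_ge0// exprn_gt0.
have dF x : is_derive x (1 : R) F (poisson e (x - s)).
  have dl : is_derive x (1 : R) (fun x : R => 2 * pi * (x - s) / e) (2 * pi / e).
    by apply: is_derive_eq; rewrite /GRing.scale /=; ring.
  have da := @is_derive1_comp _ atan (fun x : R => 2 * pi * (x - s) / e) x _ _
    (is_derive1_atan (2 * pi * (x - s) / e)) dl.
  rewrite /F; apply: is_derive_eq; rewrite /GRing.scale /= /poisson.
  have D1 : 1 + (2 * pi * (x - s) / e) ^+ 2 != 0.
    by rewrite gt_eqF// ltr_pwDl// sqr_ge0.
  move: (D0 (x - s)) D1 p0; move: (x - s) (@pi R) => y P D2 D1 p0.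
  by field; rewrite (gt_eqF e0) (gt_eqF p0) (gt_eqF D2).
have cp : continuous (fun x : R => poisson e (x - s)).
  have c1 : continuous (fun x : R => x - s) := cts_add cts_id (cts_cst (c := - s)).
  exact: (cts_comp c1 (continuous_poisson e0)).
have cF : continuous F.
  by move=> y; apply: differentiable_continuous; apply/derivable1_diffP; have [] := dF y.
have dr : derivable_oo_LRcontinuous F a b.
  split.
  - by move=> x _; have [] := dF x.
  - by apply: cvg_at_right_filter; exact: cF.
  - by apply: cvg_at_left_filter; exact: cF.
have dF2 : {in `]a, b[, F^`()%classic =1 (fun x : R => poisson e (x - s))}.
  by move=> x _; rewrite derive1E; have [] := dF x.
rewrite (continuous_FTC2 ab (continuous_subspaceT cp) dr dF2) /= /F /poisson_mass -mulrBl.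
by [].
Qed.

Lemma poisson_ge0 e x : 0 < e -> 0 <= poisson e x.
Proof. by move=> e0; rewrite divr_ge0 ?addr_ge0 ?sqr_ge0 ?mulr_ge0// ltW. Qed.

Lemma poisson_le e x : 0 < e -> poisson e x <= 2 / e.
Proof.
move=> e0; have D0 : 0 < e ^+ 2 + (2 * pi * x) ^+ 2 by rewrite ltr_wpDr ?sqr_ge0// exprn_gt0.
rewrite /poisson ler_pdivrMr//.
have -> : 2 * e = 2 / e * e ^+ 2 by field; rewrite gt_eqF.
by rewrite ler_wpM2l ?divr_ge0 ?(ltW e0)// lerDl sqr_ge0.
Qed.

Lemma damped_interval e : 0 < e ->
  cint mu (fun t => (itv_ind t)%:C * damped e t) = cint mu (fun s => u s * (poisson_mass e s)%:C).
Proof.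
move=> e0.
pose f (p : R * R) := (itv_ind p.1 * poisson e (p.1 - p.2))%:C * u p.2.
have mp : measurable_fun setT (fun p : R * R => poisson e (p.1 - p.2)).
  apply: (measurableT_comp (continuous_measurable_fun (continuous_poisson e0))).
  exact: measurable_funB.
have mf : cmeas f.
  apply: cmeasM; last exact: (cmeas_comp mu_ measurable_snd).
  apply: cmeas_real; apply: measurable_funM => //.
  exact: (measurableT_comp measurable_itv_ind measurable_fst).
have fb t s : normc (f (t, s)) <= 2 / e * itv_ind t * normc (u s).
  have /andP[i0 i1] := itv_ind01 t.
  rewrite Normc.normcM normc_real /= ger0_norm; last by rewrite mulr_ge0// poisson_ge0.
  by rewrite ler_wpM2r ?normc_ge0// mulrC ler_wpM2r// poisson_le.
have i0 t : 0 <= 2 / e * itv_ind t.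
  by have /andP[i0 i1] := itv_ind01 t; rewrite mulr_ge0// divr_ge0// ltW.
have [_ _ _ h1 h2] := complex_fubiniL i0 (fun s => normc_ge0 (u s))
  (integrableZl measurableT (2 / e) integrable_itv_ind) (cintegrable_normc uI) mf fb.
transitivity (cint mu (fun t => cint mu (fun s => f (t, s)))).
  apply: eq_cint => t; rewrite dampedE// -cintZL; last first.
    apply: (cintegrableM_boundedL (M := 2 / e)) uI.
      apply: cmeas_real; apply: (measurableT_comp (continuous_measurable_fun (continuous_poisson e0))).
      exact: measurable_funB.
    by move=> s; rewrite normc_real ger0_norm ?poisson_ge0// poisson_le.
  apply: eq_cint => s; rewrite /f [fst _]/= [snd _]/=.
  by have -> : (itv_ind t * poisson e (t - s))%:C = (itv_ind t)%:C * (poisson e (t - s))%:C; [rewrite rmorphM|ring].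
rewrite h1 -h2; apply: eq_cint => s.
have -> : (fun t => f (t, s)) = (fun t => u s * (itv_ind t * poisson e (t - s))%:C).
  by apply/funext => t; rewrite /f mulrC.
rewrite cintZL ?cint_real ?poisson_massE//.
apply: cintegrable_realL; apply: (dominatedL _ _ (integrableZl measurableT (2 / e) integrable_itv_ind)).
  apply: measurable_funM; first exact: measurable_itv_ind.
  apply: (measurableT_comp (continuous_measurable_fun (continuous_poisson e0))).
  exact: measurable_funB.
move=> t; have /andP[j0 j1] := itv_ind01 t.
rewrite ger0_norm; last by rewrite mulr_ge0// poisson_ge0.
by rewrite mulrC ler_wpM2r// poisson_le.
Qed.

Lemma poisson_mass01 e s : 0 < e -> 0 <= poisson_mass e s <= 1.
Proof.
move=> e0; have p0 := pi_gt0 R; rewrite /poisson_mass.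
have h : 2 * pi * (a - s) / e <= 2 * pi * (b - s) / e.
  by rewrite ler_wpM2r ?invr_ge0 ?(ltW e0)// ler_wpM2l ?mulr_ge0 ?(ltW p0)// lerD2r ltW.
have h2 := atan_ltpi2 (2 * pi * (b - s) / e); have h3 := atan_gtNpi2 (2 * pi * (a - s) / e).
rewrite divr_ge0 ?(ltW p0)//=; last by rewrite subr_ge0 le_atan.
by rewrite ler_pdivrMr// mul1r; lra.
Qed.

Lemma cvg_atan_scale (c : R) : (fun n : nat => atan (c * n.+1%:R)) @ \oo --> (Num.sg c * (pi / 2) : R).
Proof.
have pos (d : R) : 0 < d -> (fun n : nat => atan (d * n.+1%:R)) @ \oo --> (pi / 2 : R).
  move=> d0; have h1 : (fun n : nat => d * n.+1%:R) @ \oo --> +oo%R.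
    by apply/cvgryPge => x; exact: near_large_mul.
  exact: (cvg_comp _ _ h1 (@cvgy_atan R)).
have [c0|c0|->] := ltgtP c 0; last 2 first.
- by rewrite gtr0_sg// mul1r; exact: pos.
- rewrite sgr0 mul0r (_ : (fun n : nat => _) = (fun=> 0)); first exact: cvg_cst.
  by apply/funext => n; rewrite mul0r atan0.
rewrite ltr0_sg// mulN1r (_ : (fun n : nat => _) = (fun n : nat => - atan (- c * n.+1%:R))).
  by apply: cvgN; apply: pos; rewrite oppr_gt0.
by apply/funext => n; rewrite mulNr atanN opprK.
Qed.

Lemma cvg_poisson_mass s : s != a -> s != b ->
  (fun n : nat => poisson_mass (n.+1%:R^-1) s) @ \oo --> itv_ind s.
Proof.
move=> sa sb; have p0 := pi_gt0 R.
have -> : itv_ind s = (Num.sg (2 * pi * (b - s)) * (pi / 2) - Num.sg (2 * pi * (a - s)) * (pi / 2)) / pi.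
  rewrite /itv_ind indicE !sgrM (gtr0_sg p0) (@gtr0_sg _ 2)// !mul1r.
  have [h|h|h] := ltgtP s a; last by rewrite h eqxx in sa.
    rewrite (gtr0_sg (x := b - s)); last by rewrite subr_gt0 (lt_trans h).
    rewrite (gtr0_sg (x := a - s)); last by rewrite subr_gt0.
    rewrite memNset; last by rewrite /= in_itv /= (leNgt a s) h.
    by rewrite subrr mul0r.
  rewrite (ltr0_sg (x := a - s)); last by rewrite subr_lt0.
  have [h'|h'|h'] := ltgtP s b; last by rewrite h' eqxx in sb.
    rewrite (gtr0_sg (x := b - s)); last by rewrite subr_gt0.
    rewrite mem_set; last by rewrite /= in_itv /= !ltW.
    by move: p0; move: (@pi R) => P p0; rewrite mulN1r opprK mul1r -splitr divff// gt_eqF.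
  rewrite (ltr0_sg (x := b - s)); last by rewrite subr_lt0.
  rewrite memNset; last by rewrite /= in_itv /= (leNgt s b) h' andbF.
  by rewrite subrr mul0r.
apply: cvgM; last exact: cvg_cst.
rewrite (_ : (fun n : nat => _) = (fun n : nat => atan (2 * pi * (b - s) * n.+1%:R) - atan (2 * pi * (a - s) * n.+1%:R))).
  by apply: cvgB; exact: cvg_atan_scale.
by apply/funext => n; rewrite !invrK.
Qed.

Lemma normc_damped e t : 0 < e -> normc (damped e t) <= (\int[mu]_x k x)%R.
Proof.
move=> e0.
have hb xi : normc (fourier u xi * cexp (0 +i* (2 * pi * xi * t)) * (expR (- (e * `|xi|)))%:C) <= k xi.
  rewrite Normc.normcM normc_real ger0_norm ?expR_ge0// -[leRHS]mulr1 ler_pM ?normc_ge0 ?expR_ge0 ?normc_integrand//.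
  by rewrite -expR0 ler_expR oppr_le0 mulr_ge0// ltW.
apply: (normc_cint_leL _ hb kI).
by apply: (cintegrable_dominatedL _ hb kI); apply: cmeasM; [exact: cmeas_integrand|exact: mexp].
Qed.

Lemma cmeas_damped e : cmeas (damped e).
Proof.
apply: (cmeas_cint_param mu (f := fun p : R * R => fourier u p.2 * cexp (0 +i* (2 * pi * p.2 * p.1)) * (expR (- (e * `|p.2|)))%:C)).
apply: cmeasM; last exact: (cmeas_comp (mexp e) measurable_snd).
apply: cmeasM; first exact: (cmeas_comp cmeas_fourier measurable_snd).
by apply: cmeas_phase; apply: measurable_funM => //; exact: measurable_funM.
Qed.

Lemma cvg_damped t : (fun n : nat => damped (n.+1%:R^-1) t : R[i]^o) @ \oo --> (inverse_fourier t : R[i]^o).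
Proof.
apply: (cint_dominated_cvgL (k := k)) => //.
- by move=> n; apply: cmeasM; [exact: cmeas_integrand|exact: mexp].
- exact: cmeas_integrand.
- apply: aeW => xi; rewrite -[X in _ --> X]mulr1.
  apply: cvgcM; first exact: cvgc_cst.
  apply/cvgc_ReIm; split => /=; last exact: cvg_cst.
  have h : (fun n : nat => - (n.+1%:R^-1 * `|xi|)) @ \oo --> (0 : R).
    rewrite -oppr0 -(mul0r `|xi|); apply: cvgN; apply: cvgM; last exact: cvg_cst.
    exact: cvg_harmonic.
  have h2 := @continuous_expR R 0; rewrite /continuous_at expR0 in h2.
  exact: (cvg_comp _ _ h h2).
- move=> n xi; rewrite Normc.normcM normc_real ger0_norm ?expR_ge0// -[leRHS]mulr1 ler_pM ?normc_ge0 ?expR_ge0 ?normc_integrand//.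
Qed.

Lemma ae_neq2 : {ae mu, forall s : R, s != a /\ s != b}.
Proof.
have ma (c : R) : {ae mu, forall s : R, s != c}.
  exists [set c]; split; [exact: measurable_set1|exact: lebesgue_measure_set1|].
  by move=> s /= /negP; rewrite negbK => /eqP.
by apply: (@filterS2 _ _ (ae_filter_ringOfSetsType mu) _ _ _ _ (ma a) (ma b)) => s; split.
Qed.

(** The damped integrals over [[a, b]] are computed in two ways and damping is removed on both
    sides. One side is dominated through the integrability of the Fourier transform, the other by
    [normc (u t)]. *)
Lemma interval_inversion :
  cint mu (fun t => (itv_ind t)%:C * inverse_fourier t) = cint mu (fun t => (itv_ind t)%:C * u t).
Proof.
pose K := (\int[mu]_x k x)%R.
have mi : cmeas (fun t => (itv_ind t)%:C) by apply: cmeas_real; exact: measurable_itv_ind.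
have ni t : normc (itv_ind t)%:C = itv_ind t.
  by rewrite normc_real ger0_norm//; have /andP[] := itv_ind01 t.
have l1 : (fun n : nat => cint mu (fun t => (itv_ind t)%:C * damped (n.+1%:R^-1) t) : R[i]^o) @ \oo -->
   (cint mu (fun t => (itv_ind t)%:C * inverse_fourier t) : R[i]^o).
  apply: (cint_dominated_cvgL (k := fun t => K * itv_ind t)).
  - by move=> n; apply: cmeasM => //; exact: cmeas_damped.
  - by apply: cmeasM => //; exact: cmeas_inverse_fourier.
  - by apply: aeW => t; apply: cvgcM; [exact: cvgc_cst|exact: cvg_damped].
  - exact: (integrableZl measurableT K integrable_itv_ind).
  - move=> n t; rewrite Normc.normcM ni mulrC; apply: ler_wpM2r; first by have /andP[] := itv_ind01 t.
    by apply: normc_damped; rewrite invr_gt0.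
have l2 : (fun n : nat => cint mu (fun s => u s * (poisson_mass (n.+1%:R^-1) s)%:C) : R[i]^o) @ \oo -->
   (cint mu (fun s => u s * (itv_ind s)%:C) : R[i]^o).
  apply: (cint_dominated_cvgL (k := fun t => normc (u t))).
  - move=> n; apply: cmeasM => //; apply: cmeas_real.
    have c1 (c : R) : continuous (fun s : R => atan (2 * pi * (c - s) / n.+1%:R^-1)).
      apply: (cts_comp (f := fun s : R => 2 * pi * (c - s) / n.+1%:R^-1) _ (@continuous_atan R)).
      apply: cts_mul; last exact: cts_cst.
      apply: cts_mul; first exact: cts_cst.
      by apply: cts_add; [exact: cts_cst|apply: cts_opp; exact: cts_id].
    by apply: measurable_funM => //; apply: measurable_funB; apply: continuous_measurable_fun; exact: c1.
  - by apply: cmeasM.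
  - apply: (@filterS _ _ (ae_filter_ringOfSetsType mu) _ _ _ ae_neq2) => s [sa sb]; apply: cvgcM; first exact: cvgc_cst.
    by apply/cvgc_ReIm; split => /=; [exact: cvg_poisson_mass|exact: cvg_cst].
  - exact: (cintegrable_normc uI).
  - move=> n s; rewrite Normc.normcM normc_real.
    have n0 : 0 < n.+1%:R^-1 :> R by rewrite invr_gt0.
    have /andP[p1 p2] := poisson_mass01 s n0.
    by rewrite ger0_norm// -[leRHS]mulr1 ler_wpM2l ?normc_ge0.
have -> : cint mu (fun t => (itv_ind t)%:C * u t) = cint mu (fun s => u s * (itv_ind s)%:C).
  by apply: eq_cint => s; rewrite mulrC.
apply: (limc_unique l1); apply: cvg_trans l2; apply: near_eq_cvg; apply: nearW => n.
by rewrite damped_interval// invr_gt0.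
Qed.

End Interval.

(** Lebesgue differentiation: at almost every point [f] is the derivative of an indefinite integral,
    and that integral vanishes identically. *)
Lemma ae_eq0_interval (f : R -> R) : measurable_fun setT f ->
  locally_integrable [set: R] f ->
  (forall a b : R, a <= b -> mu.-integrable `[a, b]%classic (EFin \o f)) ->
  (forall a b : R, a < b -> (\int[mu]_(t in `[a, b]%classic) f t)%R = 0) ->
  {ae mu, forall t, f t = 0}.
Proof.
move=> mf lf intf f0.
have intf' a b : mu.-integrable `[a, b]%classic (EFin \o f).
  have [ab|ba] := leP a b; first exact: intf.
  rewrite set_itv_ge; last by rewrite bnd_simp -ltNge.
  exact: integrable_set0.
(* The base points [- N] are countably many, so one null set serves them all, and every [t] lies to
   the right of some of them. *)
have h (N : nat) := @FTC1 R f (BLeft (- N%:R)) (intf' _) lf.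
have /ae_foralln h' := h.
apply: (@filterS _ _ (ae_filter_ringOfSetsType mu) _ _ _ h') => t ht.
pose N := Num.truncn `|t|.
have tN : - N.+1%:R < t by rewrite ltrNl; apply: (le_lt_trans (ler_norm _)); rewrite normrN; exact: truncnS_gt.
have [|_ <-] := ht N.+1; first by [].  
rewrite -[RHS](derive1_cst (0 : R) t) !derive1E; apply: near_eq_derive.
near=> x; apply: f0; near: x.
exact: (lt_nbhsr tN).
Unshelve. all: end_near. Qed.

Theorem fourier_inversion : {ae mu, forall t, u t = inverse_fourier t}.
Proof.
have [[mur mui] [mvr mvi]] : cmeas u /\ cmeas inverse_fourier by split => //; exact: cmeas_inverse_fourier.
have [iur iui] := uI.
pose K := (\int[mu]_x k x)%R.
have main (f g : R -> R) : mu.-integrable setT (EFin \o f) -> measurable_fun setT g ->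
    (forall x, `|g x| <= K) ->
    (forall a b, a < b -> (\int[mu]_x (itv_ind a b x * g x))%R = (\int[mu]_x (itv_ind a b x * f x))%R) ->
    {ae mu, forall t, f t - g t = 0}.
  move=> fi mg gK fg.
  have mf : measurable_fun setT f by apply/measurable_EFinP; exact: (measurable_int mu fi).
  have gi (D : set (measurableTypeR R)) : measurable D -> (mu D < +oo)%E -> mu.-integrable D (EFin \o g).
    move=> mD Dfin; have := integrable_itv_bounded mD Dfin mg gK.
    rewrite (integrable_mkcond _ mD); congr (mu.-integrable _ _).
    by apply/funext => x; rewrite patchE /= indicE; case: (x \in D); rewrite ?mul1r ?mul0r.
  have hi (D : set (measurableTypeR R)) : measurable D -> (mu D < +oo)%E ->
      mu.-integrable D (EFin \o (fun x => f x - g x)).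
    move=> mD Dfin.
    exact: (integrableB mD (integrableS measurableT mD (@subsetT _ _) fi) (gi _ mD Dfin)).
  have bfin (a b : R) : (mu `[a, b]%classic < +oo)%E.
    by rewrite lebesgue_measure_itv /=; case: ifP => _; rewrite -?EFinD ?ltry.
  apply: ae_eq0_interval.
  - exact: measurable_funB.
  - split; [exact: measurable_funB|exact: openT|].
    move=> C _ cC.
    have mC := compact_measurable cC.
    have /integrableP[_] := hi _ mC (compact_finite_measure cC).
    by [].
  - by move=> a b _; exact: hi.
  - move=> a b ab; rewrite RintegralB//.
    + by rewrite -(Rintegral_itv_ind a b f) -(Rintegral_itv_ind a b g) fg// subrr.
    + exact: (integrableS measurableT _ (@subsetT _ _) fi).
    + exact: gi.
have hRe : {ae mu, forall t, complex.Re (u t) - complex.Re (inverse_fourier t) = 0}.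
  apply: main => //.
  - by move=> x; apply: le_trans (Re_le_normc _) (normc_inverse_fourier x).
  - move=> a b ab; have /(congr1 (@complex.Re R)) := interval_inversion ab.
    have e (h : R -> R[i]) : complex.Re (cint mu (fun t => (itv_ind a b t)%:C * h t)) =
        (\int[mu]_x (itv_ind a b x * complex.Re (h x)))%R.
      rewrite /cint [LHS]/=; apply: eq_Rintegral => x _.
      by rewrite cReM [complex.Re _%:C]/= [complex.Im _%:C]/= mul0r subr0.
    by rewrite !e.
have hIm : {ae mu, forall t, complex.Im (u t) - complex.Im (inverse_fourier t) = 0}.
  apply: main => //.
  - by move=> x; apply: le_trans (Im_le_normc _) (normc_inverse_fourier x).
  - move=> a b ab; have /(congr1 (@complex.Im R)) := interval_inversion ab.
    have e (h : R -> R[i]) : complex.Im (cint mu (fun t => (itv_ind a b t)%:C * h t)) =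
        (\int[mu]_x (itv_ind a b x * complex.Im (h x)))%R.
      rewrite /cint [LHS]/=; apply: eq_Rintegral => x _.
      by rewrite cImM [complex.Re _%:C]/= [complex.Im _%:C]/= mul0r addr0.
    by rewrite !e.
apply: (@filterS2 _ _ (ae_filter_ringOfSetsType mu) _ _ _ _ hRe hIm) => t /subr0_eq h1 /subr0_eq h2.
exact: complexP.
Qed.

End Inversion.

(** * Square-integrable functions *)

Section SquareIntegrable.
Context {R : realType}.
Notation mu := (@lebesgue_measure R).
Implicit Types (f g h : R -> R[i]) (p : R * R).

Definition sqnorm f : R -> R := fun t => normc (f t) ^+ 2.

Lemma sqnorm_ge0 f t : 0 <= sqnorm f t.
Proof. exact: sqr_ge0. Qed.

Lemma L2normE f : L2norm f = ((\int[mu]_t (sqnorm f t)%:E) `^ 2^-1)%E.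
Proof.
rewrite /L2norm unlock; congr (_ `^ _)%E; apply: eq_integral => t _ /=.
by rewrite ger0_norm ?normc_ge0// powR_mulrn// normc_ge0.
Qed.

Lemma integral_sqnorm_ge0 f : (0 <= \int[mu]_t (sqnorm f t)%:E)%E.
Proof. by apply: integral_ge0 => t _; rewrite lee_fin sqnorm_ge0. Qed.

Lemma L2P f : L2 f <-> cmeas f /\ mu.-integrable setT (EFin \o sqnorm f).
Proof.
have e : (\int[mu]_t `|(EFin \o sqnorm f) t| = \int[mu]_t (sqnorm f t)%:E)%E.
  by apply: eq_integral => t _; rewrite /= ger0_norm// sqnorm_ge0.
split=> [[mr mi]|[[mr mi] /integrableP[_]]].
  rewrite L2normE => /lty_poweRy h; split; first by split.
  apply/integrableP; split; last by rewrite e h// invr_neq0.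
  by apply/measurable_EFinP; apply: measurable_funX; exact: cmeas_normc.
by rewrite e => h; split => //; rewrite L2normE poweR_lty.
Qed.

Lemma L2_cmeas f : L2 f -> cmeas f.
Proof. by case/L2P. Qed.

Lemma L2_integrable f : L2 f -> mu.-integrable setT (EFin \o sqnorm f).
Proof. by case/L2P. Qed.

Lemma L2norm_ge0 f : (0 <= L2norm f)%E.
Proof. exact: Lnorm_ge0. Qed.

Lemma L2norm_fin f : L2 f -> L2norm f \is a fin_num.
Proof. by case=> _ _ h; rewrite ge0_fin_numE// L2norm_ge0. Qed.

Lemma L2normK f : L2 f -> fine (L2norm f) ^+ 2 = (\int[mu]_t sqnorm f t)%R.
Proof.
move=> f2; rewrite L2normE fine_poweR -powR_mulrn ?powR_ge0// -powRrM mulVf// powRr1//.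
by apply: fine_ge0; exact: integral_sqnorm_ge0.
Qed.

Lemma inner_cintegrable f g : L2 f -> L2 g -> cintegrable mu (fun t => f t * conjc (g t)).
Proof.
move=> f2 g2.
apply: (cintegrable_dominatedL (k := fun t => sqnorm f t + sqnorm g t)).
- by apply: cmeasM; [exact: L2_cmeas|apply: cmeas_conj; exact: L2_cmeas].
- move=> t; rewrite Normc.normcM normc_conj /sqnorm.
  have := sqr_ge0 (normc (f t) - normc (g t)); have := normc_ge0 (f t); have := normc_ge0 (g t).
  by move: (normc _) (normc _) => a b; nra.
- exact: (integrableD measurableT (L2_integrable f2) (L2_integrable g2)).
Qed.

Lemma inner_cauchy f g : L2 f -> L2 g -> ((normc (inner f g))%:E <= L2norm f * L2norm g)%E.
Proof.
move=> f2 g2; have fg := inner_cintegrable f2 g2.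
have mf : measurable_fun setT (fun t => normc (f t)) by apply: cmeas_normc; exact: L2_cmeas.
have mg : measurable_fun setT (fun t => normc (g t)) by apply: cmeas_normc; exact: L2_cmeas.
have h2 : (2^-1 + 2^-1 = 1 :> R)%R by rewrite [RHS](splitr 1) mul1r.
have := hoelder mu mf mg (ltr0n R 2) (ltr0n R 2) h2.
apply: le_trans; rewrite Lnorm1.
have hI := cintegrable_normc fg.
have e : (\int[mu]_x `|(normc (f x) * normc (g x))%R%:E| =
   \int[mu]_x (normc (f x * conjc (g x)))%:E)%E.
  by apply: eq_integral => x _ /=; rewrite ger0_norm ?mulr_ge0 ?normc_ge0// Normc.normcM normc_conj.
apply: (@le_trans _ _ (\int[mu]_x (normc (f x * conjc (g x)))%:E)%E); last by rewrite -e.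
have := normc_cint_leL (k := fun t => normc (f t * conjc (g t))) fg (fun x => lexx _) hI.
by rewrite -lee_fin /Rintegral fineK//; exact: integrable_fin_num.
Qed.

Lemma innerDl f g h : L2 f -> L2 g -> L2 h ->
  inner (fun t => f t + g t) h = inner f h + inner g h.
Proof.
move=> f2 g2 h2; rewrite -(cintDL (inner_cintegrable f2 h2) (inner_cintegrable g2 h2)).
by apply: eq_cint => t; rewrite mulrDl.
Qed.

Lemma innerZl (c : R[i]) f h : L2 f -> L2 h -> inner (fun t => c * f t) h = c * inner f h.
Proof.
move=> f2 h2; rewrite -(cintZL c (inner_cintegrable f2 h2)).
by apply: eq_cint => t; rewrite mulrA.
Qed.

Lemma L2D f g : L2 f -> L2 g -> L2 (fun t => f t + g t).
Proof.
move=> /L2P[mf fI] /L2P[mg gI]; apply/L2P; split; first exact: cmeasD.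
have k := integrableZl measurableT 2 (integrableD measurableT fI gI).
apply: (dominatedL _ _ k); first by apply: measurable_funX; apply: cmeas_normc; exact: cmeasD.
move=> t /=; rewrite ger0_norm ?sqnorm_ge0// /sqnorm.
have := le_normcD (f t) (g t); have := normc_ge0 (f t); have := normc_ge0 (g t).
have := normc_ge0 (f t + g t); move: (normc (f t + g t)) (normc (f t)) (normc (g t)) => a b c.
have := sqr_ge0 (b - c); nra.
Qed.

Lemma L2Z (c : R[i]) f : L2 f -> L2 (fun t => c * f t).
Proof.
move=> /L2P[mf fI]; apply/L2P; split; first by apply: cmeasM => //; exact: cmeas_cst.
have := integrableZl measurableT (normc c ^+ 2) fI; congr (mu.-integrable _ _).
by apply/funext => t /=; rewrite /sqnorm Normc.normcM exprMn.
Qed.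

Lemma L2_sum (I : Type) (r : seq I) (F : I -> R -> R[i]) :
  (forall i, L2 (F i)) -> L2 (fun x => \sum_(i <- r) F i x).
Proof.
move=> F2; elim: r => [|i r IH].
  under eq_fun do rewrite big_nil; apply/L2P; split; first exact: cmeas_cst.
  rewrite (_ : _ \o _ = cst 0%E); first exact: integrable0.
  by apply/funext => t /=; rewrite /sqnorm Normc.normc0 expr0n.
by under eq_fun do rewrite big_cons; exact: L2D.
Qed.

Lemma inner_sum (I : Type) (r : seq I) (F : I -> R -> R[i]) h :
  (forall i, L2 (F i)) -> L2 h ->
  inner (fun x => \sum_(i <- r) F i x) h = \sum_(i <- r) inner (F i) h.
Proof.
move=> F2 h2; elim: r => [|i r IH].
  under eq_fun do rewrite big_nil; rewrite big_nil /inner -[RHS](cint0 mu).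
  by apply: eq_cint => t; rewrite mul0r.
under eq_fun do rewrite big_cons.
by rewrite big_cons innerDl ?IH//; exact: L2_sum.
Qed.

Lemma integral_shift (F : R -> \bar R) (b : R) : measurable_fun setT F -> (forall x, 0 <= F x)%E ->
  (\int[mu]_t F (t - b)%R = \int[mu]_t F t)%E.
Proof.
move=> mF F0; have := ge0_integral_affine (- b) (oner_neq0 R) mF F0.
rewrite normr1 mul1e => ->; apply: eq_integral => t _; by rewrite mul1r.
Qed.

Lemma cmeas_shift f b : cmeas f -> cmeas (fun t : R => f (t - b)).
Proof. by move=> mf; apply: (cmeas_comp mf); exact: measurable_funB. Qed.

Lemma cmeas_tfshift p f : cmeas f -> cmeas (tfshift p f).
Proof.
move=> mf; apply: cmeasM; last exact: cmeas_shift.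
by apply: cmeas_cexp; split => /=; [exact: measurable_cst|exact: measurable_funM].
Qed.

Lemma sqnorm_tfshift p f t : sqnorm (tfshift p f) t = sqnorm f (t - p.1).
Proof. by rewrite /sqnorm /tfshift Normc.normcM normc_cexp_i mul1r. Qed.

Lemma integral_sqnorm_tfshift p f : cmeas f ->
  (\int[mu]_t (sqnorm (tfshift p f) t)%:E = \int[mu]_t (sqnorm f t)%:E)%E.
Proof.
move=> mf; under eq_integral do rewrite sqnorm_tfshift.
apply: (integral_shift (F := fun t => (sqnorm f t)%:E)).
  by apply/measurable_EFinP; apply: measurable_funX; exact: cmeas_normc.
by move=> t; rewrite lee_fin sqnorm_ge0.
Qed.

Lemma L2_tfshift p f : L2 f -> L2 (tfshift p f).
Proof.
move=> /L2P[mf /integrableP[_ fI]]; apply/L2P; split; first exact: cmeas_tfshift.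
have e g : (\int[mu]_t `|(EFin \o sqnorm g) t| = \int[mu]_t (sqnorm g t)%:E)%E.
  by apply: eq_integral => t _; rewrite /= ger0_norm// sqnorm_ge0.
apply/integrableP; split.
  by apply/measurable_EFinP; apply: measurable_funX; apply: cmeas_normc; exact: cmeas_tfshift.
by rewrite e integral_sqnorm_tfshift// -e.
Qed.

Lemma L2norm_tfshift p f : cmeas f -> L2norm (tfshift p f) = L2norm f.
Proof. by move=> mf; rewrite !L2normE integral_sqnorm_tfshift. Qed.

Lemma measurable_gauss (a : R) : measurable_fun setT (fun t : R => expR (- (a * t ^+ 2))).
Proof.
apply: (measurableT_comp (@measurable_expR R)); apply: measurable_funN.
by apply: measurable_funM => //; exact: measurable_funX.
Qed.

Lemma gaussian_gt0 t : 0 < complex.Re (@gaussian R t).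
Proof. by rewrite /= mulr_gt0 ?expR_gt0// powR_gt0. Qed.

Lemma gaussian_real t : @gaussian R t = (complex.Re (@gaussian R t))%:C.
Proof. by []. Qed.

Lemma gaussian_neq0 t : @gaussian R t != 0.
Proof. by rewrite gaussian_real -normc_gt0 normc_real normr_gt0 gt_eqF// gaussian_gt0. Qed.

Lemma L2_gaussian : L2 (@gaussian R).
Proof.
apply/L2P; split.
  by apply: cmeas_real; apply: measurable_funM => //; exact: measurable_gauss.
have h := integrableZl measurableT ((2 `^ 4^-1) ^+ 2) (integrable_gauss 0 (mulr_gt0 (ltr0n R 2) (pi_gt0 R))).
have : mu.-integrable setT (fun x => ((2 `^ 4^-1) ^+ 2)%:E * (expR (- (2 * pi * (x - 0) ^+ 2)))%:E)%E by exact: h.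
congr (mu.-integrable _ _); apply/funext => t; rewrite /= /sqnorm normc_real ger0_norm; last first.
  by rewrite mulr_ge0 ?powR_ge0 ?expR_ge0.
by rewrite exprMn -EFinM -expRM_natl subr0; congr (_ * expR _)%:E; ring.
Qed.

End SquareIntegrable.

(** * The adjoint lattice *)

Section AdjointLattice.
Context {R : realType}.
Notation mu := (@lebesgue_measure R).
Implicit Types (f : R -> R[i]) (p : R * R) (s : R).

(** [cos (2 pi s) = 1] forces [sin (pi s) = 0]. Subtracting the floor of [s] brings the angle into
    [[0, pi)], where the sine vanishes only at 0. *)
Lemma cexp_2pi_eq1 s : cexp (0 +i* (2 * pi * s)) = 1 -> exists k : int, s = k%:~R.
Proof.
have p0 := pi_gt0 R.
move=> /(congr1 (@complex.Re R)); rewrite /= expR0 mul1r => h.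
have hs : sin (pi * s) = 0.
  apply/eqP; rewrite -sqrf_eq0; move: h; rewrite -mulrA mulrC mulr_natr cos_mulr2n => h.
  have := cos2Dsin2 (pi * s); move: h; rewrite mulr2n.
  by move: (cos _ ^+ 2) (sin _ ^+ 2) => a b h h'; apply/eqP; lra.
have hsn (n : int) (x : R) : sin (x + n%:~R * pi) = 0 -> sin x = 0.
  have e : sin (n%:~R * pi : R) = 0.
    have sn (m : nat) : sin (m%:R * pi : R) = 0.
      elim: m => [|m IH]; first by rewrite mul0r sin0.
      by rewrite -natr1 mulrDl mul1r sinDpi IH oppr0.
    case: n => m; first exact: sn.
    by rewrite NegzE rmorphN mulNr sinN [X in - X]sn oppr0.
  rewrite sinD [sin (n%:~R * pi)]e mulr0 addr0 => /eqP; rewrite mulf_eq0 => /orP[/eqP//|/eqP c0].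
  by have := cos2Dsin2 (n%:~R * pi : R); rewrite c0 e !expr0n/= addr0 => /eqP; rewrite eq_sym oner_eq0.
exists (Num.floor s).
have f1 := floor_le_tmp s; have f2 := lt_succ_floor s.
set k := Num.floor s in f1 f2 *.
have : sin (pi * (s - k%:~R)) = 0.
  apply: (hsn k); rewrite -hs; congr sin; ring.
have [->//|sk] := eqVneq s k%:~R.
have : 0 < sin (pi * (s - k%:~R)).
  apply: sin_gt0_pi.
  have d0 : 0 < s - k%:~R by rewrite subr_gt0 lt_neqAle eq_sym sk.
  by rewrite mulr_gt0//= gtr_pMr// ltrBlDr addrC; move: f2; rewrite intrD.
by move=> + z; rewrite z ltxx.
Qed.

Lemma cexp_2pi_int (k : int) : cexp (0 +i* (2 * pi * k%:~R)) = 1 :> R[i].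
Proof.
have nat1 (m : nat) : cexp (0 +i* (2 * pi * m%:R)) = 1 :> R[i].
  have -> : 0 +i* (2 * pi * m%:R) = (0 +i* (2 * pi)) *+ m :> R[i].
    by rewrite -[RHS]mulr_natr natC; apply: complexP; rewrite ?cReM ?cImM /=; ring.
  rewrite cexpMn (_ : cexp _ = 1) ?expr1n//.
  by apply: complexP; rewrite /= expR0 mul1r mulrC mulr_natr ?cos2pi ?sin2pi.
case: k => m; first exact: nat1.
rewrite NegzE rmorphN mulrN (_ : 0 +i* _ = - (0 +i* (2 * pi * m.+1%:R))).
  by rewrite cexpN nat1 invr1.
by apply: complexP; rewrite /= ?oppr0.
Qed.

Lemma ae_exists (P : R -> Prop) : {ae mu, forall t, P t} -> exists t, P t.
Proof.
move=> [N [mN N0 PN]]; apply: contrapT => /forallNP h.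
have : (mu `[0%R, 1%R]%classic <= mu N)%E.
  by apply: le_measure; rewrite ?inE// => t _; apply: PN; exact: h.
by rewrite N0 lebesgue_measure_itv /= lte_fin ltr01 -EFinD subr0 lee_fin ler10.
Qed.

Lemma intr_scale (w : R[i]) (k : int) : w *~ k = (k%:~R)%:C * w.
Proof.
by rewrite -[LHS]mulrzl; congr (_ * w); rewrite rmorph_int.
Qed.

(** The standard symplectic form, which measures the failure of time-frequency shifts to commute. *)
Definition cross p q := p.1 * q.2 - p.2 * q.1.

Lemma tfshift_comp (la m : R * R) f t : tfshift la (tfshift m f) t =
  cexp (0 +i* (2 * pi * (m.1 * la.2 - m.2 * la.1))) * tfshift m (tfshift la f) t.
Proof.
rewrite /tfshift !mulrA -!cexpD -!addrA; congr (cexp _ * f _).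
  by apply: complexP; rewrite /= ?addr0//; ring.
by congr (_ + _); rewrite addrC.
Qed.

(** The two orders of composition differ by a constant phase. The Gaussian vanishes nowhere, so
    testing on it already forces the phase to be 1. *)
Lemma adjoint_latticeP (Lambda : set (R * R)) m : adjoint_lattice Lambda m <->
  forall la, Lambda la -> exists k : int, cross m la = k%:~R.
Proof.
split=> h la Lla.
  have [t ht] := ae_exists (h _ Lla _ (@L2_gaussian R)).
  apply: cexp_2pi_eq1; move: ht; rewrite tfshift_comp -[RHS]mul1r => /mulIf; apply.
  by rewrite /tfshift !mulf_neq0 ?cexp_neq0 ?gaussian_neq0.
move=> f _; apply: aeW => t; rewrite tfshift_comp.
by have [k] := h _ Lla; rewrite /cross => ->; rewrite cexp_2pi_int mul1r.
Qed.

Lemma period_area_gt0 (w1 w2 : R[i]) : 0 < complex.Im (w2 / w1) -> 0 < period_area w1 w2.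
Proof.
have [->|w10] := eqVneq w1 0; first by rewrite invr0 mulr0 /= ltxx.
move=> h; have -> : period_area w1 w2 = normc w1 ^+ 2 * complex.Im (w2 / w1).
  rewrite /period_area -[in LHS](divfK w10 w2) [_ / w1 * w1]mulrC mulrA [conjc _ * _]mulrC mulc_conj.
  by rewrite cImM /= mul0r addr0.
by rewrite mulr_gt0// exprn_gt0// normc_gt0.
Qed.

(** A basis of the adjoint lattice pairs integrally with the lattice basis [a], [b], so the product
    of the two areas is the modulus of an integer determinant. Conversely the symplectic dual basis
    has integer coordinates in the adjoint basis, so its inverse is an integer too; both equal 1. *)
Lemma adjoint_area (A : 'M[R]_2) (w1 w2 : R[i]) : A \in unitmx ->
  0 < complex.Im (w2 / w1) ->
  conj_points (adjoint_lattice (lattice A)) = period_lattice w1 w2 ->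
  period_area w1 w2 * lattice_area A = 1.
Proof.
move=> hA hw hL; have ar := period_area_gt0 hw.
pose D := \det A; have D0 : D != 0 by move: hA; rewrite unitmxE unitfE.
have DE : D = A 0 0 * A 1 1 - A 0 1 * A 1 0.
    rewrite /D (expand_det_row A 0) 2!big_ord_recl big_ord0 addr0 /cofactor !det_mx11 !mxE /=.
    rewrite expr0 mul1r expr1 mulN1r mulrN.
    by congr (_ * A _ _ - A _ _ * A _ _); apply/val_inj.
pose a := lattice_point A (1, 0); pose b := lattice_point A (0, 1).
have ab : cross a b = D.
  by rewrite /cross /a /b /lattice_point /= DE !mulr1 !mulr0 !addr0 !add0r; ring.
have la : lattice A a by exists (1, 0). have lb : lattice A b by exists (0, 1).
have adj m : (exists k : int, cross m a = k%:~R) -> (exists k : int, cross m b = k%:~R) ->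
    adjoint_lattice (lattice A) m.
  move=> [k hk] [l hl]; apply/adjoint_latticeP => _ [[i j] _ <-].
  exists (k * i + l * j); rewrite intrD !intrM -hk -hl /cross /a /b /lattice_point /= !mulr1 !mulr0.
  ring.
(* The Pluecker relation: a determinant of pairings is the product of the two areas. *)
have plu (m l u v : R * R) : cross m u * cross l v - cross m v * cross l u = cross m l * cross u v.
  by rewrite /cross; ring.
have [m1 [m1L m1w]] : exists m, adjoint_lattice (lattice A) m /\ conjc (m.1 +i* m.2) = w1.
  have : period_lattice w1 w2 w1 by exists (1, 0) => //; rewrite /period /= mulr1z mulr0z addr0.
  by rewrite -hL => -[m mL mw]; exists m.
have [m2 [m2L m2w]] : exists m, adjoint_lattice (lattice A) m /\ conjc (m.1 +i* m.2) = w2.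
  have : period_lattice w1 w2 w2 by exists (0, 1) => //; rewrite /period /= mulr1z mulr0z add0r.
  by rewrite -hL => -[m mL mw]; exists m.
have areaE : period_area w1 w2 = - cross m1 m2.
  by rewrite /period_area -m1w -m2w /cross /= !opprK; ring.
have [k1 hk1] := (adjoint_latticeP _ _).1 m1L _ la; have [k2 hk2] := (adjoint_latticeP _ _).1 m1L _ lb.
have [l1 hl1] := (adjoint_latticeP _ _).1 m2L _ la; have [l2 hl2] := (adjoint_latticeP _ _).1 m2L _ lb.
have E1 : period_area w1 w2 * lattice_area A = `|k1 * l2 - k2 * l1|%:~R.
  rewrite intr_norm intrB !intrM -hk1 -hk2 -hl1 -hl2 plu ab normrM /lattice_area -/D; congr (_ * _).
  by rewrite -[LHS]ger0_norm ?(ltW ar)// areaE normrN.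
(* The symplectic dual basis of [a], [b], up to sign: each vector pairs to 0 with one basis vector
   and to [1] or [-1] with the other. *)
pose n1 : R * R := (b.1 / D, b.2 / D); pose n2 : R * R := (a.1 / D, a.2 / D).
have n1L : adjoint_lattice (lattice A) n1.
  apply: adj; [exists (-1)|exists 0].
    transitivity (- (cross a b / D)); first by rewrite /cross /n1 /=; ring.
    by rewrite ab divff.
  by rewrite /cross /n1 /=; ring.
have n2L : adjoint_lattice (lattice A) n2.
  apply: adj; [exists 0|exists 1]; last first.
    transitivity (cross a b / D); first by rewrite /cross /n2 /=; ring.
    by rewrite ab divff.
  by rewrite /cross /n2 /=; ring.
have inP m : adjoint_lattice (lattice A) m -> exists i j : int,
    m = (i%:~R * m1.1 + j%:~R * m2.1, i%:~R * m1.2 + j%:~R * m2.2).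
  move=> mL; have : period_lattice w1 w2 (conjc (m.1 +i* m.2)) by rewrite -hL; exists m.
  move=> [[i j] _]; rewrite /period /= -m1w -m2w => h; exists i, j.
  have hre := congr1 (@complex.Re R) h; have him := congr1 (@complex.Im R) h.
  move: hre him; rewrite !intr_scale !cReD !cImD !cReM !cImM /= => hre him.
  rewrite (surjective_pairing m); congr (_, _); first by move: hre; rewrite !mul0r !subr0.
  by apply: oppr_inj; rewrite -[LHS]him !mul0r !addr0; ring.
have [i1 [j1 e1]] := inP _ n1L; have [i2 [j2 e2]] := inP _ n2L.
have E2 : D^-1 = (i1 * j2 - j1 * i2)%:~R * period_area w1 w2.
  have -> : D^-1 = - cross n1 n2.
    have -> : - cross n1 n2 = cross a b * D^-1 ^+ 2 by rewrite /cross /n1 /n2 /=; ring.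
    by rewrite ab; field.
  rewrite e1 e2 areaE intrB !intrM /cross /=; ring.
have E3 : 1 = `|i1 * j2 - j1 * i2|%:~R * `|k1 * l2 - k2 * l1|%:~R :> R.
  rewrite -E1 intr_norm mulrA -[X in _ * X * _](ger0_norm (ltW ar)) -normrM -E2.
  by rewrite normfV mulVf// normr_eq0.
have /eqP : (1 : int) = `|i1 * j2 - j1 * i2| * `|k1 * l2 - k2 * l1|.
  by apply/(@intr_inj R); rewrite intrM -E3.
rewrite E1; move: (i1 * j2 - j1 * i2) (k1 * l2 - k2 * l1) => x y.
rewrite -normrM eq_sym => /eqP h.
have : (absz x * absz y == 1)%N by rewrite -abszM -eqz_nat abszE h.
by rewrite muln_eq1 => /andP[_ /eqP yE]; rewrite -abszE yE.
Qed.

End AdjointLattice.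

(** * The short-time Fourier transform *)

Section ShortTimeFourier.
Context {R : realType}.
Notation mu := (@lebesgue_measure R).
Implicit Types (f g : R -> R[i]) (p : R * R) (a x xi t : R).

Definition stft f p : R[i] := inner f (tfshift p gaussian).

Definition sqdist p : R := p.1 ^+ 2 + p.2 ^+ 2.

Lemma sqdist_ge0 p : 0 <= sqdist p.
Proof. by rewrite addr_ge0 ?sqr_ge0. Qed.

Lemma normc_xi p : normc (p.1 -i* p.2) ^+ 2 = sqdist p.
Proof. by rewrite normc2E /= sqrrN. Qed.

Lemma cmeas_gaussian : cmeas (@gaussian R).
Proof. exact: (L2_cmeas L2_gaussian). Qed.

Lemma cmeas_stft f : cmeas f -> cmeas (stft f).
Proof.
move=> mf.
apply: (cmeas_cint_param mu (f := fun q : (R * R) * R =>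
  f q.2 * conjc (cexp (0 +i* (2 * pi * q.1.2 * q.2)) * gaussian (q.2 - q.1.1)))).
have m2 : measurable_fun setT (fun q : (R * R) * R => q.2) by exact: measurable_snd.
have m11 : measurable_fun setT (fun q : (R * R) * R => q.1.1).
  exact: (measurableT_comp measurable_fst measurable_fst).
have m12 : measurable_fun setT (fun q : (R * R) * R => q.1.2).
  exact: (measurableT_comp measurable_snd measurable_fst).
apply: cmeasM; first exact: (cmeas_comp mf m2).
apply: cmeas_conj; apply: cmeasM.
  apply: cmeas_cexp; split => /=; first exact: measurable_cst.
  by apply: measurable_funM => //; exact: measurable_funM.
exact: (cmeas_comp cmeas_gaussian (measurable_funB m2 m11)).
Qed.

Lemma conj_tfshift_gaussian p t : conjc (tfshift p (@gaussian R) t) =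
  (2 `^ 4^-1 * expR (- (pi * p.1 ^+ 2)))%:C *
  ((expR (- (pi * t ^+ 2)))%:C * cexp (2 * pi%:C * t%:C * (p.1 -i* p.2))).
Proof.
rewrite /tfshift; set th := 2 * pi * p.2 * t.
have -> : conjc (cexp (0 +i* th) * gaussian (t - p.1)) = cexp (0 +i* - th) * gaussian (t - p.1).
  by apply: complexP; rewrite /= ?cosN ?sinN; ring.
rewrite /gaussian !rmorphM /= -!cexp_real mulrCA -[RHS]mulrA; congr (_ * _).
rewrite -!cexpD; congr cexp; rewrite (natC 2) /th; apply: complexP; rewrite /=; ring.
Qed.

(** The conjugated shift of the Gaussian is the Bargmann kernel at [z = x - i xi] up to a factor.
    Comparing moduli uses that [- pi x^2] is the sum of the real part of [- pi z^2 / 2] and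
    [- pi |z|^2 / 2]. *)
Lemma normc_stft f p : L2 f -> normc (stft f p) =
  normc (bargmann f (p.1 -i* p.2)) * expR (- (pi * sqdist p / 2)).
Proof.
move=> f2; set A := 2 `^ 4^-1 * expR (- (pi * p.1 ^+ 2)).
have A0 : 0 < A by rewrite mulr_gt0 ?powR_gt0 ?expR_gt0.
pose I := cintegral (fun t => f t * (expR (- (pi * t ^+ 2)))%:C * cexp (2 * pi%:C * t%:C * (p.1 -i* p.2))).
have -> : stft f p = A%:C * I.
  have Ac : A%:C != 0 by rewrite -normc_gt0 normc_real normr_gt0 gt_eqF.
  have h := inner_cintegrable f2 (L2_tfshift p (@L2_gaussian R)).
  have e : (fun t => f t * (expR (- (pi * t ^+ 2)))%:C * cexp (2 * pi%:C * t%:C * (p.1 -i* p.2))) =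
    (fun t => (A%:C)^-1 * (f t * conjc (tfshift p gaussian t))).
    by apply/funext => t; rewrite conj_tfshift_gaussian -/A; field.
  by rewrite /I e -[cintegral _]/(cint mu _) cintZL// mulVKf.
rewrite /bargmann -/I !Normc.normcM normc_cexp !normc_real !ger0_norm ?powR_ge0 ?(ltW A0)//.
set X := complex.Re _; set Y := - (_ / 2).
rewrite /A; have -> : expR (- (pi * p.1 ^+ 2)) = expR X * expR Y; last by ring.
rewrite -expRD; congr expR; rewrite /X /Y /sqdist.
have -> : - (pi%:C * (p.1 -i* p.2) ^+ 2 / 2) = (- (pi / 2))%:C * (p.1 -i* p.2) ^+ 2.
  by rewrite (natC 2) rmorphN rmorphM fmorphV /=; ring.
by rewrite expr2 !cReM !cImM /=; field.
Qed.

Lemma integralT_oneDsqr : (\int[mu]_x ((1 + x ^+ 2)^-1)%:E = pi%:E)%E.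
Proof.
have e := @integral0y_oneDsqr R.
rewrite (@ge0_symfun_integralT R (fun x => (1 + x ^+ 2)^-1)).
- rewrite (_ : [set x | _] = `[0, +oo[%classic); last first.
    by apply/seteqP; split => x /=; rewrite in_itv/= andbT.
  by rewrite e -EFinM mulrC divfK.
- by move=> x; rewrite invr_ge0 addr_ge0 ?sqr_ge0.
- by move=> x; apply: continuous_oneDsqrV.
- by move=> x; rewrite /= sqrrN.
Qed.

Lemma integralT_aDsqr a : 0 < a -> (\int[mu]_x ((a + x ^+ 2)^-1)%:E = (pi / Num.sqrt a)%:E)%E.
Proof.
move=> a0; have s0 : 0 < Num.sqrt a by rewrite sqrtr_gt0.
have mf : measurable_fun setT (fun x : R => ((a + x ^+ 2)^-1)%:E).
  apply/measurable_EFinP; apply: continuous_measurableT; apply: cts_inv.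
    exact: (cts_add (cts_cst (c := a)) (@exprn_continuous R 2)).
  by move=> x; rewrite gt_eqF// ltr_wpDr// sqr_ge0.
rewrite (@ge0_integral_affine R (Num.sqrt a) 0 (fun x => ((a + x ^+ 2)^-1)%:E) (lt0r_neq0 s0) mf); last first.
  by move=> x; rewrite lee_fin invr_ge0 addr_ge0 ?sqr_ge0 ?(ltW a0).
rewrite gtr0_norm//.
transitivity ((Num.sqrt a)%:E * (\int[mu]_x ((a^-1)%:E * ((1 + x ^+ 2)^-1)%:E)))%E.
  congr (_ * _)%E; apply: eq_integral => x _; rewrite addr0 -EFinM exprMn sqr_sqrtr ?(ltW a0)//.
  by rewrite -[X in (X + _)^-1]mulr1 -mulrDr invfM.
rewrite ge0_integralZl//; last 3 first.
- apply/measurable_EFinP; apply: continuous_measurableT; apply: cts_inv.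
    exact: (cts_add (cts_cst (c := 1)) (@exprn_continuous R 2)).
  by move=> x; rewrite gt_eqF// ltr_wpDr// sqr_ge0.
- by move=> x _; rewrite lee_fin invr_ge0 addr_ge0 ?sqr_ge0.
- by rewrite lee_fin invr_ge0 ltW.
rewrite integralT_oneDsqr -!EFinM; congr EFin.
rewrite -[in a^-1](sqr_sqrtr (ltW a0)); move: (@pi R) => P.
by field; rewrite gt_eqF.
Qed.

(* A Gaussian integral representing sqrt pi |p|^-1 exp (- a |p|^2); its value is +oo at p = 0. *)
Definition singular_weight a p : \bar R := (\int[mu]_s (expR (- ((a + s ^+ 2) * sqdist p)))%:E)%E.

Let aD a s : 0 < a -> 0 < a + s ^+ 2.
Proof. by move=> a0; rewrite ltr_wpDr// sqr_ge0. Qed.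

Lemma singular_weight_neq0 a p : 0 < sqdist p ->
  singular_weight a p = (Num.sqrt (pi / sqdist p) * expR (- (a * sqdist p)))%:E.
Proof.
move=> p0; rewrite /singular_weight mulrC EFinM -(integral_gauss 0 p0) -ge0_integralZl//.
- apply: eq_integral => s _; rewrite -EFinM -expRD subr0; congr (expR _)%:E; ring.
- exact: (measurable_int mu (integrable_gauss 0 p0)).
Qed.

Lemma singular_weight0 a p : sqdist p = 0 -> singular_weight a p = +oo%E.
Proof.
move=> p0; rewrite /singular_weight p0; under eq_integral do rewrite mulr0 oppr0 expR0.
rewrite integral_cst// mul1e.
by have := @lebesgue_measure_itv R `]-oo, +oo[; rewrite /= set_itvNyy.
Qed.

Let mexp2 a (h : R * R -> R) (k : R * R -> R) : measurable_fun setT h -> measurable_fun setT k ->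
  measurable_fun setT (fun p : R * R => expR (- ((a + h p ^+ 2) * k p ^+ 2))).
Proof.
move=> mh mk; apply: (measurableT_comp (@measurable_expR R)); apply: measurable_funN.
apply: measurable_funM; last exact: measurable_funX.
by apply: measurable_funD => //; exact: measurable_funX.
Qed.

(** Integrating over [x] and [y] before [s] replaces polar coordinates: two Gaussian integrals give
    [pi / (a + s^2)], whose integral over [s] is an arctangent. *)
Lemma integral_singular_weight a : 0 < a ->
  (\int[mu]_x \int[mu]_y singular_weight a (x, y) = (pi ^+ 2 / Num.sqrt a)%:E)%E.
Proof.
move=> a0.
have mg b : measurable_fun setT (fun x : R => (expR (- (b * x ^+ 2)))%:E).
  by apply/measurable_EFinP; exact: measurable_gauss.
have ig b : 0 < b -> (\int[mu]_x (expR (- (b * x ^+ 2)))%:E = (Num.sqrt (pi / b))%:E)%E.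
  by move=> b0; rewrite -(integral_gauss 0 b0); apply: eq_integral => x _; rewrite subr0.
have ms : measurable_fun setT (fun s : R => Num.sqrt (pi / (a + s ^+ 2))).
  apply: (measurableT_comp (continuous_measurable_fun (@sqrt_continuous R))).
  apply: measurable_funM => //; apply: continuous_measurableT; apply: cts_inv.
    exact: (cts_add (cts_cst (c := a)) (@exprn_continuous R 2)).
  by move=> x; rewrite gt_eqF// aD.
transitivity (\int[mu]_x \int[mu]_s ((expR (- ((a + s ^+ 2) * x ^+ 2)))%:E * (Num.sqrt (pi / (a + s ^+ 2)))%:E))%E.
  apply: eq_integral => x _.
  pose f (q : R * R) := (expR (- ((a + q.2 ^+ 2) * x ^+ 2)) * expR (- ((a + q.2 ^+ 2) * q.1 ^+ 2)))%:E.
  transitivity (\int[mu]_y \int[mu]_s f (y, s))%E.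
    apply: eq_integral => y _; apply: eq_integral => s _; rewrite /f -expRD /sqdist /=.
    by congr (expR _)%:E; ring.
  have mf : measurable_fun setT f.
    by apply/measurable_EFinP; apply: measurable_funM; apply: mexp2 => //; exact: measurable_snd.
  have f0 q : (0 <= f q)%E by rewrite lee_fin mulr_ge0 ?expR_ge0.
  rewrite [LHS](@fubini_tonelli _ _ (measurableTypeR R) (measurableTypeR R) R mu mu f mf f0).
  apply: eq_integral => s _; rewrite -(ig _ (aD s a0)) -ge0_integralZl//.
  exact: mg.
pose f (q : R * R) := (expR (- ((a + q.2 ^+ 2) * q.1 ^+ 2)) * Num.sqrt (pi / (a + q.2 ^+ 2)))%:E.
transitivity (\int[mu]_x \int[mu]_s f (x, s))%E; first by [].
have mf : measurable_fun setT f.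
  apply/measurable_EFinP; apply: measurable_funM; first by apply: mexp2; [exact: measurable_snd|exact: measurable_fst].
  exact: (measurableT_comp ms measurable_snd).
have f0 q : (0 <= f q)%E by rewrite lee_fin mulr_ge0 ?expR_ge0 ?sqrtr_ge0.
rewrite [LHS](@fubini_tonelli _ _ (measurableTypeR R) (measurableTypeR R) R mu mu f mf f0).
transitivity (\int[mu]_s (pi%:E * ((a + s ^+ 2)^-1)%:E))%E.
  apply: eq_integral => s _; rewrite -EFinM.
  transitivity ((Num.sqrt (pi / (a + s ^+ 2)))%:E * \int[mu]_x (expR (- ((a + s ^+ 2) * x ^+ 2)))%:E)%E.
    rewrite -ge0_integralZl//.
    + by apply: eq_integral => x _; rewrite /f -EFinM mulrC.
    + exact: mg.
  by rewrite (ig _ (aD s a0)) -EFinM -expr2 sqr_sqrtr// divr_ge0 ?pi_ge0// ltW// aD.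
rewrite ge0_integralZl//.
- by rewrite integralT_aDsqr// -EFinM mulrA expr2.
- apply/measurable_EFinP; apply: continuous_measurableT; apply: cts_inv.
    exact: (cts_add (cts_cst (c := a)) (@exprn_continuous R 2)).
  by move=> x; rewrite gt_eqF// aD.
- by move=> s _; rewrite lee_fin invr_ge0 ltW// aD.
- by rewrite lee_fin pi_ge0.
Qed.

(** The constant is the planar integral of [|p|^-1 exp (- a |p|^2)], that is [2 pi] times a
    half-line Gaussian integral. *)
Lemma M1norm_le f K a : 0 < a -> 0 < K -> cmeas f ->
  (forall p, 0 < sqdist p -> normc (stft f p) <= K / Num.sqrt (sqdist p) * expR (- (a * sqdist p))) ->
  (M1norm f <= (K * (pi * Num.sqrt pi / Num.sqrt a))%:E)%E.
Proof.
move=> a0 K0 mf hf; have p0 := pi_gt0 R.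
have sp : 0 < Num.sqrt pi :> R by rewrite sqrtr_gt0.
have K1 : 0 < K / Num.sqrt pi by rewrite divr_gt0.
have mV : measurable_fun setT (fun p : R * R => (normc (stft f p))%:E).
  by apply/measurable_EFinP; apply: cmeas_normc; exact: cmeas_stft.
have V0 (p : R * R) : (0 <= (normc (stft f p))%:E)%E by rewrite lee_fin normc_ge0.
have W0 p : (0 <= singular_weight a p)%E by apply: integral_ge0 => s _; rewrite lee_fin expR_ge0.
have mW : measurable_fun setT (singular_weight a).
  pose g (q : (R * R) * R) := (expR (- ((a + q.2 ^+ 2) * sqdist q.1)))%:E.
  apply: (measurable_fun_fubini_tonelli_F (m2 := mu) g); last by move=> q; rewrite lee_fin expR_ge0.
  apply/measurable_EFinP; apply: (measurableT_comp (@measurable_expR R)); apply: measurable_funN.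
  apply: measurable_funM.
    by apply: measurable_funD => //; apply: measurable_funX; exact: measurable_snd.
  apply: measurable_funD; apply: measurable_funX.
    exact: (measurableT_comp measurable_fst measurable_fst).
  exact: (measurableT_comp measurable_snd measurable_fst).
have hW p : ((normc (stft f p))%:E <= (K / Num.sqrt pi)%:E * singular_weight a p)%E.
  (* At the origin the singular bound says nothing, but the majorant is [+oo] there. *)
  have [p00|p1] := eqVneq (sqdist p) 0.
    by rewrite singular_weight0// gt0_muley ?lte_fin ?leey.
  have {}p1 : 0 < sqdist p by rewrite lt_neqAle eq_sym p1 sqdist_ge0.
  rewrite singular_weight_neq0// -EFinM lee_fin (le_trans (hf _ p1))//.
  rewrite sqrtrM ?pi_ge0// sqrtrV ?sqdist_ge0// le_eqVlt; apply/orP; left; apply/eqP.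
  by field; rewrite (gt_eqF sp) gt_eqF// sqrtr_gt0.
rewrite /M1norm [leLHS](@fubini_tonelli1 _ _ (measurableTypeR R) (measurableTypeR R) R mu mu _ mV V0) /fubini_F.
apply: (@le_trans _ _ (\int[mu]_x \int[mu]_y ((K / Num.sqrt pi)%:E * singular_weight a (x, y)))%E).
  apply: ge0_le_integral => //.
  - by move=> x _; exact: integral_ge0.
  - exact: (measurable_fun_fubini_tonelli_F (m2 := mu) _ mV V0).
  - apply: (measurable_fun_fubini_tonelli_F (m2 := mu) (fun p => (K / Num.sqrt pi)%:E * singular_weight a p)%E).
      exact: measurable_funeM.
    by move=> y; rewrite mule_ge0// lee_fin ltW.
  - move=> x _; apply: ge0_le_integral => //.
    + exact: (measurableT_comp mV (measurable_pair1 x)).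
    + by apply: measurable_funeM; exact: (measurableT_comp mW (measurable_pair1 x)).
apply: (@le_trans _ _ ((K / Num.sqrt pi)%:E * \int[mu]_x \int[mu]_y singular_weight a (x, y))%E).
  rewrite le_eqVlt; apply/orP; left; apply/eqP.
  transitivity (\int[mu]_x ((K / Num.sqrt pi)%:E * \int[mu]_y singular_weight a (x, y)))%E.
    apply: eq_integral => x _; rewrite ge0_integralZl// ?lee_fin ?(ltW K1)//.
    exact: (measurableT_comp mW (measurable_pair1 x)).
  rewrite ge0_integralZl// ?lee_fin ?(ltW K1)//.
    exact: (measurable_fun_fubini_tonelli_F (m2 := mu) _ mW W0).
  by move=> x _; exact: integral_ge0.
rewrite integral_singular_weight// -EFinM lee_fin le_eqVlt; apply/orP; left; apply/eqP.
have := sqr_sqrtr (ltW p0); move: sp; set q := Num.sqrt pi => q0; move: q0.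
clearbody q; move: (@pi R) => P q0 <-.
by field; rewrite (gt_eqF q0) gt_eqF// sqrtr_gt0.
Qed.

End ShortTimeFourier.

(** * Taylor coefficients of the Bargmann transform *)

Section HermiteTaylor.
Context {R : realType}.
Notation mu := (@lebesgue_measure R).
Implicit Types (p : {poly R}) (s t x y h u : R) (f : R -> R[i]).

Lemma is_derive_horner p x : is_derive x (1 : R) (fun z => p.[z]) p^`().[x].
Proof.
elim/poly_ind: p => [|p c IH].
  rewrite deriv0 horner0 (_ : (fun z => _) = cst 0); first exact: is_derive_cst.
  by apply/funext => z; rewrite horner0.
rewrite (_ : (fun z => _) = (fun z => p.[z]) * id + cst c); last first.
  by apply/funext => z; rewrite hornerMXaddC.
apply: is_derive_eq; rewrite derivMXaddC hornerD hornerMX /GRing.scale /=; ring.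
Qed.

Lemma horner_exp_bound p : exists C K, [/\ 0 <= C, 0 <= K & forall u, `|p.[u]| <= C * expR (K * `|u|)].
Proof.
elim/poly_ind: p => [|p c [C [K [C0 K0 h]]]].
  by exists 0, 0; split => // u; rewrite horner0 normr0 mul0r.
exists (C + `|c|), (K + 1); split; [by rewrite addr_ge0|by rewrite addr_ge0|].
move=> u; rewrite hornerMXaddC (le_trans (ler_normD _ _))// normrM mulrDl.
have e1 : 1 <= expR ((K + 1) * `|u|) by rewrite -expR0 ler_expR mulr_ge0// addr_ge0.
apply: lerD; last by rewrite -[leLHS]mulr1 ler_wpM2l.
rewrite mulrDl mul1r expRD mulrA; apply: ler_pM => //.
by rewrite (le_trans _ (expR_ge1Dx _))// lerDr.
Qed.

(** The polynomial factor of the [n]-th derivative of [exp (- 2 pi u^2)]; the recurrence is the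
    product rule. *)
Definition hermite_poly n : {poly R} := iter n (fun p => p^`() - (4 * pi)%:P * 'X * p) 1.

Definition gauss_deriv n u : R := (hermite_poly n).[u] * expR (- (2 * pi * u ^+ 2)).

Lemma is_derive_gauss_deriv n x : is_derive x (1 : R) (gauss_deriv n) (gauss_deriv n.+1 x).
Proof.
have hp := is_derive_horner (hermite_poly n) x.
have hq : is_derive x (1 : R) (fun u : R => - (2 * pi * u ^+ 2)) (- (4 * pi * x)).
  by apply: is_derive_eq; rewrite /GRing.scale /=; ring.
have he := @is_derive1_comp _ expR (fun u : R => - (2 * pi * u ^+ 2)) x _ _ (is_derive_expR _) hq.
rewrite (_ : gauss_deriv n = (fun z => (hermite_poly n).[z]) * (expR \o (fun u : R => - (2 * pi * u ^+ 2)))) //.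
apply: is_derive_eq; rewrite /GRing.scale /= /gauss_deriv /= hornerD hornerN !hornerM hornerC hornerX.
ring.
Qed.

Lemma derive1n_gauss n : derive1n n (fun u : R => expR (- (2 * pi * u ^+ 2))) = gauss_deriv n.
Proof.
elim: n => [|n IH]; first by apply/funext => u; rewrite /gauss_deriv /= hornerC mul1r.
rewrite derive1nS IH; apply/funext => u; rewrite derive1E.
by have [_] := is_derive_gauss_deriv n u.
Qed.

Lemma mean_value_bound (g g' : R -> R) h B : g 0 = 0 ->
  (forall x, is_derive x (1 : R) g (g' x)) ->
  (forall x, `|x| <= `|h| -> `|g' x| <= B) -> `|g h| <= B * `|h|.
Proof.
move=> g0 dg gB.
have cg : continuous g.
  by move=> y; apply: differentiable_continuous; apply/derivable1_diffP; have [] := dg y.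
have [h0|h0] := leP 0 h.
  have [|x] := @MVT_segment _ g g' 0 h h0 (fun x _ => dg x).
    exact: continuous_subspaceT.
  rewrite in_itv /= => /andP[x0 xh]; rewrite g0 !subr0 => ->; rewrite normrM ler_wpM2r//.
  by apply: gB; rewrite !ger0_norm.
have [|x] := @MVT_segment _ g g' h 0 (ltW h0) (fun x _ => dg x).
  exact: continuous_subspaceT.
rewrite in_itv /= => /andP[xh x0]; rewrite g0 !sub0r => /eqP; rewrite eqr_oppLR mulrN opprK => /eqP ->.
rewrite normrM ler_wpM2r//; apply: gB.
by rewrite !ler0_norm ?(ltW h0)// lerN2.
Qed.

(** Taylor's formula for a tower of functions each of which is the derivative of the previous one.
    As a function of [h], the remainder of order [n + 1] has for derivative the remainder of order
    [n] one level higher; the remainder constant keeps no factorial. *)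
Lemma taylor_bound (F : nat -> R -> R) : (forall j x, is_derive x (1 : R) (F j) (F j.+1 x)) ->
  forall n k t h M, 0 <= M -> (forall s, `|s - t| <= `|h| -> `|F (k + n)%N s| <= M) ->
  `|F k (t + h) - \sum_(j < n) h ^+ j / j`!%:R * F (k + j)%N t| <= M * `|h| ^+ n.
Proof.
move=> dF; elim=> [|n IH] k t h M M0 FM.
  rewrite big_ord0 subr0 expr0 mulr1 -[k in F k]addn0; apply: FM.
  by rewrite addrAC subrr add0r.
pose g y := F k (t + y) - \sum_(j < n.+1) y ^+ j / j`!%:R * F (k + j)%N t.
pose g' y := F k.+1 (t + y) - \sum_(j < n) y ^+ j / j`!%:R * F (k.+1 + j)%N t.
rewrite exprSr mulrA; apply: (mean_value_bound (g := g) (g' := g')).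
- rewrite /g big_ord_recl /= addr0 addn0 fact0 expr0 divr1 mul1r big1 ?addr0 ?subrr// => i _.
  by rewrite /bump leq0n add1n expr0n /= mul0r mul0r.
- move=> y; rewrite (_ : g = (fun y => F k (t + y)) - \sum_(j < n.+1) (fun y => y ^+ j / j`!%:R * F (k + j)%N t)); last first.
    by apply/funext => z; rewrite /g /= fct_sumE.
  have d1 : is_derive y (1 : R) (fun y => F k (t + y)) (F k.+1 (t + y)).
    have hq : is_derive y (1 : R) (fun u : R => t + u) 1.
      have hh := is_deriveD (is_derive_cst t y (1 : R)) (is_derive_id y (1 : R)).
      by apply: (is_derive_eq hh); rewrite add0r.
    by have := @is_derive1_comp _ (F k) (fun u : R => t + u) y _ _ (dF k (t + y)) hq; rewrite mulr1.
  have d2 (j : 'I_n.+1) : is_derive y (1 : R) (fun y => y ^+ j / j`!%:R * F (k + j)%N t)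
     (if val j is j'.+1 then y ^+ j' / j'`!%:R * F (k.+1 + j')%N t else 0).
    case: j => -[|j] jn /=.
      by rewrite (_ : (fun _ => _) = cst (1 / 0`!%:R * F (k + 0)%N t)); [exact: is_derive_cst|apply/funext => z; rewrite expr0].
    rewrite addSnnS; move: (F (k + j.+1)%N t) => c.
    have hX := is_deriveX j.+1 (is_derive_id y (1 : R)).
    have f0 : (j`!%:R : R) != 0 by rewrite pnatr_eq0 -lt0n fact_gt0.
    have j0 : (j.+1%:R : R) != 0 by rewrite pnatr_eq0.
    have hc := is_deriveM hX (is_derive_cst (c / (j.+1)`!%:R) y (1 : R)).
    have -> : (fun y0 : R => y0 ^+ j.+1 / (j.+1)`!%:R * c) = (id ^+ j.+1) * cst (c / (j.+1)`!%:R).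
      by apply/funext => z; rewrite /= fctE /= ?exprfctE; ring.
    apply: (is_derive_eq hc).
    rewrite /GRing.scale /= mulr0 add0r mulr1.
    rewrite factS natrM.
    move: j0 f0; move: (j.+1%:R : R) (j`!%:R : R) => J z J0 z0.
    by field; rewrite ?J0 ?z0.
  have := is_deriveB d1 (is_derive_sum d2).
  move=> hD; apply: (is_derive_eq hD); rewrite /g'; congr (_ - _).
  by rewrite big_ord_recl [X in X + _]/= add0r; apply: eq_bigr.
- move=> y yh; apply: (le_trans (IH k.+1 t y M M0 _)).
    by move=> s st; rewrite addSnnS; apply: FM; exact: le_trans yh.
  by rewrite ler_wpM2l// lerXn2r// nnegrE.
Qed.

(** Lowering the exponent from [2 pi] to [3 pi / 2] absorbs both the polynomial factor and a
    displacement of at most one half. *)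
Lemma gauss_deriv_bound n : exists2 C, 0 <= C & forall s t, `|s - t| <= 2^-1 ->
  `|gauss_deriv n s| <= C * expR (- (3 / 2 * pi * t ^+ 2)).
Proof.
have [C [K [C0 K0 h]]] := horner_exp_bound (hermite_poly n).
have p0 := pi_gt0 R.
have amgm (P k v : R) : 0 < P -> k * v <= k ^+ 2 / P + P / 4 * v ^+ 2.
  move=> P0; have Pn : P != 0 by rewrite gt_eqF.
  rewrite -subr_ge0 (_ : _ - _ = P * (k / P - v / 2) ^+ 2); first by rewrite mulr_ge0 ?sqr_ge0// ltW.
  by field.
(* The polynomial costs [K |s| <= K^2 / pi + pi s^2 / 4], leaving [- 7 pi s^2 / 4]. With
   [s^2 >= 6 t^2 / 7 - 3 / 2] this is at most [- 3 pi t^2 / 2 + 21 pi / 8]. *)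
exists (C * expR (K ^+ 2 / pi + 21 / 8 * pi)); first by rewrite mulr_ge0 ?expR_ge0.
move=> s t st; rewrite /gauss_deriv normrM [X in _ * X]ger0_norm ?expR_ge0//.
apply: (le_trans (ler_wpM2r (expR_ge0 _) (h s))).
rewrite -[X in X <= _]mulrA -[X in _ <= X]mulrA -!expRD ler_wpM2l// ler_expR.
have h1 : K * `|s| <= K ^+ 2 / pi + pi / 4 * s ^+ 2.
  rewrite -[s ^+ 2]real_normK ?num_real//; exact: amgm.
have h2 : 6 / 7 * t ^+ 2 - 3 / 2 <= s ^+ 2.
  have d2 : (s - t) ^+ 2 <= 4^-1.
    rewrite -[_ ^+ 2]real_normK ?num_real// (_ : 4^-1 = 2^-1 ^+ 2); last by field.
    by rewrite lerXn2r// nnegrE invr_ge0.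
  have := sqr_ge0 (7 * s - 6 * t); nra.
have h3 : pi * (6 / 7 * t ^+ 2 - 3 / 2) <= pi * s ^+ 2 by rewrite ler_wpM2l// ltW.
by move: h1 h3; set A1 := K * `|s|; set B1 := K ^+ 2 / pi; move=> h1 h3; lra.
Qed.

(** The kernel of the Bargmann transform at a real point [x], with the square completed: as a
    function of [x] it is a translated Gaussian, whose Taylor expansion involves the derivatives in
    the definition of the Hermite functions. *)
Definition bargmann_kernel x t : R := 2 `^ 4^-1 * expR (pi * t ^+ 2) * expR (- (2 * pi * (t - x / 2) ^+ 2)).

(** The coefficient of [x^n] in the kernel, a real multiple of the Hermite function of degree
    [n]. *)
Definition hermite_term n t : R :=
  2 `^ 4^-1 * expR (pi * t ^+ 2) * gauss_deriv n t * ((- 2^-1) ^+ n / n`!%:R).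

Lemma bargmann_kernel_taylor n : exists2 C, 0 <= C & forall x t, 0 <= x <= 1 ->
  `|bargmann_kernel x t - \sum_(j < n) x ^+ j * hermite_term j t| <= C * x ^+ n * expR (- (pi / 2 * t ^+ 2)).
Proof.
have [C C0 hC] := gauss_deriv_bound n.
have k0 : 0 <= 2 `^ 4^-1 :> R by rewrite powR_ge0.
exists (2 `^ 4^-1 * C); first by rewrite mulr_ge0.
move=> x t /andP[x0 x1]; pose h := - (x / 2).
have hx : `|h| = x / 2 by rewrite normrN ger0_norm// divr_ge0.
have hM s : `|s - t| <= `|h| -> `|gauss_deriv (0 + n)%N s| <= C * expR (- (3 / 2 * pi * t ^+ 2)).
  by rewrite hx => st; apply: hC; lra.
have M0 : 0 <= C * expR (- (3 / 2 * pi * t ^+ 2)) by rewrite mulr_ge0 ?expR_ge0.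
have := taylor_bound is_derive_gauss_deriv M0 hM.
set S := \sum_(j < n) _ => hT.
have -> : bargmann_kernel x t - \sum_(j < n) x ^+ j * hermite_term j t =
    2 `^ 4^-1 * expR (pi * t ^+ 2) * (gauss_deriv 0 (t + h) - S).
  rewrite mulrBr /bargmann_kernel {1}/gauss_deriv /= hornerC mul1r; congr (_ - _).
  rewrite mulr_sumr; apply: eq_bigr => j _; rewrite /hermite_term /h add0n.
  by rewrite -mulrN exprMn_comm; [ring|exact: mulrC].
rewrite normrM ger0_norm ?mulr_ge0 ?expR_ge0//.
apply: (le_trans (ler_wpM2l _ hT)); first by rewrite mulr_ge0 ?expR_ge0.
have -> : expR (- (3 / 2 * pi * t ^+ 2)) = expR (- (pi / 2 * t ^+ 2)) / expR (pi * t ^+ 2).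
  by rewrite -expRN -expRD; congr expR; field.
apply: (@le_trans _ _ (2 `^ 4^-1 * C * `|h| ^+ n * expR (- (pi / 2 * t ^+ 2)))).
  have : expR (pi * t ^+ 2) != 0 by rewrite gt_eqF// expR_gt0.
  move: (expR (pi * t ^+ 2)) (expR (- (pi / 2 * t ^+ 2))) (2 `^ 4^-1) (`|h| ^+ n) => e e' k z e0.
  by rewrite le_eqVlt; apply/orP; left; apply/eqP; field.
rewrite ler_wpM2r ?expR_ge0// ler_wpM2l ?mulr_ge0// lerXn2r ?nnegrE// hx.
lra.
Qed.

Lemma hermite_term_bound n : exists2 C, 0 <= C & forall t,
  `|hermite_term n t| <= C * expR (- (pi / 2 * t ^+ 2)).
Proof.
have [C C0 hC] := gauss_deriv_bound n.
have k0 : 0 <= 2 `^ 4^-1 :> R by rewrite powR_ge0.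
exists (2 `^ 4^-1 * C * `|(- 2^-1) ^+ n / n`!%:R|); first by rewrite !mulr_ge0.
move=> t; have h : `|t - t| <= 2^-1 by rewrite subrr normr0 invr_ge0.
have hd := hC t t h.
have -> : `|hermite_term n t| = 2 `^ 4^-1 * expR (pi * t ^+ 2) * `|gauss_deriv n t| * `|(- 2^-1) ^+ n / n`!%:R|.
  by rewrite /hermite_term [LHS]normrM [X in X * _]normrM (ger0_norm (mulr_ge0 k0 (expR_ge0 _))).
have -> : expR (- (pi / 2 * t ^+ 2)) = expR (- (3 / 2 * pi * t ^+ 2)) * expR (pi * t ^+ 2).
  by rewrite -expRD; congr expR; field.
have h2 := ler_wpM2r (normr_ge0 ((- 2^-1) ^+ n / n`!%:R)) (ler_wpM2l (mulr_ge0 k0 (expR_ge0 (pi * t ^+ 2))) hd).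
by apply: (le_trans h2); rewrite le_eqVlt; apply/orP; left; apply/eqP; ring.
Qed.

Lemma measurable_gauss_deriv n : measurable_fun setT (gauss_deriv n).
Proof.
apply: continuous_measurableT => y; apply: differentiable_continuous; apply/derivable1_diffP.
by have [] := is_derive_gauss_deriv n y.
Qed.

Lemma measurable_expsq : measurable_fun setT (fun t : R => expR (pi * t ^+ 2)).
Proof.
apply: (measurableT_comp (@measurable_expR R)).
by apply: measurable_funM => //; exact: measurable_funX.
Qed.

Lemma measurable_hermite_term n : measurable_fun setT (hermite_term n).
Proof.
apply: measurable_funM => //; apply: measurable_funM; last exact: measurable_gauss_deriv.
by apply: measurable_funM => //; exact: measurable_expsq.
Qed.

Lemma measurable_bargmann_kernel x : measurable_fun setT (bargmann_kernel x).
Proof.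
apply: measurable_funM; first by apply: measurable_funM => //; exact: measurable_expsq.
apply: (measurableT_comp (@measurable_gauss R (2 * pi))).
exact: measurable_funB.
Qed.

Lemma L2_gauss_bound (r : R -> R) C : measurable_fun setT r ->
  (forall t, `|r t| <= C * expR (- (pi / 2 * t ^+ 2))) -> L2 (fun t => (r t)%:C).
Proof.
move=> mr rC; apply/L2P; split; first exact: cmeas_real.
have k := integrableZl measurableT (C ^+ 2) (integrable_gauss 0 (pi_gt0 R)).
apply: (dominatedL _ _ k); first by apply: measurable_funX; apply: cmeas_normc; exact: cmeas_real.
move=> t; rewrite ger0_norm ?sqnorm_ge0// /sqnorm normc_real subr0.
have -> : C ^+ 2 * expR (- (pi * t ^+ 2)) = (C * expR (- (pi / 2 * t ^+ 2))) ^+ 2.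
  by rewrite exprMn -expRM_natl; congr (_ * expR _); field.
by rewrite lerXn2r ?nnegrE// (le_trans _ (rC t)).
Qed.

Definition kernelC x t : R[i] := (bargmann_kernel x t)%:C.
Definition termC n t : R[i] := (hermite_term n t)%:C.

Lemma L2_kernelC x : 0 <= x <= 1 -> L2 (kernelC x).
Proof.
move=> x01; have [C C0 hC] := bargmann_kernel_taylor 0.
apply: (L2_gauss_bound (C := C) (measurable_bargmann_kernel x)) => t.
by have := hC x t x01; rewrite big_ord0 subr0 expr0 mulr1.
Qed.

Lemma L2_termC n : L2 (termC n).
Proof.
have [C _ hC] := hermite_term_bound n.
exact: (L2_gauss_bound (measurable_hermite_term n) hC).
Qed.

Lemma inner_kernel_taylor f n : L2 f -> exists2 C, 0 <= C & forall x, 0 <= x <= 1 ->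
  normc (inner (kernelC x) f - \sum_(j < n) (x ^+ j)%:C * inner (termC j) f) <= C * x ^+ n.
Proof.
move=> f2; have [C C0 hC] := bargmann_kernel_taylor n.
pose G (t : R) := (expR (- (pi / 2 * t ^+ 2)))%:C.
have G2 : L2 G.
  apply: (L2_gauss_bound (C := 1)); first exact: measurable_gauss.
  by move=> t; rewrite mul1r ger0_norm ?expR_ge0.
have GI := cintegrable_normc (inner_cintegrable G2 f2).
exists (C * (\int[mu]_t normc (G t * conjc (f t)))%R).
  by rewrite mulr_ge0// Rintegral_ge0// => t _; exact: normc_ge0.
move=> x x01; have k2 := L2_kernelC x01.
have S2 (j : 'I_n) : L2 (fun t => (- x ^+ j)%:C * termC j t) by apply: L2Z; exact: L2_termC.
pose r t := kernelC x t + \sum_(j < n) (- x ^+ j)%:C * termC j t.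
have r2 : L2 r by apply: L2D => //; exact: L2_sum.
have -> : inner (kernelC x) f - \sum_(j < n) (x ^+ j)%:C * inner (termC j) f = inner r f.
  rewrite innerDl//; last exact: L2_sum.
  rewrite inner_sum//; congr (_ + _); rewrite -sumrN; apply: eq_bigr => j _.
  by rewrite innerZl//; [rewrite rmorphN mulNr|exact: L2_termC].
have kI := integrableZl measurableT (C * x ^+ n) GI.
have kE : mu.-integrable setT (EFin \o (fun t => C * x ^+ n * normc (G t * conjc (f t)))) by exact: kI.
have rb t : normc (r t * conjc (f t)) <= C * x ^+ n * normc (G t * conjc (f t)).
  rewrite !Normc.normcM mulrA ler_wpM2r ?normc_ge0// /G normc_real (ger0_norm (expR_ge0 _)).
  have -> : r t = (bargmann_kernel x t - \sum_(j < n) x ^+ j * hermite_term j t)%:C.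
    rewrite /r rmorphB rmorph_sum /= -sumrN; congr (_ + _); apply: eq_bigr => j _.
    by rewrite rmorphN rmorphM mulNr.
  by rewrite normc_real; exact: hC.
apply: (le_trans (normc_cint_leL (inner_cintegrable r2 f2) rb kE)).
rewrite RintegralZl//; first by rewrite mulrAC.
Qed.

(** A polynomial of degree at most [N] that is [o(x^N)] at 0 from the right vanishes: its constant
    term is 0, and one divides by [x]. *)
Lemma poly_little_o N : forall a : nat -> R[i],
  (forall e, 0 < e -> exists2 d, 0 < d & forall x, 0 < x < d ->
     normc (\sum_(j < N.+1) (x ^+ j)%:C * a j) <= e * x ^+ N) ->
  forall j, (j <= N)%N -> a j = 0.
Proof.
elim: N => [|N IH] a ha j jN.
  move: jN; rewrite leqn0 => /eqP ->; apply/eqP; rewrite -normc_eq0 eq_le normc_ge0 andbT.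
  apply/ler_addgt0Pl => e e0; rewrite addr0; have [d d0 hd] := ha e e0.
  have := hd (d / 2); rewrite big_ord1 !expr0 mul1r mulr1; apply; lra.
pose S := \sum_(i < N.+1) normc (a i.+1).
have S0 : 0 <= S by apply: sumr_ge0 => i _; exact: normc_ge0.
have split x : \sum_(j < N.+2) (x ^+ j)%:C * a j = a 0%N + x%:C * \sum_(i < N.+1) (x ^+ i)%:C * a i.+1.
  rewrite big_ord_recl expr0 mul1r mulr_sumr; congr (_ + _); apply: eq_bigr => i _.
  by rewrite lift0 exprS rmorphM mulrA.
have a00 : a 0%N = 0.
  apply/eqP; rewrite -normc_eq0 eq_le normc_ge0 andbT.
  apply/ler_addgt0Pl => e e0; rewrite addr0.
  have e1 : 0 < e / 2 by lra.
  have [d d0 hd] := ha _ e1.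
  pose x := Num.min (d / 2) (Num.min 1 (e / (2 * (S + 1)))).
  have x0 : 0 < x by rewrite !lt_min ltr01 !divr_gt0//; lra.
  have xd : x < d by rewrite /x gt_min; apply/orP; left; lra.
  have x1 : x <= 1 by rewrite /x !ge_min lexx orbT.
  have xS : x * S <= e / 2.
    have : x * (S + 1) <= e / 2.
      rewrite -ler_pdivlMr; last by lra.
      rewrite /x !ge_min; apply/orP; right; apply/orP; right.
      by rewrite le_eqVlt; apply/orP; left; apply/eqP; field; lra.
    by move: x0; clearbody x; nra.
  have h1 : normc (\sum_(i < N.+1) (x ^+ i)%:C * a i.+1) <= S.
    apply: le_trans (normc_sum _ _ _) _; apply: ler_sum => i _.
    rewrite Normc.normcM normc_real ger0_norm ?exprn_ge0 ?(ltW x0)//.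
    by rewrite -[leRHS]mul1r ler_wpM2r ?normc_ge0// exprn_ile1// ltW.
  have := hd x; rewrite x0 xd split => /(_ isT) h2.
  have h3 : x ^+ N.+1 <= 1 by rewrite exprn_ile1// ltW.
  set T := \sum_(i < _) _ in h1 h2.
  have h4 := le_normcD (a 0%N + x%:C * T) (- (x%:C * T)).
  move: h4; rewrite addrK normcN Normc.normcM normc_real gtr0_norm// => h4.
  have h5 : e / 2 * x ^+ N.+1 <= e / 2 by rewrite -[leRHS]mulr1 ler_wpM2l// ltW.
  have h6 : x * normc T <= x * S by rewrite ler_wpM2l// ltW.
  lra.
case: j jN => [//|j]; rewrite ltnS => jN.
apply: (IH (fun i => a i.+1)) => // e e0; have [d d0 hd] := ha e e0.
exists d => // x /andP[x0 xd]; have := hd x; rewrite x0 xd split a00 add0r => /(_ isT).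
by rewrite Normc.normcM normc_real gtr0_norm// exprS mulrCA ler_pM2l.
Qed.

(** Uniqueness of the expansion at 0 allows one to read off the inner product with a Hermite
    function from any known expansion of the pairing with the kernel. It is used for the kernel, a
    Hermite term and the dual window. *)
Lemma inner_term_unique f n (b : nat -> R[i]) : L2 f ->
  (forall e, 0 < e -> exists2 d, 0 < d & forall x, 0 < x < d ->
     normc (inner (kernelC x) f - \sum_(j < n.+1) (x ^+ j)%:C * b j) <= e * x ^+ n) ->
  inner (termC n) f = b n.
Proof.
move=> f2 hb; apply/eqP; rewrite -subr_eq0; apply/eqP.
apply: (@poly_little_o n (fun j => inner (termC j) f - b j)) => // e e0.
have e2 : 0 < e / 2 by lra.
have [d d0 hd] := hb _ e2; have [C C0 hC] := inner_kernel_taylor n.+1 f2.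
exists (Num.min d (Num.min 1 (e / (2 * (C + 1))))).
  by rewrite !lt_min d0 ltr01 divr_gt0//; lra.
move=> x; rewrite !lt_min => /andP[x0 /andP[xd /andP[x1 xe]]].
have h1 := hd x; rewrite x0 xd in h1; have {}h1 := h1 isT.
have h2 := hC x; rewrite (ltW x0) (ltW x1) in h2; have {}h2 := h2 isT.
have -> : \sum_(j < n.+1) (x ^+ j)%:C * (inner (termC j) f - b j) =
  (inner (kernelC x) f - \sum_(j < n.+1) (x ^+ j)%:C * b j) -
  (inner (kernelC x) f - \sum_(j < n.+1) (x ^+ j)%:C * inner (termC j) f).
  by under eq_bigr do rewrite mulrBr; rewrite sumrB; ring.
apply: le_trans (le_normcD _ _) _; rewrite normcN.
have h3 : C * x <= e / 2.
  have : x * (C + 1) <= e / 2.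
    rewrite -ler_pdivlMr; last by lra.
    rewrite (le_trans (ltW xe))// le_eqVlt; apply/orP; left; apply/eqP; field; lra.
  nra.
have xn : 0 <= x ^+ n by rewrite exprn_ge0// ltW.
have h4 : C * x ^+ n.+1 <= e / 2 * x ^+ n by rewrite exprS mulrA ler_wpM2r.
rewrite [X in X * _](splitr e) mulrDl; lra.
Qed.

(** The reproducing kernel of the Fock space at real points; completing the square leaves a Gaussian
    centred at [(x + y) / 2]. *)
Lemma inner_kernel x y : inner (kernelC x) (kernelC y) = (expR (pi * x * y))%:C.
Proof.
have p0 := pi_gt0 R; have p2 : 0 < 2 * pi :> R by rewrite mulr_gt0.
have -> : inner (kernelC x) (kernelC y) =
   cint mu (fun t => (Num.sqrt 2 * expR (pi * x * y) * expR (- (2 * pi * (t - (x + y) / 2) ^+ 2)))%:C).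
  apply: eq_cint => t; rewrite /kernelC /bargmann_kernel.
  rewrite conjc_real -rmorphM /=; congr (_%:C).
  have -> : Num.sqrt 2 = 2 `^ 4^-1 * 2 `^ 4^-1 :> R.
    rewrite -powR12_sqrt// -powRD ?pnatr_eq0 ?implybT//; by congr (_ `^ _); field.
  rewrite -[RHS]mulrA.
  have -> : expR (pi * x * y) * expR (- (2 * pi * (t - (x + y) / 2) ^+ 2)) =
    expR (pi * t ^+ 2) * expR (- (2 * pi * (t - x / 2) ^+ 2)) *
    (expR (pi * t ^+ 2) * expR (- (2 * pi * (t - y / 2) ^+ 2))).
    by rewrite -!expRD; congr expR; field.
  ring.
rewrite cint_real RintegralZl//; last exact: (integrable_gauss _ p2).
rewrite /Rintegral integral_gauss//=; congr (_%:C).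
have -> : pi / (2 * pi) = 2^-1 :> R by rewrite invfM mulrCA divff ?mulr1// gt_eqF.
by rewrite mulrAC sqrtrV// divff ?mul1r// gt_eqF// sqrtr_gt0.
Qed.

Lemma expR_taylor n a : 0 <= a -> exists2 C, 0 <= C & forall x, 0 <= x <= 1 ->
  `|expR (a * x) - \sum_(j < n) (a * x) ^+ j / j`!%:R| <= C * x ^+ n.
Proof.
move=> a0; exists (expR a * a ^+ n); first by rewrite mulr_ge0 ?expR_ge0 ?exprn_ge0.
move=> x /andP[x0 x1].
have hM s : `|s - 0| <= `|a * x| -> `|expR s| <= expR a.
  rewrite subr0 (ger0_norm (expR_ge0 _)) ler_expR (ger0_norm (mulr_ge0 a0 x0)) => hs.
  rewrite (le_trans (ler_norm _))// (le_trans hs)// -[leRHS]mulr1; exact: ler_wpM2l.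
have := @taylor_bound (fun _ => expR) (fun _ x => is_derive_expR x) n 0%N 0 (a * x) _ (expR_ge0 a) hM.
rewrite add0r expR0 (ger0_norm (mulr_ge0 a0 x0)) [(a * x) ^+ n]exprMn mulrA.
by under eq_bigr do rewrite mulr1.
Qed.

Lemma inner_term_kernel n y : 0 <= y <= 1 -> inner (termC n) (kernelC y) = ((pi * y) ^+ n / n`!%:R)%:C.
Proof.
move=> y01; have p0 := pi_gt0 R.
have a0 : 0 <= pi * y by rewrite mulr_ge0 ?(ltW p0)//; case/andP: y01.
apply: (inner_term_unique (b := fun j => ((pi * y) ^+ j / j`!%:R)%:C) (L2_kernelC y01)) => e e0.
have [C C0 hC] := expR_taylor n.+1 a0.
exists (Num.min 1 (e / (C + 1))); first by rewrite lt_min ltr01 divr_gt0//; lra.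
move=> x; rewrite lt_min => /andP[x0 /andP[x1 xe]].
have h2 := hC x; rewrite (ltW x0) (ltW x1) in h2; have {}h2 := h2 isT.
have -> : inner (kernelC x) (kernelC y) - \sum_(j < n.+1) (x ^+ j)%:C * ((pi * y) ^+ j / j`!%:R)%:C =
   (expR (pi * y * x) - \sum_(j < n.+1) (pi * y * x) ^+ j / j`!%:R)%:C.
  rewrite inner_kernel rmorphB rmorph_sum /= mulrAC; congr (_ - _); apply: eq_bigr => j _.
  by rewrite -rmorphM; congr (_%:C); rewrite [(_ * x) ^+ j]exprMn; ring.
rewrite normc_real (le_trans h2)// exprS mulrA ler_wpM2r ?exprn_ge0 ?(ltW x0)//.
move: xe; rewrite ltr_pdivlMr; last by lra.
nra.
Qed.

(** The norm comes from expanding [exp (pi x y)] in one variable and then in the other, with no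
    orthogonality relation for Hermite polynomials. *)
Lemma inner_term_term n : inner (termC n) (termC n) = (pi ^+ n / n`!%:R)%:C.
Proof.
pose b j : R[i] := if j == n then (pi ^+ n / n`!%:R)%:C else 0.
have bn : (pi ^+ n / n`!%:R)%:C = b n by rewrite /b eqxx.
rewrite [RHS]bn; apply: inner_term_unique; first exact: L2_termC.
move=> e e0.
exists 1 => // x /andP[x0 x1].
rewrite (_ : _ - _ = 0); first by rewrite Normc.normc0 mulr_ge0 ?exprn_ge0 ?ltW.
rewrite big_ord_recr /= -bn big1 ?add0r; last first.
  by move=> i _; rewrite /b ltn_eqF ?mulr0.
have -> : inner (kernelC x) (termC n) = inner (termC n) (kernelC x).
  by apply: eq_cint => t; rewrite /kernelC /termC !conjc_real mulrC.
rewrite inner_term_kernel ?(ltW x0) ?(ltW x1)// -rmorphM -rmorphB.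
by rewrite exprMn -mulrA mulrCA subrr.
Qed.

End HermiteTaylor.

(** * Gaussian decay *)

Section GaussianDecay.
Context {R : realType}.
Notation mu := (@lebesgue_measure R).
Implicit Types (x t xi : R).

(** A property valid almost everywhere holds along a sequence tending to any given point, since
    intervals are not null. It extends identities between continuous functions from almost
    everywhere to everywhere. *)
Lemma ae_seq (P : R -> Prop) t : {ae mu, forall s, P s} ->
  exists2 y : nat -> R, y @ \oo --> t & forall n, P (y n).
Proof.
move=> [N [mN N0 PN]].
have h (n : nat) : exists y, t <= y <= t + n.+1%:R^-1 /\ P y.
  apply: contrapT => /forallNP hn.
  have d0 : 0 < n.+1%:R^-1 :> R by rewrite invr_gt0.
  have : (mu `[t, (t + n.+1%:R^-1)%R]%classic <= mu N)%E.
    apply: le_measure; rewrite ?inE// => s; rewrite /= in_itv /= => ts; apply: PN => Ps.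
    exact: (hn s).
  rewrite N0 lebesgue_measure_itv /= lte_fin ltrDl d0 -EFinD lee_fin addrAC subrr add0r.
  by rewrite leNgt d0.
have [y hy] := choice h; exists y => [|n]; last by case: (hy n).
apply: (@squeeze_cvgr _ _ _ _ (fun=> t) (fun n : nat => t + n.+1%:R^-1)).
- by apply: nearW => n; case: (hy n).
- exact: cvg_cst.
- rewrite -[X in _ --> X]addr0; apply: cvgD; first exact: cvg_cst.
  exact: cvg_harmonic.
Qed.

Lemma gaussian_prod_le a t x : 0 < a <= pi ->
  expR (- (a * t ^+ 2)) * expR (- (pi * (t - x) ^+ 2)) <=
  expR (- (a / 4 * (x - 0) ^+ 2)) * expR (- (a / 4 * (t - 0) ^+ 2)).
Proof.
move=> /andP[a0 api]; rewrite -!expRD ler_expR !subr0.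
have h1 : a * (t - x) ^+ 2 <= pi * (t - x) ^+ 2 by rewrite ler_wpM2r ?sqr_ge0.
have h2 : 0 <= a * (3 * t - 2 * x) ^+ 2 by rewrite mulr_ge0 ?sqr_ge0// ltW.
have h3 : 0 <= a * x ^+ 2 by rewrite mulr_ge0 ?sqr_ge0// ltW.
have h4 : 0 <= a * t ^+ 2 by rewrite mulr_ge0 ?sqr_ge0// ltW.
have h5 : 0 <= a * (7 * t - 4 * x) ^+ 2 by rewrite mulr_ge0 ?sqr_ge0// ltW.
(* After lowering [pi] to [a], the difference of exponents times 28 is [a] times the sum of squares
   [(7 t - 4 x)^2 + 5 x^2]. *)
have : 0 <= 28 * (a * t ^+ 2 + a * (t - x) ^+ 2 - (a / 4 * x ^+ 2 + a / 4 * t ^+ 2)).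
  rewrite (_ : _ * _ = a * (7 * t - 4 * x) ^+ 2 + 5 * (a * x ^+ 2)); first by rewrite addr_ge0// mulr_ge0.
  by field.
by lra.
Qed.

Variables (gamma : R -> R[i]) (a C : R).
Hypotheses (g2 : L2 gamma) (a0 : 0 < a) (api : a <= pi) (C0 : 0 <= C).
Hypothesis hV : forall p, normc (stft gamma p) <= C * expR (- (a * sqdist p)).

Let mg : cmeas gamma := L2_cmeas g2.

Let conj_gaussian (s : R) : conjc (@gaussian R s) = gaussian s.
Proof. by rewrite gaussian_real conjc_real. Qed.

Definition windowed x t : R[i] := gamma t * gaussian (t - x).

Let conjM (u v : R[i]) : conjc (u * v) = conjc u * conjc v.
Proof. by rewrite rmorphM. Qed.

Lemma windowedE x t : windowed x t = gamma t * conjc (tfshift (x, 0) gaussian t).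
Proof.
rewrite /windowed /tfshift (_ : cexp _ = 1); last by rewrite /= mulr0 mul0r; exact: cexp0.
by rewrite mul1r conj_gaussian.
Qed.

Lemma windowed_cintegrable x : cintegrable mu (windowed x).
Proof.
have := inner_cintegrable g2 (L2_tfshift (x, 0) (@L2_gaussian R)).
by congr (cintegrable mu _); apply/funext => t; rewrite windowedE.
Qed.

Lemma windowed_fourierE x xi t : windowed x t * cexp (0 +i* (- (2 * pi * xi * t))) =
  gamma t * conjc (tfshift (x, xi) gaussian t).
Proof.
rewrite /windowed /tfshift conjM -cexp_conj [gaussian _]gaussian_real conjc_real /=.
by rewrite -mulrA; congr (_ * _); rewrite mulrC.
Qed.

Lemma fourier_windowed x xi : fourier (windowed x) xi = stft gamma (x, xi).
Proof. by apply: eq_cint => t; exact: windowed_fourierE. Qed.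

Let k x xi := C * expR (- (a * x ^+ 2)) * expR (- (a * (xi - 0) ^+ 2)).

Let kI x : mu.-integrable setT (EFin \o k x).
Proof. exact: (integrableZl measurableT (C * expR (- (a * x ^+ 2))) (integrable_gauss 0 a0)). Qed.

Let kint x : (\int[mu]_xi k x xi)%R = C * expR (- (a * x ^+ 2)) * Num.sqrt (pi / a).
Proof.
rewrite RintegralZl//; last exact: (integrable_gauss 0 a0).
by rewrite /Rintegral integral_gauss.
Qed.

Let hk x xi : normc (stft gamma (x, xi)) <= k x xi.
Proof.
apply: (le_trans (hV _)); rewrite /k subr0 -mulrA -expRD /sqdist /=.
by rewrite le_eqVlt; apply/orP; left; apply/eqP; congr (_ * expR _); ring.
Qed.

Let hk' x xi : normc (fourier (windowed x) xi) <= k x xi.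
Proof. by rewrite fourier_windowed. Qed.

Let inv x := inverse_fourier (windowed x).

Let inversion x := fourier_inversion (windowed_cintegrable x) (hk' x) (kI x).

Let gr t : R := complex.Re (@gaussian R t).

Let gr_neq0 t : gr t != 0.
Proof. by rewrite gt_eqF// gaussian_gt0. Qed.

Let cgr : continuous gr.
Proof.
apply: cts_mul; first exact: (cts_cst (c := 2 `^ 4^-1)).
apply: (cts_comp (f := fun t : R => - (pi * t ^+ 2)) _ (@continuous_expR R)).
apply: cts_opp; apply: cts_mul; first exact: (cts_cst (c := pi)).
exact: exprn_continuous.
Qed.

(** Inversion with the window centred at 0, divided by the window. The division spoils the decay,
    which [smooth_versionM] restores by letting the centre vary. *)
Definition smooth_version t : R[i] := inv 0 t * ((gr t)^-1)%:C.

Lemma smooth_version_ae : {ae mu, forall t, gamma t = smooth_version t}.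
Proof.
apply: (@filterS _ _ (ae_filter_ringOfSetsType mu) _ _ _ (inversion 0)) => t e.
rewrite /smooth_version /inv -e /windowed subr0 [gaussian t]gaussian_real -/(gr t).
by rewrite -mulrA -rmorphM /= divff ?mulr1.
Qed.

Let seq_cvg (y : nat -> R) t : y @ \oo --> t ->
  (fun n => smooth_version (y n) : R[i]^o) @ \oo --> (smooth_version t : R[i]^o).
Proof.
move=> yt; apply: cvgcM; first exact: (cvg_inverse_fourier (windowed_cintegrable 0) (hk' 0) (kI 0) yt).
apply/cvgc_ReIm; split => /=; last exact: cvg_cst.
apply: cvgV; first exact: gr_neq0.
exact: (cvg_comp _ _ yt (@cgr t)).
Qed.

Lemma continuous_smooth_version : continuous (smooth_version : R -> R[i]^o).
Proof.
move=> t; apply/cvgc_ReIm; split; apply/(@cvg_nbhsP _ R^o) => y yt.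
  by have /cvgc_ReIm[h _] := seq_cvg yt; exact: h.
by have /cvgc_ReIm[_ h] := seq_cvg yt; exact: h.
Qed.

Lemma cmeas_smooth_version : cmeas smooth_version.
Proof.
apply: cmeasM; first exact: (cmeas_inverse_fourier (windowed_cintegrable 0)).
apply: cmeas_real; apply: continuous_measurableT; exact: (cts_inv cgr gr_neq0).
Qed.

(** Both sides are continuous in [t] and agree almost everywhere, hence everywhere. As the identity
    holds for every centre and at every point, it may be used at [x = t]. *)
Lemma smooth_versionM x t : smooth_version t * gaussian (t - x) = inv x t.
Proof.
have h : {ae mu, forall s, smooth_version s * gaussian (s - x) = inv x s}.
  apply: (@filterS2 _ _ (ae_filter_ringOfSetsType mu) _ _ _ _ smooth_version_ae (inversion x)) => s e1 e2.
  by rewrite -e1 /inv -e2.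
have [y yt hy] := ae_seq t h.
have l1 := cvg_inverse_fourier (windowed_cintegrable x) (hk' x) (kI x) yt.
have l2 : (fun n => smooth_version (y n) * gaussian (y n - x) : R[i]^o) @ \oo -->
    (smooth_version t * gaussian (t - x) : R[i]^o).
  apply: (cvgcM (seq_cvg yt)); apply/cvgc_ReIm; split => /=; last exact: cvg_cst.
  have yx : (fun n => y n - x) @ \oo --> t - x by apply: cvgB => //; exact: cvg_cst.
  exact: (cvg_comp _ _ yx (@cgr (t - x))).
apply: (limc_unique l2); move: l1.
by rewrite (_ : (fun n => _) = (fun n => smooth_version (y n) * gaussian (y n - x) : R[i]^o))//; apply/funext => n; rewrite hy.
Qed.

Let q := 2 `^ 4^-1 : R.
Let q0 : 0 < q. Proof. exact: powR_gt0. Qed.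

Let C1 := C * Num.sqrt (pi / a) / q.

Let C10 : 0 <= C1.
Proof. by rewrite divr_ge0 ?(ltW q0)// mulr_ge0// sqrtr_ge0. Qed.

Lemma smooth_version_bound t : normc (smooth_version t) <= C1 * expR (- (a * t ^+ 2)).
Proof.
have h := normc_inverse_fourier (windowed_cintegrable t) (hk' t) (kI t) t.
rewrite -/(inv t) -smooth_versionM kint Normc.normcM subrr in h.
have e : normc (@gaussian R 0) = q.
  by rewrite /gaussian normc_real expr0n /= mulr0 oppr0 expR0 mulr1 ger0_norm// ltW.
rewrite e -ler_pdivlMr// in h.
by apply: (le_trans h); rewrite le_eqVlt; apply/orP; left; apply/eqP; rewrite /C1; ring.
Qed.

Lemma normc_gaussian t : normc (@gaussian R t) = q * expR (- (pi * t ^+ 2)).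
Proof. by rewrite /gaussian normc_real ger0_norm// mulr_ge0 ?expR_ge0 ?(ltW q0). Qed.

(** The translates [gaussian (t - x)] integrate over [x] to [q], so by Fubini [q] times the Fourier
    transform of [gamma] at [xi] is the integral of [stft gamma (x, xi)] over [x]. *)
Lemma fourier_bound xi : normc (fourier gamma xi) <= C1 * expR (- (a * xi ^+ 2)).
Proof.
have p0 := pi_gt0 R; have a4 : 0 < a / 4 by rewrite divr_gt0.
pose e t : R[i] := cexp (0 +i* (- (2 * pi * xi * t))).
have ne t : normc (e t) = 1 by exact: normc_cexp_i.
have me : cmeas e by apply: cmeas_phase; apply: measurable_funN; exact: measurable_funM.
have ms := cmeas_smooth_version.
pose f (p : R * R) : R[i] := smooth_version p.2 * gaussian (p.2 - p.1) * e p.2.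
have fp x t : f (x, t) = smooth_version t * gaussian (t - x) * e t by [].
have mf : cmeas f.
  apply: cmeasM; last exact: (cmeas_comp me measurable_snd).
  apply: cmeasM; first exact: (cmeas_comp ms measurable_snd).
  by apply: (cmeas_comp (cmeas_gaussian (R := R))); exact: measurable_funB.
pose A x := C1 * q * expR (- (a / 4 * (x - 0) ^+ 2)); pose B t := expR (- (a / 4 * (t - 0) ^+ 2)) : R.
have fb x t : normc (f (x, t)) <= A x * B t.
  rewrite fp 2!Normc.normcM ne mulr1 normc_gaussian /A /B -[leRHS]mulrA.
  have h1 := ler_wpM2r (mulr_ge0 (ltW q0) (expR_ge0 (- (pi * (t - x) ^+ 2)))) (smooth_version_bound t).
  apply: (le_trans h1).
  have h2 := ler_wpM2l (mulr_ge0 C10 (ltW q0)) (@gaussian_prod_le a t x (introT andP (conj a0 api))).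
  by apply: le_trans h2; rewrite le_eqVlt; apply/orP; left; apply/eqP; ring.
have A0 x : 0 <= A x by rewrite mulr_ge0 ?expR_ge0// mulr_ge0// ltW.
have B0 t : 0 <= B t by exact: expR_ge0.
have AI : mu.-integrable setT (EFin \o A) by exact: (integrableZl measurableT (C1 * q) (integrable_gauss 0 a4)).
have [_ _ _ h1 h2] := complex_fubiniL A0 B0 AI (integrable_gauss 0 a4) mf fb.
have hx x : cint mu (fun t => f (x, t)) = stft gamma (x, xi).
  rewrite -fourier_windowed; apply: cint_ae_eqL.
  - by split; [apply: (measurableT_comp mf.1 (measurable_pair1 x))|apply: (measurableT_comp mf.2 (measurable_pair1 x))].
  - by apply: cmeasM => //; exact: cintegrable_cmeas (windowed_cintegrable x).
  - by apply: (@filterS _ _ (ae_filter_ringOfSetsType mu) _ _ _ smooth_version_ae) => t et; rewrite fp /windowed et.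
have ht t : cint mu (fun x => f (x, t)) = q%:C * (smooth_version t * e t).
  have gi : mu.-integrable setT (EFin \o (fun x => q * expR (- (pi * (x - t) ^+ 2)))).
    exact: (integrableZl measurableT q (integrable_gauss t p0)).
  transitivity (cint mu (fun x => smooth_version t * e t * (q * expR (- (pi * (x - t) ^+ 2)))%:C)).
    apply: eq_cint => x; rewrite fp mulrAC; congr (_ * _).
    by rewrite /gaussian -(sqrrN (t - x)) opprB.
  rewrite cintZL; last exact: cintegrable_realL gi.
  rewrite cint_real RintegralZl//; last exact: (integrable_gauss t p0).
  by rewrite /Rintegral integral_gauss//= divff ?gt_eqF// sqrtr1 mulr1 mulrC.
have eI : cintegrable mu (fun t => smooth_version t * e t).
  have bI : mu.-integrable setT (EFin \o (fun t => C1 * expR (- (a * (t - 0) ^+ 2)))).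
    exact: (integrableZl measurableT C1 (integrable_gauss 0 a0)).
  apply: (cintegrable_dominatedL _ _ bI); first exact: cmeasM.
  by move=> t; rewrite Normc.normcM ne mulr1 subr0 smooth_version_bound.
have fE : fourier gamma xi = cint mu (fun t => smooth_version t * e t).
  apply: cint_ae_eqL; [exact: cmeasM|exact: cmeasM|].
  by apply: (@filterS _ _ (ae_filter_ringOfSetsType mu) _ _ _ smooth_version_ae) => t et; rewrite -et.
have key : q%:C * fourier gamma xi = cint mu (fun x => stft gamma (x, xi)).
  rewrite fE -cintZL//; transitivity (cint mu (fun t => cint mu (fun x => f (x, t)))).
    by apply: eq_cint => t; rewrite ht.
  by rewrite h2 -h1; apply: eq_cint => x; rewrite hx.
have mst : cmeas (fun x => stft gamma (x, xi)).
  have ms2 := cmeas_stft mg.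
  by split; [apply: (measurableT_comp ms2.1 (measurable_pair2 xi))|apply: (measurableT_comp ms2.2 (measurable_pair2 xi))].
have hb x : normc (stft gamma (x, xi)) <= k xi x.
  by have := hV (x, xi); rewrite /sqdist /= addrC => h; apply: (le_trans h); rewrite /k subr0 -mulrA -expRD le_eqVlt; apply/orP; left; apply/eqP; congr (_ * expR _); ring.
have := normc_cint_leL (cintegrable_dominatedL mst hb (kI xi)) hb (kI xi).
rewrite -key kint Normc.normcM normc_real gtr0_norm// mulrC -ler_pdivlMr// => h.
by apply: (le_trans h); rewrite le_eqVlt; apply/orP; left; apply/eqP; rewrite /C1; ring.
Qed.

Theorem gaussian_decay : exists gamma0 : R -> R[i],
  [/\ {ae mu, forall t, gamma t = gamma0 t}, continuous (gamma0 : R -> R[i]^o), cmeas gamma0 &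
    exists2 K, 0 <= K & forall t, normc (gamma0 t) <= K * expR (- (a * t ^+ 2)) /\
      normc (fourier gamma t) <= K * expR (- (a * t ^+ 2))].
Proof.
exists smooth_version; split.
- exact: smooth_version_ae.
- exact: continuous_smooth_version.
- exact: cmeas_smooth_version.
- by exists C1 => // t; split; [exact: smooth_version_bound|exact: fourier_bound].
Qed.

End GaussianDecay.

(** * The inner product of the dual window and the Hermite function *)

Section Orthogonality.
Context {R : realType}.
Notation mu := (@lebesgue_measure R).
Implicit Types (x t xi : R).

Variables (gamma g : R -> R[i]) (a C : R).
Hypotheses (g2 : L2 gamma) (h2 : L2 g) (a0 : 0 < a) (api : a <= pi) (C0 : 0 <= C).
Hypothesis hV : forall p, normc (stft gamma p) <= C * expR (- (a * sqdist p)).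

Let q := 2 `^ 4^-1 : R.
Let q0 : 0 < q. Proof. exact: powR_gt0. Qed.
Let conjM (u v : R[i]) : conjc (u * v) = conjc u * conjc v.
Proof. by rewrite rmorphM. Qed.
Let conj_gaussian (s : R) : conjc (@gaussian R s) = gaussian s.
Proof. by rewrite gaussian_real conjc_real. Qed.
Let mg : cmeas g := L2_cmeas h2.

Let cmeas1 (F : R * R -> R[i]) x : cmeas F -> cmeas (fun t : R => F (x, t)).
Proof. by case=> m1 m2; split; [exact: (measurableT_comp m1 (measurable_pair1 x))|exact: (measurableT_comp m2 (measurable_pair1 x))]. Qed.

Lemma cintegrable_windowed_conj x : cintegrable mu (fun t => conjc (g t) * gaussian (t - x)).
Proof.
have := inner_cintegrable (L2_tfshift (x, 0) (@L2_gaussian R)) h2.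
congr (cintegrable mu _); apply/funext => t; rewrite /tfshift (_ : cexp _ = 1).
  by rewrite mul1r mulrC.
by rewrite /= mulr0 mul0r; exact: cexp0.
Qed.

Lemma conj_stft x xi : conjc (stft g (x, xi)) =
  cint mu (fun t => conjc (g t) * gaussian (t - x) * cexp (0 +i* (2 * pi * xi * t))).
Proof.
rewrite /stft /inner -[cintegral _]/(cint mu _) -cint_conj; last first.
  exact: (inner_cintegrable h2 (L2_tfshift (x, xi) (@L2_gaussian R))).
apply: eq_cint => t; rewrite conjM conjcK /tfshift [(x, xi).1]/= [(x, xi).2]/=; ring.
Qed.

(** Parseval's identity for one window centre, obtained from Fubini and the inversion of the
    windowed function: only [stft gamma] needs to be integrable in [xi]. *)
Lemma moyal_slice x : cint mu (fun xi => stft gamma (x, xi) * conjc (stft g (x, xi))) =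
  cint mu (fun t => smooth_version gamma t * conjc (g t) * gaussian (t - x) ^+ 2).
Proof.
pose f (p : R * R) := stft gamma (x, p.1) * (conjc (g p.2) * gaussian (p.2 - x) * cexp (0 +i* (2 * pi * p.1 * p.2))).
have mst := cmeas_stft (L2_cmeas g2).
have mw := cintegrable_cmeas (cintegrable_windowed_conj x).
have mf : cmeas f.
  apply: cmeasM; first exact: (cmeas_comp (cmeas1 x mst) measurable_fst).
  apply: cmeasM; first exact: (cmeas_comp mw measurable_snd).
  by apply: cmeas_phase; apply: measurable_funM => //; exact: measurable_funM.
pose A1 xi := C * expR (- (a * x ^+ 2)) * expR (- (a * (xi - 0) ^+ 2)).
pose B1 t := normc (conjc (g t) * gaussian (t - x)).
have hA xi : normc (stft gamma (x, xi)) <= A1 xi.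
  apply: (le_trans (hV _)); rewrite /A1 subr0 -mulrA -expRD /sqdist /=.
  by rewrite le_eqVlt; apply/orP; left; apply/eqP; congr (_ * expR _); ring.
have fb xi t : normc (f (xi, t)) <= A1 xi * B1 t.
  rewrite /f [(xi, t).1]/= [(xi, t).2]/= Normc.normcM [normc (_ * cexp _)]Normc.normcM normc_cexp_i mulr1.
  by apply: ler_wpM2r => //; exact: normc_ge0.
have A0 xi : 0 <= A1 xi by rewrite !mulr_ge0 ?expR_ge0.
have B0 t : 0 <= B1 t by exact: normc_ge0.
have AI : mu.-integrable setT (EFin \o A1).
  exact: (integrableZl measurableT (C * expR (- (a * x ^+ 2))) (integrable_gauss 0 a0)).
have BI : mu.-integrable setT (EFin \o B1) by exact: (cintegrable_normc (cintegrable_windowed_conj x)).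
have [_ _ _ e1 e2] := complex_fubiniL A0 B0 AI BI mf fb.
transitivity (cint mu (fun xi => cint mu (fun t => f (xi, t)))).
  apply: eq_cint => xi; rewrite conj_stft -cintZL//.
  apply: (cintegrableM_boundedL (M := 1) _ _ (cintegrable_windowed_conj x)); last by move=> t; rewrite normc_cexp_i.
  by apply: cmeas_phase; exact: measurable_funM.
rewrite e1 -e2; apply: eq_cint => t.
transitivity (conjc (g t) * gaussian (t - x) * inverse_fourier (windowed gamma x) t); last first.
  by rewrite -(smooth_versionM g2 a0 hV); ring.
have sI : cintegrable mu (fun xi => stft gamma (x, xi) * cexp (0 +i* (2 * pi * xi * t))).
  apply: (cintegrableM_boundedL (M := 1)).
  - by apply: cmeas_phase; apply: measurable_funM => //; exact: measurable_funM.
  - by move=> xi; rewrite normc_cexp_i.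
  - exact: (cintegrable_dominatedL (cmeas1 x mst) hA AI).
transitivity (conjc (g t) * gaussian (t - x) * cint mu (fun xi => stft gamma (x, xi) * cexp (0 +i* (2 * pi * xi * t)))).
  by rewrite -(cintZL _ sI); apply: eq_cint => xi; rewrite /f [(xi, t).1]/= [(xi, t).2]/=; ring.
by congr (_ * _); apply: eq_cint => xi; rewrite fourier_windowed.
Qed.

(** The orthogonality relation of the short-time Fourier transform: after [moyal_slice], integration
    over [x] produces the squared norm of the window, which is 1. *)
Lemma moyal : cintegrable (mu \x mu)%E (fun p : R * R => stft gamma p * conjc (stft g p)) /\
  cint (mu \x mu)%E (fun p : R * R => stft gamma p * conjc (stft g p)) = inner gamma g.
Proof.
pose Mg := fine (L2norm g * L2norm (@gaussian R))%E.
have Gb p : normc (stft g p) <= Mg.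
  have := inner_cauchy h2 (L2_tfshift p (@L2_gaussian R)).
  rewrite L2norm_tfshift; last exact: L2_cmeas (@L2_gaussian R).
  rewrite -[X in (_ <= X)%E -> _]fineK ?lee_fin//.
  by rewrite fin_numM// L2norm_fin//; exact: L2_gaussian.
have Mg0 : 0 <= Mg by apply: le_trans (Gb (0, 0)); exact: normc_ge0.
pose f (p : R * R) := stft gamma p * conjc (stft g p).
have mf : cmeas f by apply: cmeasM; [exact: cmeas_stft (L2_cmeas g2)|apply: cmeas_conj; exact: cmeas_stft].
pose A1 x := C * Mg * expR (- (a * (x - 0) ^+ 2)); pose B1 xi := expR (- (a * (xi - 0) ^+ 2)) : R.
have fb x xi : normc (f (x, xi)) <= A1 x * B1 xi.
  rewrite /f Normc.normcM normc_conj /A1 /B1 !subr0.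
  have h1 := ler_pM (normc_ge0 _) (normc_ge0 _) (hV (x, xi)) (Gb (x, xi)).
  apply: (le_trans h1); rewrite -[X in _ <= X]mulrA -expRD /sqdist /=.
  by rewrite le_eqVlt; apply/orP; left; apply/eqP; rewrite mulrAC; congr (_ * expR _); ring.
have A0 x : 0 <= A1 x by rewrite !mulr_ge0 ?expR_ge0.
have B0 xi : 0 <= B1 xi by exact: expR_ge0.
have AI : mu.-integrable setT (EFin \o A1) by exact: (integrableZl measurableT (C * Mg) (integrable_gauss 0 a0)).
have [fI _ _ e1 _] := complex_fubiniL A0 B0 AI (integrable_gauss 0 a0) mf fb.
split; first exact: fI.
rewrite -[LHS]e1.
transitivity (cint mu (fun x => cint mu (fun t => smooth_version gamma t * conjc (g t) * gaussian (t - x) ^+ 2))).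
  by apply: eq_cint => x; exact: moyal_slice.
have ms := cmeas_smooth_version g2.
pose h (p : R * R) := smooth_version gamma p.2 * conjc (g p.2) * gaussian (p.2 - p.1) ^+ 2.
have hp x t : h (x, t) = smooth_version gamma t * conjc (g t) * gaussian (t - x) ^+ 2 by [].
have mgs : cmeas (fun p : R * R => gaussian (p.2 - p.1)).
  by apply: (cmeas_comp (cmeas_gaussian (R := R))); exact: measurable_funB.
have mh : cmeas h.
  apply: cmeasM.
    apply: cmeasM; first exact: (cmeas_comp ms measurable_snd).
    exact: (cmeas_comp (cmeas_conj mg) measurable_snd).
  rewrite (_ : (fun p => _) = (fun p : R * R => gaussian (p.2 - p.1) * gaussian (p.2 - p.1))); first exact: cmeasM.
  by apply/funext => p; rewrite expr2.
have a4 : 0 < a / 4 by rewrite divr_gt0.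
(* [gaussian_prod_le] separates the decay in [x] from that in [t]. The part [G] in [t] is
   square-integrable, so its product with [g] is integrable. *)
pose G (t : R) : R[i] := (expR (- (a / 4 * (t - 0) ^+ 2)))%:C.
have G2 : L2 G.
  apply/L2P; split.
    by apply: cmeas_real; apply/measurable_EFinP; exact: (measurable_int mu (integrable_gauss 0 a4)).
  have a2 : 0 < a / 2 by rewrite divr_gt0.
  have := integrable_gauss 0 a2; congr (mu.-integrable _ _); apply/funext => t /=.
  by rewrite /sqnorm normc_real ger0_norm ?expR_ge0// -expRM_natl; congr (expR _)%:E; field.
set K1 := C * Num.sqrt (pi / a) / 2 `^ 4^-1.
have K10 : 0 <= K1 by rewrite divr_ge0 ?powR_ge0// mulr_ge0// sqrtr_ge0.
pose A2 x := K1 * q ^+ 2 * expR (- (a / 4 * (x - 0) ^+ 2)); pose B2 t := normc (G t * conjc (g t)).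
have hb x t : normc (h (x, t)) <= A2 x * B2 t.
  have B2E : B2 t = expR (- (a / 4 * (t - 0) ^+ 2)) * normc (conjc (g t)).
    by rewrite /B2 Normc.normcM /G normc_real (ger0_norm (expR_ge0 _)).
  rewrite hp 2!Normc.normcM normcX normc_gaussian /A2 B2E.
  rewrite -/q; set ng := normc (conjc (g t)).
  have ng0 : 0 <= ng by exact: normc_ge0.
  have s1 := smooth_version_bound g2 a0 hV t.
  have s2 := @gaussian_prod_le R a t x (introT andP (conj a0 api)).
  have s3 : expR (- (pi * (t - x) ^+ 2)) ^+ 2 <= expR (- (pi * (t - x) ^+ 2)).
    rewrite expr2 -[X in _ <= X]mulr1 ler_wpM2l ?expR_ge0// -expR0 ler_expR oppr_le0 mulr_ge0 ?sqr_ge0//.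
    exact: pi_ge0.
  have s4 := ler_pM (normc_ge0 _) (exprn_ge0 2 (expR_ge0 _)) s1 s3.
  have s5 := ler_wpM2l K10 s2.
  rewrite mulrA in s5; have s6 := le_trans s4 s5.
  have s7 := ler_wpM2l (mulr_ge0 ng0 (exprn_ge0 2 (ltW q0))) s6.
  apply: le_trans (le_trans s7 _); rewrite le_eqVlt; apply/orP; left; apply/eqP; first by rewrite exprMn; ring.
  by rewrite -/K1; ring.
have A20 x : 0 <= A2 x by rewrite mulr_ge0 ?expR_ge0// mulr_ge0// exprn_ge0// ltW.
have B20 t : 0 <= B2 t by exact: normc_ge0.
have A2I : mu.-integrable setT (EFin \o A2) by exact: (integrableZl measurableT (K1 * q ^+ 2) (integrable_gauss 0 a4)).
have B2I : mu.-integrable setT (EFin \o B2) by exact: (cintegrable_normc (inner_cintegrable G2 h2)).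
have [_ _ _ e3 e4] := complex_fubiniL A20 B20 A2I B2I mh hb.
transitivity (cint mu (fun x => cint mu (fun t => h (x, t)))); first by [].
rewrite e3 -e4.
have p2 : 0 < 2 * pi :> R by rewrite mulr_gt0 ?pi_gt0.
transitivity (cint mu (fun t => smooth_version gamma t * conjc (g t))).
  apply: eq_cint => t.
  have gi : mu.-integrable setT (EFin \o (fun x => q ^+ 2 * expR (- (2 * pi * (x - t) ^+ 2)))).
    exact: (integrableZl measurableT (q ^+ 2) (integrable_gauss t p2)).
  transitivity (cint mu (fun x => smooth_version gamma t * conjc (g t) * (q ^+ 2 * expR (- (2 * pi * (x - t) ^+ 2)))%:C)).
    apply: eq_cint => x; rewrite hp; congr (_ * _).
    rewrite gaussian_real -rmorphXn /= exprMn -expRM_natl; congr ((_ * expR _)%:C).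
    by rewrite -(sqrrN (t - x)) opprB; ring.
  rewrite cintZL; last exact: cintegrable_realL gi.
  rewrite cint_real RintegralZl//; last exact: (integrable_gauss t p2).
  rewrite /Rintegral integral_gauss// [fine _]/=.
  have -> : pi / (2 * pi) = 2^-1 :> R by rewrite invfM mulrCA divff ?mulr1// gt_eqF// pi_gt0.
  have -> : q ^+ 2 = Num.sqrt 2.
    rewrite -powR12_sqrt// /q -powR_mulrn ?powR_ge0// -powRrM; by congr (_ `^ _); field.
  by rewrite sqrtrV// divff ?mulr1// gt_eqF// sqrtr_gt0.
apply: cint_ae_eqL.
- by apply: cmeasM => //; exact: cmeas_conj.
- by apply: cmeasM; [exact: L2_cmeas|exact: cmeas_conj].
- by apply: (@filterS _ _ (ae_filter_ringOfSetsType mu) _ _ _ (smooth_version_ae g2 a0 hV)) => t ->.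
Qed.

End Orthogonality.

(** * Summation over the lattice and unfolding *)

Section LatticeSum.
Context {R : realType}.
Notation mu := (@lebesgue_measure R).
Notation mu2 := (mu \x mu)%E.
Implicit Types (x t : R) (w p : R * R) (f g : R -> R[i]).

Let conjM (u v : R[i]) : conjc (u * v) = conjc u * conjc v.
Proof. by rewrite rmorphM. Qed.
Let conj_gaussian (s : R) : conjc (@gaussian R s) = gaussian s.
Proof. by rewrite gaussian_real conjc_real. Qed.
Let conj_cexp_i (s : R) : conjc (cexp (0 +i* s)) = cexp (0 +i* (- s)).
Proof. by rewrite -cexp_conj. Qed.

Lemma sum_prod_le (x y u v : R) : 0 <= x -> 0 <= y -> 0 <= u -> 0 <= v -> x * u + y * v <= (x + y) * (u + v).
Proof.
move=> x0 y0 u0 v0; have := mulr_ge0 x0 v0; have := mulr_ge0 y0 u0.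
nra.
Qed.

Lemma sqr_sum_half (x y : R) : (x + y) ^+ 2 / 2 <= x ^+ 2 + y ^+ 2.
Proof. by have := sqr_ge0 (x - y); rewrite sqrrB sqrrD; lra. Qed.

Lemma cint_shift (F : R -> R[i]) (b : R) : cintegrable mu F -> cint mu (fun t => F (t + b)) = cint mu F.
Proof.
move=> [fr fi]; apply: complexP => /=.
  rewrite [RHS](Rintegral_affine b (oner_neq0 R) fr) normr1 mul1r.
  by apply: eq_Rintegral => t _; rewrite mul1r.
rewrite [RHS](Rintegral_affine b (oner_neq0 R) fi) normr1 mul1r.
by apply: eq_Rintegral => t _; rewrite mul1r.
Qed.

Lemma inner_conj f g : L2 f -> L2 g -> inner g f = conjc (inner f g).
Proof.
move=> f2 g2; rewrite /inner -![cintegral _]/(cint mu _) -(cint_conj (inner_cintegrable f2 g2)).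
by apply: eq_cint => t; rewrite conjM conjcK mulrC.
Qed.

Lemma inner_self f : L2 f -> inner f f = (fine (L2norm f) ^+ 2)%:C.
Proof.
move=> f2; rewrite L2normK// -cint_real; apply: eq_cint => t.
by rewrite mulc_conj.
Qed.

Lemma L2norm_gaussian : L2norm (@gaussian R) = 1%:E.
Proof.
have e : @gaussian R = kernelC 0.
  apply/funext => t; rewrite /gaussian /kernelC /bargmann_kernel; congr (_%:C).
  by rewrite -mulrA -expRD mul0r subr0; congr (_ * expR _); ring.
have h := inner_self (@L2_gaussian R).
rewrite {1 2}e inner_kernel mulr0 expR0 in h.
have {}h := congr1 (@complex.Re R) h; rewrite /= in h.
rewrite -(fineK (L2norm_fin (@L2_gaussian R))); congr EFin.
have n0 : 0 <= fine (L2norm (@gaussian R)) by apply: fine_ge0; exact: L2norm_ge0.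
by apply/eqP; rewrite -(@eqrXn2 _ 2)// -h expr1n.
Qed.

Definition psub p w : R * R := (p.1 - w.1, p.2 - w.2).

Lemma inner_tfshift f la w : L2 f -> inner (tfshift la f) (tfshift w (@gaussian R)) =
  cexp (0 +i* (2 * pi * (la.2 - w.2) * la.1)) * stft f (psub w la).
Proof.
move=> f2; have g2 := @L2_gaussian R.
have I1 := inner_cintegrable (L2_tfshift la f2) (L2_tfshift w g2).
have I2 := inner_cintegrable f2 (L2_tfshift (psub w la) g2).
rewrite /stft /inner -![cintegral _]/(cint mu _) -(cintZL _ I2) -(cint_shift la.1 I1).
apply: eq_cint => t; rewrite /tfshift !conjM !conj_cexp_i !conj_gaussian addrK.
have -> : t + la.1 - w.1 = t - (psub w la).1 by rewrite /=; ring.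
set G := gaussian _; set ph := cexp (0 +i* (2 * pi * (la.2 - w.2) * la.1)).
have e : cexp (0 +i* (2 * pi * la.2 * (t + la.1))) * cexp (0 +i* - (2 * pi * w.2 * (t + la.1))) =
   ph * cexp (0 +i* - (2 * pi * (psub w la).2 * t)).
  by rewrite /ph -!cexpD; congr cexp; apply: complexP; rewrite /=; ring.
set e1 := cexp _ in e *; set e2 := cexp _ in e *; set e3 := cexp _ in e *.
transitivity (e1 * e2 * (f t * G)); first by ring.
by rewrite e; ring.
Qed.

Definition cint2_dominated_cvg (F_ : nat -> R * R -> R[i]) (F : R * R -> R[i]) (k : R * R -> R) :=
  @cint_dominated_cvg R _ (measurableTypeR R * measurableTypeR R)%type mu2 F_ F k.

Variables (gamma g : R -> R[i]) (A : 'M[R]_2).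
Hypotheses (gamma2 : L2 gamma) (g2 : L2 g) (hg : L2norm g = 1%:E) (hA : A \in unitmx).
Hypothesis hdual : dual_window g A gamma.

Definition cross_ambiguity p := stft gamma p * conjc (stft g p).

(** The expansion of the shifted Gaussian is paired with that Gaussian itself, of norm 1. Moving the
    lattice shift to the other side creates the same phase in both factors of a term, and the phases
    cancel by conjugation. Cauchy-Schwarz transfers the norm convergence. *)
Lemma cross_ambiguity_sum w :
  (fun F : {fset int * int} => \sum_(m <- F) cross_ambiguity (psub w (lattice_point A m)) : R[i]^o) @ totally --> (1 : R[i]^o).
Proof.
have p2 := L2_tfshift w (@L2_gaussian R).
have pn : L2norm (tfshift w (@gaussian R)) = 1%:E.
  by rewrite L2norm_tfshift ?L2norm_gaussian//; exact: L2_cmeas (@L2_gaussian R).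
set fw := tfshift w _ in p2 pn *.
pose r (F : {fset int * int}) t := fw t - \sum_(m <- F) inner fw (tfshift (lattice_point A m) g) * tfshift (lattice_point A m) gamma t.
have hr : (fun F => L2norm (r F)) @ totally --> 0%E by exact: hdual.
have T2 m : L2 (fun t => inner fw (tfshift (lattice_point A m) g) * tfshift (lattice_point A m) gamma t).
  by apply: L2Z; exact: L2_tfshift.
have S2 (F : {fset int * int}) : L2 (fun t => \sum_(m <- F) inner fw (tfshift (lattice_point A m) g) * tfshift (lattice_point A m) gamma t).
  exact: L2_sum.
have rE F : r F = (fun t => fw t + (-1) * \sum_(m <- F) inner fw (tfshift (lattice_point A m) g) * tfshift (lattice_point A m) gamma t).
  by apply/funext => t; rewrite /r mulN1r.
have r2 F : L2 (r F) by rewrite rE; apply: L2D => //; exact: L2Z.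
have rI F : inner (r F) fw = 1 - \sum_(m <- F) cross_ambiguity (psub w (lattice_point A m)).
  rewrite rE innerDl//; last exact: L2Z.
  rewrite innerZl// inner_sum// inner_self// pn [fine _]/= expr1n mulN1r; congr (_ - _).
  apply: eq_bigr => m _; set la := lattice_point A m.
  have gl := L2_tfshift la g2; have gal := L2_tfshift la gamma2.
  have E0 : inner fw (tfshift la g) = conjc (inner (tfshift la g) fw) := inner_conj gl p2.
  pose ph : R[i] := cexp (0 +i* (2 * pi * (la.2 - w.2) * la.1)).
  have E1 : inner (tfshift la g) fw = ph * stft g (psub w la) := inner_tfshift la w g2.
  have E2 : inner (tfshift la gamma) fw = ph * stft gamma (psub w la) := inner_tfshift la w gamma2.
  transitivity (conjc (inner (tfshift la g) fw) * inner (tfshift la gamma) fw).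
    by rewrite -E0; exact: (innerZl _ gal p2).
  have phn : normc ph = 1 by exact: normc_cexp_i.
  rewrite E1 E2 conjM /cross_ambiguity.
  move: (stft g _) (stft gamma _) => sg sgm.
  transitivity (ph * conjc ph * (sgm * conjc sg)); first by ring.
  by rewrite mulc_conj phn expr1n mul1r.
have fineto : (fun F => fine (L2norm (r F))) @ totally --> (0 : R).
  by have /fine_cvgP[_] := hr.
apply: (cvgc_squeeze _ fineto); apply: nearW => F; rewrite normcB -rI.
have := inner_cauchy (r2 F) p2; rewrite pn mule1 -(fineK (L2norm_fin (r2 F))) lee_fin.
by [].
Qed.

Definition ind01 x : R := \1_(`[0, 1[%classic) x.

Lemma ind01E x : ind01 x = (0 <= x < 1)%R%:R.
Proof. by rewrite /ind01 indicE mem_setE in_itv. Qed.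

Lemma ind01_ge0 x : 0 <= ind01 x.
Proof. by rewrite ind01E ler0n. Qed.

Lemma measurable_ind01 : measurable_fun setT ind01.
Proof. exact: measurable_indic. Qed.

Lemma integral_ind01 : (\int[mu]_x (ind01 x)%:E = 1)%E.
Proof.
have h := @lebesgue_measure_itv R `[0%R, 1%R[; rewrite /= lte_fin ltr01 -EFinD subr0 in h.
by transitivity (mu `[0%R, 1%R[%classic); [rewrite integral_indic// setIT|exact: h].
Qed.

Lemma ind01_shift x (m : int) : ind01 (x + m%:~R) = (m == - Num.floor x)%R%:R.
Proof.
rewrite ind01E; congr (nat_of_bool _)%:R.
have f1 := floor_le_tmp x; have f2 := lt_succ_floor x.
apply/idP/eqP => [/andP[h1 h2]|->].
  apply: oppr_inj; rewrite opprK; apply/esym/floor_def; rewrite intrD rmorphN /=.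
  by apply/andP; split; lra.
rewrite rmorphN /= subr_ge0 f1 /= ltrBlDr addrC.
by move: f2; rewrite intrD.
Qed.

Let mu2f (f1 : R * R -> R) : measurable_fun setT f1 -> measurable_fun setT (fun p => ind01 (f1 p)).
Proof. by move=> m1; exact: (measurableT_comp measurable_ind01 m1). Qed.

(** A triangular change of variables: [y] is replaced by the coordinate [f1], then [x] by [f2], each
    by a one-dimensional affine substitution. *)
Lemma area_ind01 (f1 f2 : R * R -> R) b e c h : b != 0 -> h != 0 ->
  measurable_fun setT f1 -> measurable_fun setT f2 ->
  (forall x t, f1 (x, b * t + e * x) = t) -> (forall x t, f2 (x, b * t + e * x) = (x - c * t) / h) ->
  (\int[mu2]_p (ind01 (f1 p) * ind01 (f2 p))%:E = `|b * h|%:E)%E.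
Proof.
move=> b0 h0 m1 m2 hf1 hf2.
pose F p := (ind01 (f1 p) * ind01 (f2 p))%:E.
have mF : measurable_fun setT F by apply/measurable_EFinP; apply: measurable_funM; exact: mu2f.
have F0 p : (0 <= F p)%E by rewrite lee_fin mulr_ge0 ?ind01_ge0.
rewrite [LHS](@fubini_tonelli1 _ _ (measurableTypeR R) (measurableTypeR R) R mu mu F mF F0) /fubini_F.
pose k (q : R * R) := (ind01 q.2 * ind01 ((q.1 - c * q.2) / h))%:E.
have mk : measurable_fun setT k.
  apply/measurable_EFinP; apply: measurable_funM; apply: mu2f; first exact: measurable_snd.
  by apply: measurable_funM => //; apply: measurable_funB => //; exact: measurable_funM.
have k0 p : (0 <= k p)%E by rewrite lee_fin mulr_ge0 ?ind01_ge0.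
transitivity (\int[mu]_x ((`|b|)%:E * \int[mu]_t k (x, t)))%E.
  apply: eq_integral => x _.
  have mFx : measurable_fun setT (fun y : R => F (x, y)) by exact: (measurableT_comp mF (measurable_pair1 x)).
  rewrite (@ge0_integral_affine R b (e * x) (fun y => F (x, y)) b0 mFx (fun y => F0 (x, y))).
  by congr (_ * _)%E; apply: eq_integral => t _; rewrite /F hf1 hf2.
rewrite ge0_integralZl//; last 2 first.
- exact: (measurable_fun_fubini_tonelli_F (m2 := mu) k mk k0).
- by move=> x _; exact: integral_ge0.
rewrite [X in (_ * X)%E](@fubini_tonelli _ _ (measurableTypeR R) (measurableTypeR R) R mu mu k mk k0).
transitivity ((`|b|)%:E * \int[mu]_t ((`|h|)%:E * (ind01 t)%:E))%E.
  congr (_ * _)%E; apply: eq_integral => t _.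
  have mkt : measurable_fun setT (fun x : R => k (x, t)) by exact: (measurableT_comp mk (measurable_pair2 t)).
  rewrite (@ge0_integral_affine R h (c * t) (fun x => k (x, t)) h0 mkt (fun x => k0 (x, t))).
  congr (_ * _)%E; transitivity (\int[mu]_x ((ind01 t)%:E * (ind01 x)%:E))%E.
    by apply: eq_integral => x _; rewrite /k [(_, t).1]/= [(_, t).2]/= addrK [h * x]mulrC mulfK// EFinM.
  rewrite ge0_integralZl//.
  - by rewrite integral_ind01 mule1.
  - by apply/measurable_EFinP; exact: measurable_ind01.
  - by move=> x _; rewrite lee_fin ind01_ge0.
  - by rewrite lee_fin ind01_ge0.
rewrite ge0_integralZl//.
- by rewrite integral_ind01 mule1 -EFinM normrM.
- by apply/measurable_EFinP; exact: measurable_ind01.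
- by move=> x _; rewrite lee_fin ind01_ge0.
Qed.

Let D := \det A.
Let D0 : D != 0. Proof. by move: hA; rewrite unitmxE unitfE. Qed.
Let DE : D = A 0 0 * A 1 1 - A 0 1 * A 1 0.
Proof.
rewrite /D (expand_det_row A 0) 2!big_ord_recl big_ord0 addr0 /cofactor !det_mx11 !mxE /=.
rewrite expr0 mul1r expr1 mulN1r mulrN.
by congr (_ * A _ _ - A _ _ * A _ _); apply/val_inj.
Qed.

Definition coord1 p : R := (A 1 1 * p.1 - A 0 1 * p.2) / D.
Definition coord2 p : R := (A 0 0 * p.2 - A 1 0 * p.1) / D.

Lemma measurable_coord1 : measurable_fun setT coord1.
Proof. by apply: measurable_funM => //; apply: measurable_funB; exact: measurable_funM. Qed.

Lemma measurable_coord2 : measurable_fun setT coord2.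
Proof. by apply: measurable_funM => //; apply: measurable_funB; exact: measurable_funM. Qed.

(* The indicator function of the fundamental domain A [0, 1)^2. *)
Definition cell p : R := ind01 (coord1 p) * ind01 (coord2 p).

Lemma cell_ge0 p : 0 <= cell p.
Proof. by rewrite mulr_ge0 ?ind01_ge0. Qed.

Lemma measurable_cell : measurable_fun setT cell.
Proof.
apply: measurable_funM; apply: mu2f; [exact: measurable_coord1|exact: measurable_coord2].
Qed.

Lemma integral_cell : (\int[mu2]_p (cell p)%:E = (lattice_area A)%:E)%E.
Proof.
(* The first substitution solves [coord1] for [y] and divides by [A 0 1]. When that entry is 0,
   [coord2] is used instead, as invertibility makes [A 0 0] nonzero. *)
rewrite /lattice_area -/D; have [A0|A0] := eqVneq (A 0 1) 0.
  have a0 : A 0 0 != 0 by apply: contraNneq D0 => z; rewrite DE A0 z !mul0r subrr.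
  transitivity (\int[mu2]_p (ind01 (coord2 p) * ind01 (coord1 p))%:E)%E.
    by apply: eq_integral => p _; rewrite /cell mulrC.
  have b0 : D / A 0 0 != 0 by rewrite mulf_neq0 ?invr_eq0.
  rewrite (@area_ind01 coord2 coord1 (D / A 0 0) (A 1 0 / A 0 0) (A 0 1) (A 0 0) b0 a0 measurable_coord2 measurable_coord1).
  - by rewrite divfK.
  - by move=> x t; rewrite /coord2 [(x, _).1]/= [(x, _).2]/=; field; rewrite ?D0 ?a0.
  - move=> x t; rewrite /coord1 [(x, _).1]/= [(x, _).2]/= A0 !mul0r !subr0.
    have -> : A 1 1 = D / A 0 0 by rewrite DE A0 mul0r subr0 mulrC mulKf.
    by field; rewrite ?D0 ?a0.
have b0 : - D / A 0 1 != 0 by rewrite mulf_neq0 ?invr_eq0 ?oppr_eq0.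
rewrite (@area_ind01 coord1 coord2 (- D / A 0 1) (A 1 1 / A 0 1) (A 0 0) (A 0 1) b0 A0 measurable_coord1 measurable_coord2).
- by rewrite divfK// normrN.
- by move=> x t; rewrite /coord1 [(x, _).1]/= [(x, _).2]/=; field; rewrite ?D0 ?A0.
- move=> x t; rewrite /coord2 [(x, _).1]/= [(x, _).2]/=.
  have h : (A 0 0 * A 1 1 - A 1 0 * A 0 1) = D by rewrite DE; ring.
  rewrite (_ : A 0 0 * (- D / A 0 1 * t + A 1 1 / A 0 1 * x) - A 1 0 * x =
     (- A 0 0 * t * D + (A 0 0 * A 1 1 - A 1 0 * A 0 1) * x) / A 0 1); last by field.
  by rewrite h; field; rewrite ?D0 ?A0.
Qed.

Definition padd p w : R * R := (p.1 + w.1, p.2 + w.2).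

Lemma coord1_add p m : coord1 (padd p (lattice_point A m)) = coord1 p + m.1%:~R.
Proof.
rewrite -[RHS](mulfK D0); congr (_ / _); rewrite mulrDl divfK// /padd /lattice_point /= DE; ring.
Qed.

Lemma coord2_add p m : coord2 (padd p (lattice_point A m)) = coord2 p + m.2%:~R.
Proof.
rewrite -[RHS](mulfK D0); congr (_ / _); rewrite mulrDl divfK// /padd /lattice_point /= DE; ring.
Qed.

Definition cell_index p : int * int := (- Num.floor (coord1 p), - Num.floor (coord2 p)).

Lemma cell_shift p m : cell (padd p (lattice_point A m)) = (m == cell_index p)%:R.
Proof.
rewrite /cell coord1_add coord2_add !ind01_shift -natrM mulnb; congr (nat_of_bool _)%:R.
Qed.

Lemma sum_cell p (F : {fset int * int}) :
  \sum_(m <- F) cell (padd p (lattice_point A m)) = (cell_index p \in F)%:R.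
Proof.
under eq_bigr do rewrite cell_shift.
have [iF|iF] := boolP (cell_index p \in F).
  rewrite (bigD1_seq (cell_index p)) ?fset_uniq//= eqxx big1 ?addr0// => m mi.
  by rewrite (negbTE mi).
rewrite big1_seq// => m /andP[_ mF].
have [e|//] := eqVneq m (cell_index p).
by move: iF; rewrite -e mF.
Qed.

Variables (a C : R).
Hypotheses (a0 : 0 < a) (C0 : 0 <= C).
Hypothesis hV : forall p, normc (stft gamma p) <= C * expR (- (a * sqdist p)).

Let Phi := cross_ambiguity.

Lemma normc_stft_le1 p : normc (stft g p) <= 1.
Proof.
have := inner_cauchy g2 (L2_tfshift p (@L2_gaussian R)).
rewrite hg L2norm_tfshift; last exact: L2_cmeas (@L2_gaussian R).
by rewrite L2norm_gaussian mule1 lee_fin.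
Qed.

Lemma cross_ambiguity_bound p : normc (Phi p) <= C * expR (- (a * sqdist p)).
Proof.
rewrite /Phi /cross_ambiguity Normc.normcM normc_conj -[X in _ <= X]mulr1.
exact: (ler_pM (normc_ge0 _) (normc_ge0 _) (hV p) (normc_stft_le1 p)).
Qed.

Lemma cmeas_cross_ambiguity : cmeas Phi.
Proof.
apply: cmeasM; first exact: (cmeas_stft (L2_cmeas gamma2)).
by apply: cmeas_conj; exact: (cmeas_stft (L2_cmeas g2)).
Qed.

Let al x := C * expR (- (a * (x - 0) ^+ 2)).
Let be x : R := expR (- (a * (x - 0) ^+ 2)).
Let al0 x : 0 <= al x. Proof. by rewrite mulr_ge0 ?expR_ge0. Qed.
Let be0 x : 0 <= be x. Proof. exact: expR_ge0. Qed.
Let alI : mu.-integrable setT (EFin \o al).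
Proof. exact: (integrableZl measurableT C (integrable_gauss 0 a0)). Qed.
Let beI : mu.-integrable setT (EFin \o be).
Proof. exact: (integrable_gauss 0 a0). Qed.

Let albe x y : C * expR (- (a * sqdist (x, y))) = al x * be y.
Proof. by rewrite /al /be -mulrA -expRD !subr0 /sqdist /=; congr (_ * expR _); ring. Qed.

Let shiftI (h : R -> R) b : mu.-integrable setT (EFin \o h) -> mu.-integrable setT (EFin \o (fun x => h (x - b))).
Proof.
move=> hI; have := integrable_affine (- b) (oner_neq0 R) hI.
by congr (mu.-integrable _ _); apply/funext => x /=; rewrite mul1r.
Qed.

Lemma cint2_shift (F : R * R -> R[i]) w : cmeas F -> (forall p, normc (F p) <= C * expR (- (a * sqdist p))) ->
  cintegrable mu2 F /\ cintegrable mu2 (fun p => F (psub p w)) /\ cint mu2 (fun p => F (psub p w)) = cint mu2 F.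
Proof.
move=> mF hF.
have hF1 x y : normc (F (x, y)) <= al x * be y by rewrite -albe.
have [FI FxI _ e1 _] := complex_fubiniL al0 be0 alI beI mF hF1.
pose H p := F (psub p w).
have mH : cmeas H.
  apply: (cmeas_comp mF); apply: measurable_fun_pair; exact: measurable_funB.
have hH x y : normc (H (x, y)) <= al (x - w.1) * be (y - w.2) by exact: hF1.
have [HI _ _ e2 _] := complex_fubiniL (fun x => al0 (x - w.1)) (fun y => be0 (y - w.2)) (shiftI w.1 alI) (shiftI w.2 beI) mH hH.
split; [exact: FI|split; first exact: HI].
rewrite -[LHS]e2 -[RHS]e1 -[RHS](cint_shift (- w.1) FxI).
apply: eq_cint => x; apply: (cint_shift (F := fun y => F (x - w.1, y))).
have mFx : cmeas (fun y : R => F (x - w.1, y)).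
  by case: mF => mr mi; split; [exact: (measurableT_comp mr (measurable_pair1 _))|exact: (measurableT_comp mi (measurable_pair1 _))].
have kI : mu.-integrable setT (EFin \o (fun y => al (x - w.1) * be y)) by exact: (integrableZl measurableT (al (x - w.1)) beI).
exact: (cintegrable_dominatedL mFx (fun y => hF1 _ y) kI).
Qed.

Let beta : R := (`|A 1 1| + `|A 0 1| + `|A 0 0| + `|A 1 0|) / `|D|.
Let beta0 : 0 <= beta. Proof. by rewrite divr_ge0// !addr_ge0. Qed.
Let K : R := C * expR (9 + 9 * beta ^+ 2 / (2 * a)).

(** For a point of the cell, the norm of its lattice translate grows linearly in the index, so
    Gaussian decay beats the inverse cube. The bound is uniform over the cell and dominates the
    lattice sum there. *)
Lemma cross_ambiguity_cell_bound p m : cell p != 0 ->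
  normc (Phi (psub p (lattice_point A m))) <= K * (lsize m ^+ 3)^-1.
Proof.
move=> cp; have [c1 c2] : 0 <= coord1 p < 1 /\ 0 <= coord2 p < 1.
  move: cp; rewrite /cell !ind01E; case: (0 <= coord1 p < 1); case: (0 <= coord2 p < 1) => //=; rewrite ?mulr0 ?mul0r eqxx //.
set v := psub p (lattice_point A m).
have pv : p = padd v (lattice_point A m) by rewrite /padd /v /psub /= !subrK; case: p {cp c1 c2 v}.
have k1 : coord1 p = coord1 v + m.1%:~R by rewrite [in LHS]pv coord1_add.
have k2 : coord2 p = coord2 v + m.2%:~R by rewrite [in LHS]pv coord2_add.
pose s := `|v.1| + `|v.2|; have s0 : 0 <= s by rewrite addr_ge0.
have b1 : `|coord1 v| <= (`|A 1 1| + `|A 0 1|) / `|D| * s.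
  rewrite /coord1 normrM normfV mulrAC ler_wpM2r ?invr_ge0//.
  apply: (le_trans (ler_normB _ _)); rewrite !normrM /s.
  exact: sum_prod_le.
have b2 : `|coord2 v| <= (`|A 0 0| + `|A 1 0|) / `|D| * s.
  rewrite /coord2 normrM normfV mulrAC ler_wpM2r ?invr_ge0//.
  apply: (le_trans (ler_normB _ _)); rewrite !normrM /s.
  by rewrite (addrC `|v.1|); exact: sum_prod_le.
(* Each coordinate of [p] is at most 1 and [lsize] adds another 1, hence 3; [beta] is the operator
   bound for the coordinates of [v]. *)
have ls : lsize m <= 3 + beta * s :> R.
  rewrite /lsize -addn1 !natrD !natr_absz !intr_norm.
  have -> : m.1%:~R = coord1 p - coord1 v by rewrite k1 addrAC subrr add0r.
  have -> : m.2%:~R = coord2 p - coord2 v by rewrite k2 addrAC subrr add0r.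
  have n1 := ler_normB (coord1 p) (coord1 v); have n2 := ler_normB (coord2 p) (coord2 v).
  have q1 : `|coord1 p| <= 1 by rewrite ger0_norm; case/andP: c1 => // _ /ltW.
  have q2 : `|coord2 p| <= 1 by rewrite ger0_norm; case/andP: c2 => // _ /ltW.
  have -> : beta * s = (`|A 1 1| + `|A 0 1|) / `|D| * s + (`|A 0 0| + `|A 1 0|) / `|D| * s by rewrite /beta; ring.
  lra.
have l0 : 0 < lsize m :> R by exact: lsize_gt0.
have l3 : lsize m ^+ 3 <= expR (9 + 3 * (beta * s)) :> R.
  have h1 : lsize m <= expR (3 + beta * s) :> R.
    by apply: (le_trans ls); apply: (le_trans _ (expR_ge1Dx _)); rewrite lerDr.
  have -> : expR (9 + 3 * (beta * s)) = expR (3 + beta * s) ^+ 3 by rewrite -expRM_natl; congr expR; ring.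
  by rewrite lerXn2r ?nnegrE ?expR_ge0 ?(ltW l0).
have sS : s ^+ 2 / 2 <= sqdist v.
  rewrite /s /sqdist -(real_normK (num_real v.1)) -(real_normK (num_real v.2)).
  exact: sqr_sum_half.
(* Completing the square trades the linear term for the quadratic decay; this is the origin of the
   exponent in [K]. *)
have am : 3 * (beta * s) <= 9 * beta ^+ 2 / (2 * a) + a * sqdist v.
  have h : a * (s ^+ 2 / 2) <= a * sqdist v by rewrite ler_wpM2l// ltW.
  have h1 : 0 <= (3 * beta - a * s) ^+ 2 / (2 * a) by rewrite divr_ge0 ?sqr_ge0// mulr_ge0// ltW.
  have h2 : (3 * beta - a * s) ^+ 2 / (2 * a) = 9 * beta ^+ 2 / (2 * a) + a * (s ^+ 2 / 2) - 3 * (beta * s).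
    by field; rewrite gt_eqF.
  by rewrite h2 in h1; lra.
apply: (le_trans (cross_ambiguity_bound v)); rewrite /K -mulrA ler_wpM2l//.
rewrite ler_pdivlMr ?exprn_gt0//.
apply: (le_trans (ler_wpM2l (expR_ge0 _) l3)); rewrite -expRD ler_expR; lra.
Qed.

Lemma integrable_cell : mu2.-integrable setT (EFin \o cell).
Proof.
apply/integrableP; split; first by apply/measurable_EFinP; exact: measurable_cell.
have -> : (\int[mu2]_x `|(EFin \o cell) x| = \int[mu2]_p (cell p)%:E)%E.
  by apply: eq_integral => p _; rewrite /= ger0_norm ?cell_ge0.
by rewrite integral_cell ltry.
Qed.

(** Unfolding: the lattice sum is 1 at every point, so its integral over the cell is the area.
    Translating each term back turns the same integral into that of [Phi] over a union of translated
    cells, which exhausts the plane. *)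
Lemma cint_cross_ambiguity : cint mu2 Phi = (lattice_area A)%:C.
Proof.
pose S N p := \sum_(m <- box N) Phi (psub p (lattice_point A m)).
have mcell : cmeas (fun p => (cell p)%:C) by apply: cmeas_real; exact: measurable_cell.
have mPhi := cmeas_cross_ambiguity.
have mpsub w : measurable_fun setT (fun p : R * R => psub p w).
  by apply: measurable_fun_pair; exact: measurable_funB.
have mpadd w : measurable_fun setT (fun p : R * R => padd p w).
  by apply: measurable_fun_pair; exact: measurable_funD.
have mS N : cmeas (S N).
  by apply: cmeas_sum => m; exact: (cmeas_comp mPhi (mpsub _)).
have mCS N : cmeas (fun p : R * R => (cell p)%:C * S N p) := cmeasM mcell (mS N).
have K0 : 0 <= K by rewrite mulr_ge0 ?expR_ge0.
have l1 : (fun N : nat => cint mu2 (fun p => (cell p)%:C * S N p) : R[i]^o) @ \oo --> ((lattice_area A)%:C : R[i]^o).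
  have -> : (lattice_area A)%:C = cint mu2 (fun p => (cell p)%:C).
    by rewrite cint_real /Rintegral integral_cell.
  apply: (@cint2_dominated_cvg _ _ (fun p => 32 * K * cell p)).
  - by move=> N; exact: mCS.
  - exact: mcell.
  - apply: aeW => p; rewrite -[X in _ --> X]mulr1.
    apply: cvgcM; first exact: cvgc_cst.
    exact: (box_cvg (cross_ambiguity_sum p)).
  - exact: (integrableZl measurableT (32 * K) integrable_cell).
  - move=> N p; rewrite Normc.normcM normc_real ger0_norm ?cell_ge0//.
    have [->|cp] := eqVneq (cell p) 0; first by rewrite mul0r mulr0.
    rewrite mulrC ler_wpM2r ?cell_ge0//.
    apply: (le_trans (normc_sum _ _ _)).
    apply: (@le_trans _ _ (\sum_(m <- box N) K * (lsize m ^+ 3)^-1)).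
      by apply: ler_sum => m _; exact: cross_ambiguity_cell_bound.
    by rewrite -mulr_sumr mulrC ler_wpM2r// sum_lsize_le.
pose Fm m p := (cell (padd p (lattice_point A m)))%:C * Phi p.
have c1 p : cell p <= 1.
  by rewrite /cell !ind01E; case: (0 <= coord1 p < 1); case: (0 <= coord2 p < 1); rewrite /= ?mulr0 ?mul0r ?mulr1.
have mFm m : cmeas (Fm m).
  have mc : cmeas (fun p : R * R => (cell (padd p (lattice_point A m)))%:C) := cmeas_comp mcell (mpadd _).
  exact: (cmeasM mc mPhi).
have bFm m p : normc (Fm m p) <= C * expR (- (a * sqdist p)).
  rewrite /Fm Normc.normcM normc_real ger0_norm ?cell_ge0//.
  apply: le_trans (cross_ambiguity_bound p); rewrite -[X in _ <= X]mul1r ler_wpM2r ?normc_ge0//.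
have shift m := cint2_shift (lattice_point A m) (mFm m) (bFm m).
have Fs m p : Fm m (psub p (lattice_point A m)) = (cell p)%:C * Phi (psub p (lattice_point A m)).
  rewrite /Fm; congr ((cell _)%:C * _).
  by rewrite /padd /psub /= !subrK; case: p.
have [PI _] := cint2_shift (0, 0) mPhi cross_ambiguity_bound.
have e N : cint mu2 (fun p => (cell p)%:C * S N p) = cint mu2 (fun p => (cell_index p \in box N)%:R%:C * Phi p).
  transitivity (\sum_(m <- box N) cint mu2 (Fm m)).
    transitivity (cint mu2 (fun p => \sum_(m <- box N) Fm m (psub p (lattice_point A m)))).
      by apply: eq_cint => p; rewrite /S mulr_sumr; apply: eq_bigr => m _; rewrite Fs.
    rewrite cint_sum; last by move=> m; have [_ []] := shift m.
    by apply: eq_bigr => m _; have [_ []] := shift m.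
  rewrite -cint_sum; last by move=> m; have [] := shift m.
  by apply: eq_cint => p; rewrite /Fm -mulr_suml -sum_cell rmorph_sum.
have mI N : measurable_fun setT (fun p : R * R => (cell_index p \in box N)%:R : R).
  rewrite (_ : (fun p => _) = (fun p => \sum_(m <- box N) cell (padd p (lattice_point A m)))).
    by apply: measurable_sum => m; exact: (measurableT_comp measurable_cell (mpadd _)).
  by apply/funext => p; rewrite sum_cell.
have mIP N : cmeas (fun p : R * R => (cell_index p \in box N)%:R%:C * Phi p) := cmeasM (cmeas_real (mI N)) mPhi.
have l2 : (fun N : nat => cint mu2 (fun p => (cell_index p \in box N)%:R%:C * Phi p) : R[i]^o) @ \oo --> (cint mu2 Phi : R[i]^o).
  apply: (@cint2_dominated_cvg _ _ (fun p => normc (Phi p))).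
  - by move=> N; exact: mIP.
  - exact: mPhi.
  - apply: aeW => p; have [N0 hN0] := sub_box [fset cell_index p]%fset.
    apply: cvg_near_cst; exists N0 => // N /= NN0.
    have /fsubsetP h := hN0 N NN0.
    by rewrite h ?mul1r// inE.
  - exact: (cintegrable_normc PI).
  - move=> N p; rewrite Normc.normcM normc_real; case: (_ \in _); rewrite /= ?normr1 ?normr0 ?mul1r ?mul0r ?normc_ge0//.
apply: (limc_unique l2); move: l1.
by rewrite (_ : (fun N => _) = (fun N : nat => cint mu2 (fun p => (cell_index p \in box N)%:R%:C * Phi p) : R[i]^o))//; apply/funext => N; rewrite e.
Qed.

End LatticeSum.

(** * The dual window *)

Section DualWindow.
Context {R : realType}.
Notation mu := (@lebesgue_measure R).
Implicit Types (x t : R) (f : R -> R[i]).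

Let conjM (u v : R[i]) : conjc (u * v) = conjc u * conjc v.
Proof. by rewrite rmorphM. Qed.

Lemma hermite_scaled (ck : R[i]) n : exists b : R[i], hermite ck n = fun t => b * termC n t.
Proof.
have r0 : 2 `^ 4^-1 * ((- 2^-1) ^+ n / n`!%:R) != 0 :> R.
  apply: mulf_neq0; first by rewrite gt_eqF// powR_gt0.
  apply: mulf_neq0; first by rewrite expf_neq0// oppr_eq0 invr_eq0 pnatr_eq0.
  by rewrite invr_eq0 pnatr_eq0 -lt0n fact_gt0.
exists (ck * (2 `^ 4^-1 * ((- 2^-1) ^+ n / n`!%:R))^-1%:C); apply/funext => t.
rewrite /hermite /termC /hermite_term derive1n_gauss -mulrA -rmorphM; congr (_ * (_)%:C).
move: r0; move: (2 `^ 4^-1) ((- 2^-1) ^+ n / n`!%:R) (expR _) (gauss_deriv n t) => u v e h uv.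
have -> : u * e * h * v = (u * v) * (e * h) by ring.
by rewrite mulKf.
Qed.

Lemma bargmann_real f x : L2 f -> 0 <= x <= 1 -> bargmann f x%:C = conjc (inner (kernelC x) f).
Proof.
move=> f2 x01; have k2 := L2_kernelC x01.
rewrite -(inner_conj k2 f2).
pose E : R[i] := cexp (- (pi%:C * x%:C ^+ 2 / 2)); pose q : R[i] := (2 `^ 4^-1)%:C.
have qE : q * E != 0.
  by rewrite mulf_neq0 ?cexp_neq0// -normc_gt0 normc_real normr_gt0 gt_eqF// powR_gt0.
have e t : f t * conjc (kernelC x t) = (q * E) * (f t * (expR (- (pi * t ^+ 2)))%:C * cexp (2 * pi%:C * t%:C * x%:C)).
  rewrite /kernelC conjc_real.
  have -> : (bargmann_kernel x t)%:C = q * (E * ((expR (- (pi * t ^+ 2)))%:C * cexp (2 * pi%:C * t%:C * x%:C))).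
    rewrite /q /E /bargmann_kernel -!cexp_real -!cexpD (natC 2).
    have -> : - (pi%:C * x%:C ^+ 2 / 2%:R%:C) + ((- (pi * t ^+ 2))%:C + 2%:R%:C * pi%:C * t%:C * x%:C) =
       (- (pi * x ^+ 2 / 2) + (- (pi * t ^+ 2) + 2 * pi * t * x))%:C :> R[i].
      by rewrite !(rmorphD, rmorphN, rmorphM, fmorphV, rmorphXn).
    by rewrite cexp_real -rmorphM -mulrA -expRD; congr ((_ * expR _)%:C); field.
  by ring.
pose I := cintegral (fun t => f t * (expR (- (pi * t ^+ 2)))%:C * cexp (2 * pi%:C * t%:C * x%:C)).
have -> : bargmann f x%:C = q * E * I by [].
have -> : I = (q * E)^-1 * inner f (kernelC x).
  rewrite /inner -[cintegral _]/(cint mu _) -(cintZL _ (inner_cintegrable f2 k2)).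
  by apply: eq_cint => t; rewrite e mulKf.
by rewrite mulVKf.
Qed.

(** Since [pi <= 4], the induction step reduces to [4 (n + 1) <= (n + 2)^2]. The square on the right
    is what bounds the constant by [(n + 1) s]. *)
Lemma pi_fact_le n : pi ^+ n / n`!%:R <= n.+1%:R ^+ 2 :> R.
Proof.
have p4 : pi <= 4 :> R by have := @pihalf_lt2 R; lra.
have p0 := pi_ge0 R.
elim: n => [|n IH]; first by rewrite expr0 fact0 divr1 expr1n.
have f0 : 0 < n`!%:R :> R by rewrite ltr0n fact_gt0.
have n0 : 0 < n.+1%:R :> R by rewrite ltr0n.
rewrite factS natrM exprS.
have -> : pi * pi ^+ n / (n.+1%:R * n`!%:R) = pi / n.+1%:R * (pi ^+ n / n`!%:R) :> R.
  by rewrite invfM; ring.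
have h1 : pi / n.+1%:R * (pi ^+ n / n`!%:R) <= 4 / n.+1%:R * n.+1%:R ^+ 2 :> R.
  apply: ler_pM => //; first by rewrite divr_ge0// ltW.
    by rewrite divr_ge0 ?exprn_ge0// ltW.
  by rewrite ler_wpM2r ?invr_ge0// ltW.
apply: (le_trans h1).
have -> : 4 / n.+1%:R * n.+1%:R ^+ 2 = 4 * n.+1%:R :> R by rewrite expr2 mulrA divfK ?gt_eqF.
rewrite -[n.+2%:R]natr1; move: (n.+1%:R : R) n0 => y y0.
have := sqr_ge0 (y - 1); nra.
Qed.

Lemma normc_expB1_le (l : R[i]) n e : e <= 1 -> normc (l - 1) <= e ->
  normc (l ^+ n - 1) <= e * (n%:R * 2 ^+ n).
Proof.
move=> e1 le; rewrite subrX1 Normc.normcM.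
have e0 : 0 <= e := le_trans (normc_ge0 _) le.
have l2 : normc l <= 2.
  have := le_normcD (l - 1) 1; rewrite subrK Normc.normc1; lra.
apply: ler_pM => //; try exact: normc_ge0.
apply: (le_trans (normc_sum _ _ _)).
have -> : n%:R * 2 ^+ n = \sum_(i < n) (2 ^+ n : R) by rewrite sumr_const card_ord -[RHS]mulr_natl.
apply: ler_sum => i _; rewrite normcX.
apply: (@le_trans _ _ (2 ^+ i)); first by rewrite lerXn2r// nnegrE ?normc_ge0.
by rewrite ler_eXn2l ?ltr1n// ltnW.
Qed.

Variables (n : nat) (A : 'M[R]_2) (w1 w2 ck c : R[i]) (gamma : R -> R[i]).
Hypotheses (hA : A \in unitmx) (hs : n.+1%:R * lattice_area A < 1).
Hypothesis hw : 0 < complex.Im (w2 / w1).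
Hypothesis hL : conj_points (adjoint_lattice (lattice A)) = period_lattice w1 w2.
Hypothesis hck : L2norm (hermite ck n) = 1%:E.
Hypothesis hgamma : L2 gamma.
Hypothesis hdual : dual_window (hermite ck n) A gamma.
Hypothesis hG : forall z : R[i], z != 0 -> bargmann gamma z = c * z^-1 * sigma_mod w1 w2 z ^+ n.+1.

Let s := lattice_area A.
Let rho := n.+1%:R * s.
Let delta := 1 - rho.
Let a := pi * delta / 2.
Let cL := c_const w1 w2.
Let area0 : 0 < period_area w1 w2 := period_area_gt0 hw.
Let s0 : 0 < s.
Proof. by rewrite /s /lattice_area normr_gt0; move: hA; rewrite unitmxE unitfE. Qed.
Let rho0 : 0 < rho. Proof. by rewrite mulr_gt0// ltr0n. Qed.
Let delta0 : 0 < delta. Proof. by rewrite subr_gt0. Qed.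
Let delta1 : delta < 1. Proof. by rewrite /delta ltrBlDr ltrDl. Qed.
Let p0 : 0 < pi :> R := pi_gt0 R.
Let a0 : 0 < a. Proof. by rewrite divr_gt0// mulr_gt0. Qed.
Let api : a <= pi.
Proof. by rewrite /a -mulrA -[X in _ <= X]mulr1 ler_wpM2l ?(ltW p0)//; move: delta1; lra. Qed.

Let g2 : L2 (hermite ck n).
Proof. by have [b ->] := hermite_scaled ck n; apply: L2Z; exact: L2_termC. Qed.

Let alphaE : alpha_const w1 w2 = pi * s / 2.
Proof.
rewrite /alpha_const; have h := adjoint_area hA hw hL.
have -> : period_area w1 w2 = s^-1 by rewrite -[LHS](mulfK (lt0r_neq0 s0)) h mul1r.
by rewrite invfM invrK; ring.
Qed.

Lemma bargmann_growth z : z != 0 ->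
  normc (bargmann gamma z) <= normc c * cL ^+ n.+1 / normc z * expR (pi * rho / 2 * normc z ^+ 2).
Proof.
move=> z0; rewrite (hG z0) 2!Normc.normcM normcX Normc.normcV.
have h : normc (sigma_mod w1 w2 z) ^+ n.+1 <= (cL * expR (alpha_const w1 w2 * normc z ^+ 2)) ^+ n.+1.
  by rewrite lerXn2r ?nnegrE ?mulr_ge0 ?expR_ge0 ?normc_ge0 ?(c_const_ge0 area0) ?sigma_mod_le.
have h2 := ler_wpM2l (mulr_ge0 (normc_ge0 c) (etrans (invr_ge0 (normc z)) (normc_ge0 z))) h.
apply: (le_trans h2); rewrite exprMn -expRM_natl alphaE.
rewrite le_eqVlt; apply/orP; left; apply/eqP.
have -> : n.+1%:R * (pi * s / 2 * normc z ^+ 2) = pi * rho / 2 * normc z ^+ 2 by rewrite /rho; ring.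
by ring.
Qed.

Let K := normc c * cL ^+ n.+1.
Let K_ge0 : 0 <= K.
Proof. by rewrite mulr_ge0 ?normc_ge0// exprn_ge0// c_const_ge0. Qed.

Lemma stft_singular_bound p : 0 < sqdist p ->
  normc (stft gamma p) <= K / Num.sqrt (sqdist p) * expR (- (a * sqdist p)).
Proof.
move=> S0; rewrite (normc_stft _ hgamma); set z := p.1 -i* p.2.
have zS : normc z ^+ 2 = sqdist p by exact: normc_xi.
have z0 : z != 0 by rewrite -normc_gt0 lt_neqAle normc_ge0 andbT eq_sym -sqrf_eq0 zS gt_eqF.
have nz : normc z = Num.sqrt (sqdist p) by rewrite -zS sqrtr_sqr ger0_norm// normc_ge0.
apply: (le_trans (ler_wpM2r (expR_ge0 _) (bargmann_growth z0))).
rewrite -/K zS nz -[X in X <= _]mulrA -expRD le_eqVlt; apply/orP; left; apply/eqP.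
by congr (_ * expR _); rewrite /a /delta; field.
Qed.

Let Ng := fine (L2norm gamma).
Let Ng_ge0 : 0 <= Ng. Proof. by apply: fine_ge0; exact: L2norm_ge0. Qed.

(** [K] serves outside the unit disc, where [|p|^-1 <= 1]. Inside it the transform is at most the
    norm of [gamma], and [expR a] compensates the Gaussian. *)
Let C := K + Ng * expR a.
Let C_ge0 : 0 <= C. Proof. by rewrite addr_ge0// mulr_ge0 ?expR_ge0. Qed.

Lemma stft_gauss_bound p : normc (stft gamma p) <= C * expR (- (a * sqdist p)).
Proof.
have [S1|S1] := leP 1 (sqdist p).
  apply: (le_trans (stft_singular_bound (lt_le_trans ltr01 S1))); rewrite ler_wpM2r ?expR_ge0//.
  have sq1 : 1 <= Num.sqrt (sqdist p) by rewrite -sqrtr1 ler_wsqrtr.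
  rewrite ler_pdivrMr ?(lt_le_trans ltr01)//.
  have h := ler_wpM2l C_ge0 sq1; rewrite mulr1 in h; apply: le_trans h.
  by rewrite /C lerDl mulr_ge0 ?expR_ge0.
have := inner_cauchy hgamma (L2_tfshift p (@L2_gaussian R)).
rewrite L2norm_tfshift; last exact: L2_cmeas (@L2_gaussian R).
rewrite L2norm_gaussian mule1 -(fineK (L2norm_fin hgamma)) lee_fin => h.
apply: (le_trans h); rewrite -/Ng.
have e1 : 1 <= expR a * expR (- (a * sqdist p)).
  by rewrite -expRD -expR0 ler_expR subr_ge0 -[X in _ <= X]mulr1 ler_wpM2l ?(ltW a0)// ltW.
have h1 : Ng * 1 <= Ng * (expR a * expR (- (a * sqdist p))) by rewrite ler_wpM2l.
rewrite mulr1 in h1; apply: (le_trans h1); rewrite mulrA /C mulrDl lerDr.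
by rewrite mulr_ge0 ?expR_ge0.
Qed.

Lemma inner_dual : inner gamma (hermite ck n) = s%:C.
Proof.
have [_ <-] := moyal hgamma g2 a0 api C_ge0 stft_gauss_bound.
exact: (cint_cross_ambiguity hgamma g2 hck hA hdual a0 C_ge0 stft_gauss_bound).
Qed.

(** Near 0 the modified sigma function is [x (1 + o(1))], so the Bargmann transform is
    [c x^n (1 + o(1))]. The conjugate appears because [gamma] is in the second argument. *)
Lemma inner_term_dual : inner (termC n) gamma = conjc c.
Proof.
pose b j : R[i] := if j == n then conjc c else 0.
have bn : conjc c = b n by rewrite /b eqxx.
rewrite [RHS]bn; apply: (inner_term_unique hgamma) => e e0.
have M0 : 0 < (normc c + 1) * (n.+1%:R * 2 ^+ n.+1).
  by rewrite mulr_gt0 ?mulr_gt0 ?ltr0n ?exprn_gt0// ltr_wpDl ?normc_ge0.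
pose e' := Num.min 1 (e / ((normc c + 1) * (n.+1%:R * 2 ^+ n.+1))).
have e'0 : 0 < e' by rewrite lt_min ltr01 divr_gt0.
have [d d0 hd] := sigma_mod_near0 area0 e'0.
exists (Num.min d 1); first by rewrite lt_min d0 ltr01.
move=> x /andP[x0]; rewrite lt_min => /andP[xd x1].
have [|l sl l1] := hd x; first by rewrite x0 xd.
have x01 : 0 <= x <= 1 by rewrite !ltW.
have xC : x%:C != 0 :> R[i] by rewrite -normc_gt0 normc_real gtr0_norm.
have kE : inner (kernelC x) gamma = conjc (c * (x ^+ n)%:C * l ^+ n.+1).
  rewrite -[LHS]conjcK -(bargmann_real hgamma x01) (hG xC) sl exprMn exprS.
  have -> : (x ^+ n)%:C = x%:C ^+ n :> R[i] by rewrite rmorphXn.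
  congr conjc; move: (x%:C) (l ^+ n.+1) xC => y L y0; move: (y ^+ n) => Y.
  transitivity (y^-1 * y * (c * Y * L)); first by ring.
  by rewrite mulVf// mul1r.
rewrite big_ord_recr /= -bn big1 ?add0r; last by move=> i _; rewrite /b ltn_eqF ?mulr0.
have -> : inner (kernelC x) gamma - (x ^+ n)%:C * conjc c = conjc (c * (x ^+ n)%:C * (l ^+ n.+1 - 1)).
  have -> : (x ^+ n)%:C * conjc c = conjc (c * (x ^+ n)%:C) by rewrite conjM conjc_real mulrC.
  have conjB (u v : R[i]) : conjc u - conjc v = conjc (u - v) by rewrite rmorphB.
  by rewrite kE conjB mulrBr mulr1.
rewrite normc_conj 2!Normc.normcM normc_real (ger0_norm (exprn_ge0 n (ltW x0))).
have h := normc_expB1_le (e := e') (l := l) n.+1.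
have {}h : normc (l ^+ n.+1 - 1) <= e' * (n.+1%:R * 2 ^+ n.+1).
  by apply: h; [rewrite /e' ge_min lexx|exact: ltW].
have h2 : e' * ((normc c + 1) * (n.+1%:R * 2 ^+ n.+1)) <= e.
  by rewrite -ler_pdivlMr// /e' ge_min lexx orbT.
have xn : 0 <= x ^+ n by rewrite exprn_ge0// ltW.
have h3 : normc c * normc (l ^+ n.+1 - 1) <= e.
  apply: le_trans h2; rewrite mulrCA; apply: ler_pM; rewrite ?normc_ge0//.
  by rewrite lerDl.
by rewrite mulrAC ler_wpM2r.
Qed.

(** With [b] the factor between the Hermite function and the Taylor term, normalization gives
    [|b|^2 pi^n / n! = 1] and [inner_dual] gives [|c| |b| = s]; eliminating [b] determines [|c|]. *)
Lemma normc_constant : 0 < normc c <= rho.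
Proof.
have [b hb] := hermite_scaled ck n.
have t2 := L2_termC (R := R) n.
have e1 : normc b ^+ 2 * (pi ^+ n / n`!%:R) = 1.
  have := inner_self g2; rewrite hck [fine _]/= expr1n hb innerZl//; last exact: L2Z.
  rewrite (inner_conj (L2Z b t2) t2) innerZl// conjM inner_term_term conjc_real mulrA mulc_conj -rmorphM.
  by move/(congr1 (@complex.Re R)).
have e2 : normc c * normc b = s.
  have := inner_dual; rewrite hb (inner_conj (L2Z b t2) hgamma) innerZl// inner_term_dual conjM conjcK.
  by move/(congr1 (@normc R)); rewrite Normc.normcM normc_conj normc_real (ger0_norm (ltW s0)) mulrC.
have b0 : 0 < normc b.
  rewrite lt_neqAle normc_ge0 andbT; apply/eqP => b0.
  by move: e2; rewrite -b0 mulr0 => z; move: s0; rewrite -z ltxx.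
have c0 : 0 < normc c.
  rewrite lt_neqAle normc_ge0 andbT; apply/eqP => c0.
  by move: e2; rewrite -c0 mul0r => z; move: s0; rewrite -z ltxx.
rewrite c0 /= -(@ler_pXn2r _ 2)// ?nnegrE ?(ltW c0) ?(ltW rho0)//.
have h : normc c ^+ 2 = s ^+ 2 * (pi ^+ n / n`!%:R).
  by rewrite -e2 exprMn -mulrA e1 mulr1.
rewrite h /rho exprMn mulrC ler_wpM2r ?sqr_ge0//.
exact: pi_fact_le.
Qed.

Let cL0 : 0 < cL.
Proof.
rewrite lt_neqAle c_const_ge0// andbT; apply/eqP => cL0.
have h2 : 0 < 2^-1 :> R by rewrite invr_gt0.
have [d d0 hd] := sigma_mod_near0 area0 h2.
have [|l sl l1] := hd (d / 2); first by rewrite divr_gt0//= ltr_pdivrMr// ltr_pMr// ltr1n.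
have := sigma_mod_le area0 (d / 2)%:C; rewrite -/cL -cL0 mul0r => sm.
have s00 : sigma_mod w1 w2 (d / 2)%:C = 0 by apply/eqP; rewrite -normc_eq0 eq_le sm normc_ge0.
have l0 : l = 0.
  apply/eqP; move/eqP: s00; rewrite sl mulf_eq0 => /orP[|//].
  rewrite -normc_eq0 normc_real normr_eq0 => /eqP dd; move: d0; rewrite -(divfK (_ : 2 != 0) d) ?pnatr_eq0// dd mul0r ltxx//.
by move: l1; rewrite l0 sub0r normcN Normc.normc1; lra.
Qed.

(** The integral constant equals [pi / u] with [u^2 = delta / 2]. From [|c| <= 1 - delta], [pi <= 4]
    and [(1 - delta) u <= 1 / 2] one gets [|c| pi u <= 2]; dividing by [u^2] gives [4 / delta]. *)
Lemma M1norm_dual : (M1norm gamma <= (4 * cL ^+ n.+1 * (1 / delta))%:E)%E.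
Proof.
have /andP[c0 cr] := normc_constant.
have K0 : 0 < K by rewrite mulr_gt0// exprn_gt0.
apply: (le_trans (M1norm_le a0 K0 (L2_cmeas hgamma) stft_singular_bound)); rewrite lee_fin.
pose u := Num.sqrt (delta / 2).
have u0 : 0 < u by rewrite sqrtr_gt0 divr_gt0.
have uu : delta = 2 * u ^+ 2 by rewrite sqr_sqrtr ?divr_ge0 ?(ltW delta0)// mulrC divfK.
have sp : 0 < Num.sqrt pi :> R by rewrite sqrtr_gt0.
have sa : Num.sqrt a = Num.sqrt pi * u by rewrite /a -mulrA sqrtrM ?(ltW p0).
have -> : pi * Num.sqrt pi / Num.sqrt a = pi / u.
  by rewrite sa; field; rewrite (gt_eqF u0) (gt_eqF sp).
have p4 : pi <= 4 :> R by have := @pihalf_lt2 R; lra.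
have key : normc c * (pi / u) <= 4 * (1 / delta).
  have rd : rho = 1 - delta by rewrite /delta; ring.
  have h1 : normc c * pi <= (1 - delta) * 4.
    by rewrite -rd; apply: ler_pM => //; [exact: normc_ge0|exact: ltW].
  (* After squaring, this is an elementary cubic inequality in [delta] on the unit interval. *)
  have h2 : (1 - delta) * u <= 1 / 2.
    rewrite -(@ler_pXn2r _ 2)// ?nnegrE ?mulr_ge0 ?subr_ge0 ?(ltW delta1) ?(ltW u0) ?divr_ge0//.
    have -> : ((1 - delta) * u) ^+ 2 = (1 - delta) ^+ 2 * (delta / 2) by rewrite exprMn sqr_sqrtr// divr_ge0// ltW.
    by move: delta0 delta1; move: delta => v v0 v1; nra.
  rewrite [X in X <= _]mulrA ler_pdivrMr// mul1r [X in _ <= X]mulrAC ler_pdivlMr// uu.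
  have h3 : normc c * pi * u <= (1 - delta) * 4 * u by rewrite ler_wpM2r// ltW.
  have h4 : (1 - delta) * 4 * u <= 2 by move: h2; lra.
  have h5 : normc c * pi * u <= 2 := le_trans h3 h4.
  have h6 := ler_wpM2l (ltW u0) h5.
  have -> : normc c * pi * (2 * u ^+ 2) = 2 * (u * (normc c * pi * u)) by ring.
  have -> : 4 * u = 2 * (u * 2) by ring.
  by rewrite ler_pM2l.
rewrite /K.
have cn : 0 <= cL ^+ n.+1 by rewrite exprn_ge0// ltW.
have h := ler_wpM2r cn key.
by apply: le_trans (le_trans h _); rewrite le_eqVlt; apply/orP; left; apply/eqP; ring.
Qed.

Lemma L2norm_dual_gt0 : 0 < fine (L2norm gamma).
Proof.
rewrite -/Ng lt_neqAle Ng_ge0 andbT; apply/eqP => z.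
have := inner_cauchy hgamma g2; rewrite hck mule1 inner_dual normc_real (ger0_norm (ltW s0)).
rewrite -(fineK (L2norm_fin hgamma)) lee_fin -/Ng -z => h.
by move: s0; rewrite ltNge h.
Qed.

Lemma kappa_le : pi * (delta / (3 - rho)) <= a.
Proof.
have d3 : 0 < 3 - rho by move: delta0; rewrite /delta; lra.
rewrite /a -mulrA ler_wpM2l ?(ltW p0)// ler_wpM2l ?(ltW delta0)// lef_pV2 ?posrE//.
by move: delta0; rewrite /delta; lra.
Qed.

Lemma dual_decay : exists gamma0 : R -> R[i],
  [/\ {ae lebesgue_measure, forall t : R, gamma0 t = gamma t},
      continuous (gamma0 : R -> R[i]^o) &
      exists C : R, 0 < C /\
        forall t : R, normc (gamma0 t) + normc (fourier gamma t)
                      <= C * expR (- (pi * (delta / (3 - rho)) * t ^+ 2))].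
Proof.
have [gamma0 [hae hc _ [M M0 hM]]] := gaussian_decay hgamma a0 api C_ge0 stft_gauss_bound.
exists gamma0; split => //.
  by apply: (@filterS _ _ (ae_filter_ringOfSetsType mu) _ _ _ hae) => t ->.
exists (2 * M + 1); split; first by rewrite ltr_wpDl// mulr_ge0.
move=> t; have [h1 h2] := hM t.
have e : expR (- (a * t ^+ 2)) <= expR (- (pi * (delta / (3 - rho)) * t ^+ 2)).
  by rewrite ler_expR lerN2 ler_wpM2r ?sqr_ge0// kappa_le.
have e0 := expR_ge0 (- (pi * (delta / (3 - rho)) * t ^+ 2)).
move: e e0 h1 h2; move: (expR _) (expR _) => u v; nra.
Qed.

End DualWindow.

Theorem lemma4p4 (R : realType) (n : nat) (A : 'M[R]_2)
    (w1 w2 ck c : R[i]) (gamma : R -> R[i])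
    (hA : A \in unitmx)
    (hs : n.+1%:R * lattice_area A < 1)
    (* (w1, w2) is a positively oriented basis of the conjugate of the adjoint lattice *)
    (hw : 0 < complex.Im (w2 / w1))
    (hL : conj_points (adjoint_lattice (lattice A)) = period_lattice w1 w2)
    (hck : L2norm (hermite ck n) = 1%:E)
    (hgamma : L2 gamma)
    (hdual : dual_window (hermite ck n) A gamma)
    (* at z = 0 the right-hand side has a removable singularity *)
    (hG : forall z : R[i], z != 0 ->
       bargmann gamma z = c * z^-1 * sigma_mod w1 w2 z ^+ n.+1) :
  let delta : R := 1 - n.+1%:R * lattice_area A in
  let kappa : R := delta / (3 - n.+1%:R * lattice_area A) in
  [/\ (* pointwise values of gamma are those of its continuous representative *)
      exists gamma0 : R -> R[i],
        [/\ {ae lebesgue_measure, forall t : R, gamma0 t = gamma t},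
            continuous (gamma0 : R -> R[i]^o) &
            exists C : R, 0 < C /\
              forall t : R, normc (gamma0 t) + normc (fourier gamma t)
                            <= C * expR (- (pi * kappa * t ^+ 2))],
      (M1norm gamma <= (4 * c_const w1 w2 ^+ n.+1 * (1 / delta))%:E)%E &
      exists c1 c2 : R,
        [/\ 0 < c1, 0 < c2 &
            c1 <= fine (L2norm gamma) ^+ 2 / ln (1 / delta) <= c2]].
Proof.
move=> delta kappa.
split.
- rewrite /kappa /delta; eapply dual_decay; eassumption.
- rewrite /delta; eapply M1norm_dual; eassumption.
have s0 : 0 < lattice_area A.
  by rewrite /lattice_area normr_gt0; move: hA; rewrite unitmxE unitfE.
have d0 : 0 < delta by rewrite subr_gt0.
have d1 : delta < 1 by rewrite /delta ltrBlDr ltrDl mulr_gt0.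
have l0 : 0 < ln (1 / delta) by rewrite ln_gt0// mul1r invf_gt1.
have q0 : 0 < fine (L2norm gamma) ^+ 2 / ln (1 / delta).
  have g0 : 0 < fine (L2norm gamma) by eapply L2norm_dual_gt0; eassumption.
  by rewrite divr_gt0// exprn_gt0.
exists (fine (L2norm gamma) ^+ 2 / ln (1 / delta)), (fine (L2norm gamma) ^+ 2 / ln (1 / delta)).
by split; rewrite ?lexx.
Qed.
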